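(* Let $E$ be a real Banach space, $H$ a real separable Hilbert space, $S=(S(t))_{t\ge 0}$ a $C_0$-semigroup on $E$, $B\in\mathscr{L}(H,E)$ a bounded linear operator and $W_H$ an $H$-cylindrical Brownian motion. Assume that $s\mapsto S(s)B$ is stochastically integrable with respect to $W_H$ on every interval $[0,T]$. Let $t>0$, $x\in E$, $\xi\in\mathscr{D}_t$, and let $a\in W^{1,\infty}(0,t)$ satisfy $a(0+)=0$ and $a(t-)=1$. Then, for every bounded Borel function $f:E\to\mathbb{R}$, the derivative $D_\xi P_tf(x):=\frac{\mathrm{d}}{\mathrm{d}\varepsilon}\big|_{\varepsilon=0}P_tf(x+\varepsilon\xi)$ exists and $$D_\xi P_tf(x)=\mathbb{E}\Bigl[f(U_t^x)\int_0^t\bigl(a'(s)B^\dagger S(s)\xi\,\big|\,\mathrm{d}W_H(s)\bigr)_H\Bigr].$$ The stochastic integral is the real Gaussian random variable $W_t(v_a^\xi)$, where $v_a^\xi(s):=a'(s)B^\dagger S(s)\xi$ for $0<s<t$. If $f\in C^1_{\rm b}(E)$, then the same derivative is also given by $$D_\xi P_tf(x)=\mathbb{E}\,\langle S(t)\xi,Df(U_t^x)\rangle .$$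
   Context: $E_B:=\operatorname{Ran}(B)$, equipped with the Hilbert norm transported from $(\operatorname{Ker}B)^\perp\subseteq H$, i.e. $\|Bh\|_{E_B}=\|h\|_H$ for $h\in(\operatorname{Ker}B)^\perp$. Thus $B$ restricts to an isometry from $(\operatorname{Ker}B)^\perp$ onto $E_B$; its inverse is denoted $B^\dagger:E_B\to(\operatorname{Ker}B)^\perp\subseteq H$. For $t>0$ the space of admissible directions is $\mathscr{D}_t:=\{\xi\in E:\ S(\cdot)\xi\in L^2(0,t;E_B)\}$, i.e. $S(s)\xi\in E_B$ for almost all $s\in(0,t)$ and $\int_0^t\|S(s)\xi\|_{E_B}^2\,\mathrm{d}s<\infty$. For $\xi\in\mathscr{D}_t$ one has $v_a^\xi\in L^2(0,t;H)$. $a(0+)$, $a(t-)$ denote the one-sided limits at the end points of the (Lipschitz) continuous representative of $a$. $\langle x,x^*\rangle$ is the duality pairing of $x\in E$, $x^*\in E^*$. $C^1_{\rm b}(E)$ is the space of bounded Fréchet differentiable functions $f:E\to\mathbb{R}$ whose derivative $Df:E\to E^*$ is bounded and continuous. An $H$-cylindrical Brownian motion is a family $W_H(t):H\to L^2(\Omega)$, $t\ge 0$, of bounded linear operators such that all vectors $(W_H(t_1)h_1,\dots,W_H(t_N)h_N)$ are centred Gaussian and $\mathbb{E}(W_H(s)g\,W_H(t)h)=(s\wedge t)(g|h)_H$. For a real separable Hilbert space $\mathscr{H}$, an $\mathscr{H}$-isonormal Gaussian process is a bounded linear operator $W:\mathscr{H}\to L^2(\Omega)$ such that all vectors $(Wh_1,\dots,Wh_N)$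 are centred Gaussian and $\mathbb{E}(Wg\,Wh)=(g|h)_{\mathscr{H}}$. The formula $W(\mathbf{1}_{(a,b]}\otimes h)=W_H(b)h-W_H(a)h$ extends uniquely to an $L^2(\mathbb{R}_+;H)$-isonormal process $W$; its restriction to $L^2(0,t;H)$ (functions extended by zero) is denoted $W_t$, and one writes $\int_0^t(f(s)|\mathrm{d}W_H(s))_H:=W_t(f)$ for $f\in L^2(0,t;H)$. A bounded operator $R:\mathscr{H}\to E$ is $\gamma$-radonifying, $R\in\gamma(\mathscr{H},E)$, if for one (equivalently every) orthonormal basis $(h_n)$ of $\mathscr{H}$ and independent standard Gaussians $(\gamma_n)$ the series $\sum_n\gamma_nRh_n$ converges in $L^2(\Omega;E)$. Given such $R$ and an $\mathscr{H}$-isonormal process $W$, $X_R$ denotes the (a.s. unique) centred $E$-valued Gaussian random variable with $\langle X_R,x^*\rangle=W(R^*x^* )$ for all $x^*\in E^*$. A function $\Phi:\mathbb{R}_+\to\mathscr{L}(H,E)$ is stochastically integrable with respect to $W_H$ if $s\mapsto\langle\Phi(s)h,x^*\rangle$ is square integrable for all $h\in H$, $x^*\in E^*$, and there is $I_\Phi\in\gamma(L^2(\mathbb{R}_+;H),E)$ with $\langle I_\Phi(\mathbf{1}_{[a,b)}\otimes h),x^*\rangle=\int_a^b\langle\Phi(s)h,x^*\rangle\,\mathrm{d}s$ for all $0\le a<b<\infty$, $h\in H$, $x^*\in E^*$; then $\int_0^\infty\Phi\,\mathrm{d}W_H:=X_{I_\Phi}$. Integrability on a finite interval is defined by extending by zero.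 Stochastic integrability of $s\mapsto S(s)B$ on $[0,t]$ implies that of $s\mapsto S(t-s)B$ on $[0,t]$; the associated $\gamma$-radonifying operator is $R_t:L^2(0,t;H)\to E$, $R_tv=\int_0^tS(t-s)Bv(s)\,\mathrm{d}s$. The stochastic convolution is $W_A(t):=\int_0^tS(t-s)B\,\mathrm{d}W_H(s)=X_{R_t}$ (formed with $W_t$). For $x\in E$ put $U_t^x:=S(t)x+W_A(t)$, and for bounded Borel $f:E\to\mathbb{R}$ put $P_tf(x):=\mathbb{E}f(U_t^x)$. *)

(* Defs.v *)
From HB Require Import structures.
From mathcomp Require Import all_boot all_order all_algebra sesquilinear finmap.
From mathcomp Require Import all_classical all_reals all_analysis.

Set Implicit Arguments.
Unset Strict Implicit.
Unset Printing Implicit Defensive.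

Import Order.TTheory GRing.Theory Num.Theory.
Import numFieldNormedType.Exports.

Local Open Scope classical_set_scope.
Local Open Scope ring_scope.

Definition borelType (T : ptopologicalType) := g_sigma_algebraType (@open T).

Definition separable (T : topologicalType) : Prop :=
  exists2 C : set T, countable C & dense C.

(* Strong measurability in the form given by the Pettis theorem: Borel
   measurability and separable range. *)
Definition strongly_measurable {R : realType} {V : normedModType R}
    {d : measure_display} {T : measurableType d} (D : set T) (f : T -> V) :
    Prop :=
  measurable_fun D (f : T -> borelType V) /\
  exists2 C : set V, countable C & f @` D `<=` closure C.

Section gaussian.
Context {R : realType} {d : measure_display} {Omega : measurableType d}.
Variable P : probability Omega R.

(* The degenerate case is separated because [normal_prob m 0] is not a Dirac
   mass in the library. *)
Definition centred_gaussian (X : Omega -> R) : Prop :=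
  measurable_fun setT X /\
  ((forall A : set R, measurable A -> P (X @^-1` A) = \d_(0 : R) A) \/
   exists2 s : R, 0 < s &
     forall A : set R, measurable A -> P (X @^-1` A) = normal_prob 0 s A).

Definition centred_gaussian_vector (n : nat) (X : 'I_n -> Omega -> R) : Prop :=
  forall c : 'I_n -> R, centred_gaussian (fun w => \sum_(i < n) c i * X i w).

Definition standard_gaussian (X : Omega -> R) : Prop :=
  measurable_fun setT X /\
  forall A : set R, measurable A -> P (X @^-1` A) = normal_prob 0 1 A.

Definition independent_sequence (X : nat -> Omega -> R) : Prop :=
  forall (J : {fset nat}) (A : nat -> set R),
    (forall n, measurable (A n)) ->
    P (\bigcap_(n in [set` J]) (X n @^-1` A n)) =
    (\prod_(n <- J) P (X n @^-1` A n))%E.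

End gaussian.

Section L2.
Context {R : realType} {H : completeNormedModType R}.
Variable ip : {dot H for (@idfun R)}.
Notation mu := (@lebesgue_measure R).

(* Elements of L^2(D; H) are handled through Borel representatives; operators
   and processes on L^2(D; H) take such representatives as arguments, and
   their bounds below force them to respect equality almost everywhere. *)
Definition L2 (D : set R) (f : R -> H) : Prop :=
  strongly_measurable (D : set (measurableTypeR R)) f /\
  (\int[mu]_(s in D) (`|f s| ^+ 2)%:E < +oo)%E.

Definition L2ip (D : set R) (f g : R -> H) : R :=
  \int[mu]_(s in D) ip (f s) (g s).

Definition L2norm (D : set R) (f : R -> H) : R := Num.sqrt (L2ip D f f).

Definition tensor (A : set R) (h : H) : R -> H := fun s => \1_A s *: h.

(* The index set [I] allows for finite or empty bases (the case H = 0). *)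
Definition L2_orthonormal_basis (D : set R) (I : set nat) (e : nat -> R -> H) :
    Prop :=
  [/\ forall n, I n -> L2 D (e n),
      forall m n, I m -> I n -> L2ip D (e m) (e n) = (m == n)%:R &
      forall f, L2 D f -> (forall n, I n -> L2ip D f (e n) = 0) ->
        L2norm D f = 0].

Context {E : completeNormedModType R}.

Definition L2_bounded_linear (D : set R) (L : (R -> H) -> E) : Prop :=
  (forall (c : R) (f g : R -> H), L2 D f -> L2 D g ->
     L (fun s => c *: f s + g s) = c *: L f + L g) /\
  exists C : R, forall f, L2 D f -> `|L f| <= C * L2norm D f.

Definition gamma_radonifying (D : set R) (L : (R -> H) -> E) : Prop :=
  L2_bounded_linear D L /\
  exists (I : set nat) (e : nat -> R -> H), L2_orthonormal_basis D I e /\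
  exists (d' : measure_display) (Omega' : measurableType d')
    (P' : probability Omega' R) (g : nat -> Omega' -> R),
    [/\ forall n, standard_gaussian P' (g n),
        independent_sequence P' g &
        exists2 Y : Omega' -> E, strongly_measurable setT Y &
          (fun N : nat => \int[P']_w
             (`|\sum_(0 <= n < N | n \in I) g n w *: L (e n) - Y w| ^+ 2)%:E)%E
          @ \oo --> 0%E].

(* Phi : R_+ -> L(H, E) is a total function whose values at negative times
   are not used. *)
Definition stochastically_integrable (Phi : R -> H -> E) : Prop :=
  (forall (h : H) (xs : {linear E -> R^o}), continuous xs ->
     measurable_fun (`[0, +oo[ : set (measurableTypeR R))
       (fun s => xs (Phi s h) : R) /\
     (\int[mu]_(s in `[0%R, +oo[) ((xs (Phi s h) : R) ^+ 2)%:E < +oo)%E) /\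
  exists2 I : (R -> H) -> E, gamma_radonifying `[0, +oo[ I &
    forall (a b : R) (h : H) (xs : {linear E -> R^o}), 0 <= a -> a < b ->
      continuous xs ->
      xs (I (tensor `[a, b[ h)) = \int[mu]_(s in `[a, b]) (xs (Phi s h) : R).

End L2.

Section processes.
Context {R : realType} {H : completeNormedModType R}.
Variable ip : {dot H for (@idfun R)}.
Context {d : measure_display} {Omega : measurableType d}.
Variable P : probability Omega R.

(* Elements of L^2(Omega) are represented by functions, so linearity holds
   almost surely; boundedness is contained in the covariance identity. *)
Record cylindrical_brownian_motion (WH : R -> H -> Omega -> R) : Prop := {
  cbm_L2 : forall (t : R) h, 0 <= t -> WH t h \in Lfun P 2%:E;
  cbm_linear : forall (t c : R) h k, 0 <= t ->
    {ae P, forall w, WH t (c *: h + k) w = c * WH t h w + WH t k w};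
  cbm_gaussian : forall (n : nat) (t : 'I_n -> R) (h : 'I_n -> H),
    (forall i, 0 <= t i) ->
    centred_gaussian_vector P (fun i => WH (t i) (h i));
  cbm_covariance : forall (s t : R) g h, 0 <= s -> 0 <= t ->
    'E_P[fun w => (WH s g w * WH t h w)%R]%E = (Num.min s t * ip g h)%:E }.

Record isonormal (D : set R) (W : (R -> H) -> Omega -> R) : Prop := {
  isonormal_L2 : forall f, L2 D f -> W f \in Lfun P 2%:E;
  isonormal_linear : forall (c : R) f g, L2 D f -> L2 D g ->
    {ae P, forall w, W (fun s => c *: f s + g s) w = c * W f w + W g w};
  isonormal_gaussian : forall (n : nat) (f : 'I_n -> R -> H),
    (forall i, L2 D (f i)) -> centred_gaussian_vector P (fun i => W (f i));
  isonormal_covariance : forall f g, L2 D f -> L2 D g ->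
    'E_P[fun w => (W f w * W g w)%R]%E = (L2ip ip D f g)%:E }.

(* [W] is a version of the unique isonormal process on L^2(R_+; H) extending
   [WH]. *)
Definition isonormal_extension (WH : R -> H -> Omega -> R)
    (W : (R -> H) -> Omega -> R) : Prop :=
  isonormal `[0, +oo[ W /\
  forall (a b : R) (h : H), 0 <= a -> a < b ->
    {ae P, forall w, W (tensor `]a, b] h) w = WH b h w - WH a h w}.

(* W_t f, which is the integral of (f(s) | dW_H(s)) over (0, t). *)
Definition wiener_integral (W : (R -> H) -> Omega -> R) (t : R) (f : R -> H) :
    Omega -> R :=
  W (fun s => if s \in `]0, t[ then f s else 0).

Context {E : completeNormedModType R}.

(* [X] is a version of X_L; [g] is the adjoint of [L] applied to [xs]. *)
Definition is_gaussian_variable_of (D : set R) (W : (R -> H) -> Omega -> R)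
    (L : (R -> H) -> E) (X : Omega -> E) : Prop :=
  strongly_measurable setT X /\
  forall xs : {linear E -> R^o}, continuous xs ->
    centred_gaussian P (fun w => xs (X w) : R) /\
    exists g : R -> H,
      [/\ L2 D g,
          forall f, L2 D f -> L2ip ip D g f = xs (L f) &
          {ae P, forall w, (xs (X w) : R) = W g w}].

End processes.

Section bochner.
Context {R : realType} {E : completeNormedModType R}.
Notation mu := (@lebesgue_measure R).

Definition step_fun (s : seq (set R * E)) (x : R) : E :=
  \sum_(p <- s) \1_(p.1) x *: p.2.

Definition step_integral (D : set R) (s : seq (set R * E)) : E :=
  \sum_(p <- s) fine (mu (p.1 `&` D)) *: p.2.

Definition is_bochner_integral (D : set R) (g : R -> E) (y : E) : Prop :=
  strongly_measurable (D : set (measurableTypeR R)) g /\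
  exists s : nat -> seq (set R * E),
    [/\ forall n p, p \in s n ->
          measurable (p.1 : set (measurableTypeR R)) /\
          (mu (p.1 `&` D) < +oo)%E,
        (fun n => \int[mu]_(x in D) (`|g x - step_fun (s n) x|)%:E)%E
          @ \oo --> 0%E &
        (fun n => step_integral D (s n)) @ \oo --> y].

Definition bochner_integral (D : set R) (g : R -> E) : E :=
  xget 0 [set y | is_bochner_integral D g y].

End bochner.

Record C0_semigroup {R : realType} {E : completeNormedModType R}
    (S : R -> {linear E -> E}) : Prop := {
  C0_continuous : forall t, 0 <= t -> continuous (S t);
  C0_0 : forall x, S 0 x = x;
  C0_D : forall s t x, 0 <= s -> 0 <= t -> S (s + t) x = S s (S t x);
  C0_cvg : forall x, S t x @[t --> 0^'+] --> x }.

Section convolution.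
Context {R : realType} {E H : completeNormedModType R}.
Variables (ip : {dot H for (@idfun R)}) (S : R -> {linear E -> E}).
Variable B : {linear H -> E}.
Notation mu := (@lebesgue_measure R).

(* B^dagger on Ran B, extended by 0 to the whole of E *)
Definition Bdagger (y : E) : H :=
  xget 0 [set h : H | B h = y /\ forall k, B k = 0 -> ip h k = 0].

(* S(.) xi belongs to L^2(0, t; E_B): since B^dagger is an isometry from E_B
   onto the orthogonal complement of Ker B, measurability and square
   integrability in E_B are those of B^dagger S(.) xi in H. *)
Definition admissible_direction (t : R) (xi : E) : Prop :=
  {ae mu, forall s, s \in `]0, t[ -> range B (S s xi)} /\
  L2 `]0, t[ (fun s => Bdagger (S s xi)).

Definition SB_on (T : R) : R -> H -> E :=
  fun s h => if s \in `[0, T] then S s (B h) else 0.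

Definition convolution_operator (t : R) (v : R -> H) : E :=
  bochner_integral `]0, t[ (fun s => S (t - s) (B (v s))).

Context {d : measure_display} {Omega : measurableType d}.
Variable P : probability Omega R.

(* [X] is a version of W_A(t) *)
Definition is_stochastic_convolution (W : (R -> H) -> Omega -> R) (t : R)
    (X : Omega -> E) : Prop :=
  is_gaussian_variable_of ip P `]0, t[ (wiener_integral W t)
    (convolution_operator t) X.

Definition mild_solution (WA : Omega -> E) (t : R) (x : E) : Omega -> E :=
  fun w => S t x + WA w.

Definition transition (WA : Omega -> E) (t : R) (f : E -> R) (x : E) : R :=
  fine 'E_P[fun w => f (mild_solution WA t x w)]%E.

(* v_a^xi, with [a'] a weak derivative of a *)
Definition control (a' : R -> R) (xi : E) : R -> H :=
  fun s => a' s *: Bdagger (S s xi).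

End convolution.

Section sobolev.
Context {R : realType}.
Notation mu := (@lebesgue_measure R).

Definition Linfty (t : R) (a : R -> R) : Prop :=
  measurable_fun (`]0, t[ : set (measurableTypeR R)) a /\
  exists C : R, {ae mu, forall s, s \in `]0, t[ -> `|a s| <= C}.

Definition test_function (t : R) (phi : R -> R) : Prop :=
  (forall n x, derivable (derive1n n phi) x 1) /\
  exists c e : R, [/\ 0 < c, c < e, e < t &
    forall x, x \notin `[c, e] -> phi x = 0].

(* a belongs to W^{1,oo}(0,t) with weak derivative a' *)
Definition W1infty (t : R) (a a' : R -> R) : Prop :=
  [/\ Linfty t a, Linfty t a' &
      forall phi, test_function t phi ->
        \int[mu]_(s in `]0, t[) (a s * derive1 phi s) =
        - \int[mu]_(s in `]0, t[) (a' s * phi s)].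

(* a(0+) = l and a(t-) = r for the continuous representative of a *)
Definition boundary_values (t : R) (a : R -> R) (l r : R) : Prop :=
  exists b : R -> R,
    [/\ {ae mu, forall s, s \in `]0, t[ -> a s = b s},
        forall s, s \in `]0, t[ -> {for s, continuous b},
        b s @[s --> 0^'+] --> l &
        b s @[s --> t^'-] --> r].

End sobolev.

Section functions_on_E.
Context {R : realType} {E : completeNormedModType R}.

Definition bounded_function (f : E -> R) : Prop :=
  exists C : R, forall x, `|f x| <= C.

Definition bounded_borel (f : E -> R) : Prop :=
  measurable_fun setT (f : borelType E -> R) /\ bounded_function f.

(* The last two conditions are boundedness and continuity of Df : E -> E^* for
   the operator norm. *)
Definition C1b (f : E -> R) : Prop :=
  [/\ bounded_function f,
      forall x, differentiable f x,
      exists C : R, forall x y, `|'d f x y| <= C * `|y| &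
      forall x (e : R), 0 < e -> \forall z \near x,
        forall y, `|'d f z y - 'd f x y| <= e * `|y|].

End functions_on_E.

(* Main.v *)
(* Put X = W_A(t), G = W_t(v) for v = v_a^xi, and y = S(t) xi. Since
   S(t - s) B v(s) = a'(s) y and the integral of a' over (0, t) is 1, one has
   R_t v = y, hence E[<X, x*> G] = <y, x*> for every x*. Linear combinations of
   <X, x*> and G are Gaussian, which gives the trigonometric integrals
   E cos(<X, x*> + b G + theta) in closed form. For the functions
   F(z) = cos(<z, x*> + theta) they yield the Taylor formula
     E F(X + e y) = E F(X) + e E[F(X) G]
                    + int_0^e (e - q) E[F(X + q y) (G^2 - E G^2)] dq.
   It passes to bounded pointwise limits, and hence, by a monotone class argument
   on a separable set carrying all X + q y (norming functionals generate the
   Borel sets there), to all bounded Borel F. Its remainder is O(e^2), so the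
   derivative at e = 0 is E[F(X) G]; F(z) = f(S(t) x + z) is the first formula. *)
Require Import Defs.
From HB Require Import structures.
From mathcomp Require Import all_boot all_order all_algebra sesquilinear finmap.
From mathcomp Require Import all_classical all_reals all_analysis.
From mathcomp Require Import measurable_realfun.
From mathcomp Require Import ring lra.

Import Order.TTheory GRing.Theory Num.Theory.
Import numFieldNormedType.Exports.

Local Open Scope classical_set_scope.
Local Open Scope ring_scope.
Set Implicit Arguments.
Unset Strict Implicit.
Unset Printing Implicit Defensive.

(** The Gaussian part stays with real integrals. The cosine integrals come from the scalar identity
    E[Y sin(r Y + th)] = s^2 r E cos(r Y + th), read as a differential equation in r, and the pair
    (<X, x*>, G) enters through its linear combinations; neither complex characteristic functions
    nor a density of the shifted law appears. A product of two cosines is half a sum of cosines, so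
    the bounded closure of the generators is an algebra; this starts the monotone class argument.
    Moments of G up to order three suffice: E[G^2 sin(..)] arises as a derivative of E[G cos(..)],
    and the error of that derivative is controlled by |G|^3. Two points make R_t v = y delicate. The
    range condition on S(s) xi holds only almost everywhere, on a set not assumed measurable, and a'
    is only a weak derivative, so its integral has to be extracted from test functions. The formula
    for smooth f does not pass through the first one; it is a differentiation under the expectation
    along the shift by e y. *)

(** * Real-valued integrals: domination, limits, measurability *)

Section integral_lemmas.
Context {d} {T : measurableType d} {R : realType}.
Variables (mu : {measure set T -> \bar R}) (D : set T).
Hypothesis mD : measurable D.

Lemma Rintegral_dominated_cvg (f_ : nat -> T -> R) (f g : T -> R) :
  (forall n, measurable_fun D (f_ n)) -> mu.-integrable D (EFin \o g) ->
  (forall n x, D x -> `|f_ n x| <= g x) ->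
  (forall x, D x -> (fun n => f_ n x) @ \oo --> f x) ->
  mu.-integrable D (EFin \o f) /\
  (fun n => \int[mu]_(x in D) f_ n x) @ \oo --> \int[mu]_(x in D) f x.
Proof.
move=> mf ig fg cf.
have mfl : measurable_fun D f by apply: measurable_fun_cvg cf.
have [//|||||] := @dominated_convergence _ _ _ mu D mD (fun n => EFin \o f_ n)
    (EFin \o f) (EFin \o g).
- by move=> n; exact/measurable_EFinP/mf.
- exact/measurable_EFinP.
- by apply: aeW => x Dx; apply: cvg_EFin; [exact: nearW|exact: cf].
- by [].
- by apply: aeW => x n Dx /=; rewrite lee_fin fg.
move=> intf _ cvgf; split => //.
apply: fine_cvg; rewrite fineK ?integrable_fin_num//.
Qed.

Lemma le_integrable_norm (f g : T -> R) : measurable_fun D f ->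
  (forall x, D x -> `|f x| <= g x) -> mu.-integrable D (EFin \o g) ->
  mu.-integrable D (EFin \o f).
Proof.
move=> mf fg; apply: le_integrable => //; first exact/measurable_EFinP.
by move=> x Dx /=; rewrite lee_fin (le_trans (fg x Dx))// ler_norm.
Qed.

Lemma normr_Rintegral_le (f g : T -> R) :
  measurable_fun D f -> mu.-integrable D (EFin \o g) ->
  (forall x, D x -> `|f x| <= g x) ->
  `|\int[mu]_(x in D) f x| <= \int[mu]_(x in D) g x.
Proof.
move=> mf ig fg; have intf := le_integrable_norm mf fg ig.
apply: (le_trans (le_normr_Rintegral mD intf)); apply: le_Rintegral => //.
by have := integrable_norm intf.
Qed.

Lemma ae_eq_Rintegral (f g : T -> R) : measurable_fun D f ->
  measurable_fun D g -> {ae mu, forall x, D x -> f x = g x} ->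
  \int[mu]_(x in D) f x = \int[mu]_(x in D) g x.
Proof.
move=> mf mg fg; congr fine; apply: ae_eq_integral => //.
- exact/measurable_EFinP.
- exact/measurable_EFinP.
- by apply: filterS fg => x fgx Dx /=; rewrite fgx.
Qed.

Lemma measurable_fun_sin (f : T -> R) : measurable_fun D f ->
  measurable_fun D (fun x => sin (f x)).
Proof.
move=> mf; apply: measurableT_comp mf.
exact: (continuous_measurable_fun (@continuous_sin R)).
Qed.

Lemma measurable_fun_cos (f : T -> R) : measurable_fun D f ->
  measurable_fun D (fun x => cos (f x)).
Proof.
move=> mf; apply: measurableT_comp mf.
exact: (continuous_measurable_fun (@continuous_cos R)).
Qed.

Lemma measurable_fun_affine (r c : R) (f : T -> R) : measurable_fun D f ->
  measurable_fun D (fun x => r * f x + c).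
Proof. by move=> mf; apply: measurable_funD => //; exact: measurable_funM. Qed.

End integral_lemmas.

Lemma bounded_integrable {d} {T : measurableType d} {R : realType}
    (P : probability T R) (f : T -> R) (C : R) :
  measurable_fun setT f -> (forall x, `|f x| <= C) ->
  P.-integrable setT (EFin \o f).
Proof.
move=> mf fC; apply: (@le_integrable_norm _ _ _ P setT measurableT f (cst C)) => //.
exact: (finite_measure_integrable_cst P C measurableT).
Qed.

(** Taylor estimates deliver an error bound of order h^2; this turns such a bound into a derivative.
    It serves for integrals with a parameter, for the flat exponential at 0 and for the final
    shift. *)
Lemma derivable_quadratic {R : realType} (u : R -> R) (a l K : R) :
  (forall h, `|h| <= 1 -> `|u (a + h) - u a - h * l| <= K * h ^+ 2) ->
  is_derive a 1 u l.
Proof.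
move=> ul.
have cl : h^-1 *: ((u \o shift a) (h *: 1) - u a) @[h --> 0^'] --> l.
  apply/cvgrPdist_le => e e0; near=> h.
  have h0 : h != 0 by near: h; exact: nbhs_dnbhs_neq.
  have h1 : `|h| <= 1.
    by near: h; apply: dnbhs0_le.
  (* [K] carries no sign condition; [|K| + 1] is positive and at least [K]. *)
  have h2 : `|h| <= e / (`|K| + 1).
    by near: h; apply: dnbhs0_le; rewrite divr_gt0// ltr_wpDl.
  rewrite /= distrC /GRing.scale/= mulr1 addrC.
  have := ul h h1; rewrite (addrC h).
  set A := u a; set Bb := u _ => ul1.
  have -> : - l + h^-1 * (Bb - A) = h^-1 * (Bb - A - h * l).
    by rewrite [RHS]mulrBr mulKf// addrC.
  rewrite normrM normfV ler_pdivrMl ?normr_gt0//.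
  apply: (le_trans ul1); rewrite -(real_normK (num_real h)) expr2 mulrCA.
  rewrite ler_wpM2l ?normr_ge0//; move: h2; rewrite ler_pdivlMr ?ltr_wpDl//.
  have := normr_ge0 h; have := ler_norm K; have := normr_ge0 K; nra.
split; first by apply/cvg_ex; exists l.
by apply/cvg_lim => //; exact: cl.
Unshelve. all: by end_near. Qed.

(** * One-dimensional Gaussian integrals *)

Section normal_moments.
Context {R : realType}.
Variable s : R.
Hypothesis s0 : 0 < s.
Notation mu := (@lebesgue_measure R).
Local Notation p := (normal_pdf 0 s).

Let sn0 : s != 0. Proof. by rewrite gt_eqF. Qed.

(** Doubling the standard deviation pays for a polynomial factor. The power 3 yields the third
    moment of [G] and the decay of boundary terms in the integration by parts. *)
Lemma normal_pdf_cube_bound : exists C, forall x : R,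
  (1 + `|x| ^+ 3) * p x <= C * normal_pdf 0 (2 * s) x.
Proof.
have s20 : 2 * s != 0 by rewrite mulf_neq0.
exists ((2 + 128 * s ^+ 4) * (normal_peak s / normal_peak (2 * s))) => x.
rewrite !normal_pdfE//.
have q0 : 0 < normal_peak (2 * s) := normal_peak_gt0 s20.
rewrite [leRHS](_ : _ = normal_peak s * ((2 + 128 * s ^+ 4) * normal_fun 0 (2 * s) x)); last first.
  by field; rewrite gt_eqF.
rewrite mulrCA ler_wpM2l ?normal_peak_ge0//.
(* The two Gaussian exponents are 4 u and u; the spare factor exp(-3 u) absorbs the polynomial
   through exp(3 u) >= 1 + (3 u)^2 / 2. *)
pose u := x ^+ 2 / (8 * s ^+ 2).
have u0 : 0 <= u by rewrite divr_ge0 ?sqr_ge0// mulr_ge0// sqr_ge0.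
rewrite /normal_fun !subr0.
have -> : - x ^+ 2 / (s ^+ 2 *+ 2) = - (3 * u) - u by rewrite /u; field.
have -> : - x ^+ 2 / ((2 * s) ^+ 2 *+ 2) = - u by rewrite /u; field.
rewrite expRD mulrA ler_wpM2r ?expR_ge0// expRN ler_pdivrMr ?expR_gt0//.
have e1 := @expR_ge1Dxn R (3 * u) 1 (mulr_ge0 (ler0n _ 3) u0).
have x4 : `|x| ^+ 4 = 64 * s ^+ 4 * u ^+ 2.
  have -> : `|x| ^+ 4 = (`|x| ^+ 2) ^+ 2 by rewrite -exprM.
  by rewrite real_normK ?num_real// /u; field.
have x3 : `|x| ^+ 3 <= 1 + `|x| ^+ 4.
  have := normr_ge0 x; move: `|x| => y y0.
  have [y1|y1] := leP y 1.
    have := exprn_ile1 3 y0 y1; have := exprn_ge0 4 y0; lra.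
  have : 0 <= y ^+ 3 * (y - 1) by rewrite mulr_ge0 ?exprn_ge0// subr_ge0 ltW.
  rewrite mulrBr mulr1 -exprSr; lra.
apply: (@le_trans _ _ ((2 + 128 * s ^+ 4) * (1 + (3 * u) ^+ 2 / 2))).
  rewrite (le_trans (lerD (lexx 1) x3))// x4.
  have := exprn_ge0 4 (ltW s0); have := sqr_ge0 u.
  move: (s ^+ 4) (u) => a v; rewrite exprMn; move: (v ^+ 2) => b b0 a0.
  have := mulr_ge0 a0 b0; lra.
by rewrite ler_wpM2l// addr_ge0// mulr_ge0// exprn_ge0// ltW.
Qed.

Lemma integrable_normal_cube : mu.-integrable setT
  (fun x => ((1 + `|x| ^+ 3) * p x)%:E).
Proof.
have [C hC] := normal_pdf_cube_bound.
apply: (@le_integrable_norm _ _ _ mu setT measurableT _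
  (fun x => C * normal_pdf 0 (2 * s) x)).
- apply: measurable_funM; last exact: measurable_normal_pdf.
  apply: measurable_funD => //; apply: measurable_funX.
  exact: normr_measurable.
- move=> x _; rewrite ger0_norm// mulr_ge0 ?normal_pdf_ge0//.
- have := integrableZl measurableT C (integrable_normal_pdf 0 (2 * s)).
  by apply: eq_integrable.
Qed.

Lemma is_derive_normal_pdf (x : R) : is_derive x 1 p (- (x / s ^+ 2 * p x)).
Proof.
rewrite normal_pdfE// /normal_fun.
apply: is_derive_eq.
by rewrite /GRing.scale/= !subr0; field.
Qed.

Lemma continuous_Rintegral_FTC2 (f F : R -> R) a b : (a < b)%R ->
  continuous f -> (forall x : R, is_derive x 1 F (f x)) ->
  mu.-integrable `[a, b] (EFin \o f) /\
  \int[mu]_(x in `[a, b]) f x = F b - F a.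
Proof.
move=> ab cf dF.
have cF : continuous F.
  by move=> x; apply: differentiable_continuous; apply/derivable1_diffP; apply: ex_derive.
split.
  apply: continuous_compact_integrable; first exact: segment_compact.
  exact: continuous_subspaceT.
rewrite /Rintegral (@continuous_FTC2 _ f F)//.
- exact: continuous_subspaceT.
- split.
  + by move=> x _; apply: ex_derive.
  + by apply: cvg_at_right_filter; exact: cF.
  + by apply: cvg_at_left_filter; exact: cF.
- by move=> x _; rewrite derive1E; exact: derive_val.
Qed.

Lemma Rintegral_symmetric_cvg (f : R -> R) : mu.-integrable setT (EFin \o f) ->
  (fun n : nat => \int[mu]_(x in `[- n%:R, n%:R]) f x) @ \oo -->
  \int[mu]_x f x.
Proof.
move=> intf.
have mf : measurable_fun setT f by apply/measurable_EFinP; exact: measurable_int intf.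
under eq_fun do rewrite Rintegral_mkcond.
have [//||||_ //] := @Rintegral_dominated_cvg _ _ _ mu setT measurableT
    (fun n => f \_ `[- n%:R, n%:R]) f (fun x => `|f x|).
- move=> n; apply/(measurable_restrictT _ _).1 => //.
  exact: measurable_funTS.
- exact: (integrable_norm intf).
- by move=> n x _; rewrite patchE; case: ifP => // _; rewrite normr0.
- move=> x _; apply: cvg_near_cst.
  near=> n; rewrite patchE mem_set//= in_itv/= -ler_norml.
  by near: n; exact: nbhs_infty_ger.
Unshelve. all: by end_near. Qed.

(** Integration by parts with p' = -(x / s^2) p: the difference of the integrands is the derivative
    of [F], which vanishes at infinity. *)
Lemma normal_stein (r th : R) :
  \int[mu]_x (x * sin (r * x + th) * p x) =
  s ^+ 2 * r * \int[mu]_x (cos (r * x + th) * p x).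
Proof.
pose F := fun x : R => - (s ^+ 2 * (p x * sin (r * x + th))).
pose f := fun x : R =>
  x * sin (r * x + th) * p x - s ^+ 2 * r * (cos (r * x + th) * p x).
have dsin (x : R) : is_derive x 1 (fun x => sin (r * x + th)) (r * cos (r * x + th)).
  apply: is_derive_eq; rewrite /GRing.scale/=; ring.
have dF (x : R) : is_derive x 1 F (f x).
  have dp := is_derive_normal_pdf x.
  rewrite /F; apply: is_derive_eq.
  by rewrite /GRing.scale/= /f; field.
have caff : continuous (fun x : R => r * x + th).
  by move=> x; apply: cvgD; [apply: cvgMr; exact: cvg_id|exact: cvg_cst].
have csin : continuous (fun x : R => sin (r * x + th)).
  by move=> x; apply: continuous_comp; [exact: caff|exact: continuous_sin].
have ccos : continuous (fun x : R => cos (r * x + th)).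
  by move=> x; apply: continuous_comp; [exact: caff|exact: continuous_cos].
have cp : continuous p := @continuous_normal_pdf R 0 s sn0.
have cf : continuous f.
  move=> x; apply: cvgB.
    by apply: cvgM; [apply: cvgM; [exact: cvg_id|exact: csin]|exact: cp].
  by apply: cvgMr; apply: cvgM; [exact: ccos|exact: cp].
have dom (g : R -> R) (K : R) : continuous g -> 0 <= K ->
    (forall x, `|g x| <= K * (1 + `|x| ^+ 3)) ->
    mu.-integrable setT (EFin \o (fun x => g x * p x)).
  move=> cg K0 gK.
  apply: (@le_integrable_norm _ _ _ mu setT measurableT _
    (fun x => K * ((1 + `|x| ^+ 3) * p x))).
  - apply: measurable_funM; last exact: measurable_normal_pdf.
    exact: continuous_measurable_fun.
  - move=> x _; rewrite normrM (ger0_norm (normal_pdf_ge0 _ _ _)) mulrA.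
    by rewrite ler_wpM2r ?normal_pdf_ge0.
  - have := integrableZl measurableT K integrable_normal_cube.
    by apply: eq_integrable.
have x13 (y : R) : 0 <= y -> y <= 1 + y ^+ 3.
  move=> y0; have [y1|y1] := leP y 1.
    by have := exprn_ge0 3 y0; lra.
  have : 0 <= y * (y - 1) * (y + 1) by rewrite !mulr_ge0//; lra.
  by rewrite -mulrA -subr_sqr expr1n mulrBr mulr1 -exprS; lra.
have i1 : mu.-integrable setT (EFin \o (fun x => x * sin (r * x + th) * p x)).
  apply: (dom _ 1) => //.
    by move=> x; apply: cvgM; [exact: cvg_id|exact: csin].
  move=> x; rewrite normrM mul1r (le_trans _ (x13 _ (normr_ge0 x)))//.
  by rewrite ler_piMr// ler_norml sin_geN1 sin_le1.
have i2 : mu.-integrable setT (EFin \o (fun x => cos (r * x + th) * p x)).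
  apply: (dom _ 1) => // x; rewrite mul1r (@le_trans _ _ 1)//.
    by rewrite ler_norml cos_geN1 cos_le1.
  by rewrite lerDl exprn_ge0.
have i3 : mu.-integrable setT (EFin \o (fun x => s ^+ 2 * r * (cos (r * x + th) * p x))).
  by have := integrableZl measurableT (s ^+ 2 * r) i2; apply: eq_integrable.
have : \int[mu]_x f x = 0.
  have intf : mu.-integrable setT (EFin \o f).
    by have := integrableB measurableT i1 i3; apply: eq_integrable.
  apply: (cvg_unique _ (Rintegral_symmetric_cvg intf)) => //.
  have [C hC] := normal_pdf_cube_bound.
  (* [harmonic n] is 1 / (n + 1), and n + 1 <= 1 + n^3 for every natural n except that both are 1 at
     n = 0; so the cubic bound makes the boundary terms vanish. *)
  have pn (n : nat) (x : R) : `|x| = n%:R ->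
      `|F x| <= s ^+ 2 * (`|C| * normal_peak (2 * s)) * harmonic n.
    move=> xn; rewrite /F normrN normrM (ger0_norm (sqr_ge0 _)) -mulrA.
    rewrite ler_wpM2l ?sqr_ge0// normrM (ger0_norm (normal_pdf_ge0 _ _ _)).
    apply: (@le_trans _ _ (p x)).
      by rewrite ler_piMr ?normal_pdf_ge0// ler_norml sin_geN1 sin_le1.
    rewrite ler_pdivlMr// (le_trans (y := (1 + `|x| ^+ 3) * p x))//.
      rewrite mulrC ler_wpM2r ?normal_pdf_ge0// xn -natrX nat1r.
      rewrite ler_nat ltnS; case: (n) => // m.
      by rewrite -{1}(expn1 m.+1) leq_pexp2l.
    rewrite (le_trans (hC x))//.
    rewrite (le_trans (y := `|C| * normal_pdf 0 (2 * s) x))//.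
      by rewrite ler_wpM2r ?normal_pdf_ge0// ler_norm.
    by rewrite ler_wpM2l// normal_pdf_ub// mulf_neq0.
  apply/norm_cvg0P.
  pose K := s ^+ 2 * (`|C| * normal_peak (2 * s)).
  apply: (@squeeze_cvgr _ _ _ _ (cst 0) (fun n => K * harmonic n + K * harmonic n)).
  - exists 1%N => // n /= n1; rewrite normr_ge0/=.
    have nn : - n%:R < n%:R :> R by rewrite gtrN// ltr0n.
    rewrite (continuous_Rintegral_FTC2 nn cf dF).2.
    rewrite (le_trans (ler_normB _ _))// lerD// pn ?normrN ?ger0_norm//.
  - exact: cvg_cst.
  - rewrite -[X in _ --> X](addr0 0); apply: cvgD;
      rewrite -(mulr0 K); apply: cvgMr; exact: cvg_harmonic.
rewrite /f RintegralB// RintegralZl//.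
by move/eqP; rewrite subr_eq0 => /eqP.
Qed.

End normal_moments.

(** * From Gaussian laws to cosine integrals *)

Section gaussian_transfer.
Context {R : realType}.
Notation mu := (@lebesgue_measure R).

Lemma ge0_integral_normal_prob (m s : R) (f : R -> \bar R) :
  measurable_fun setT f -> (forall x, (0 <= f x)%E) ->
  (\int[normal_prob m s]_x f x = \int[mu]_x (f x * (normal_pdf m s x)%:E))%E.
Proof.
move=> mf f0; have dom := normal_prob_dominates m s.
rewrite -(Radon_Nikodym_SigmaFinite.change_of_variables dom)//.
have iRN := Radon_Nikodym_SigmaFinite.f_integrable dom.
apply: ae_eq_integral => //.
- by apply: emeasurable_funM => //; exact: measurable_int iRN.
- apply: emeasurable_funM => //; apply/measurable_EFinP.
  exact: measurable_normal_pdf.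
- apply: ae_eqe_mul2l; apply: integral_ae_eq => //.
    by apply/measurable_EFinP; exact: measurable_normal_pdf.
  by move=> E _ mE; rewrite -Radon_Nikodym_SigmaFinite.f_integral.
Qed.

Context {d : measure_display} {Omega : measurableType d}.
Variable P : probability Omega R.

Lemma ge0_integral_gaussian (s : R) (Y : Omega -> R) (f : R -> \bar R) :
  measurable_fun setT Y ->
  (forall A, measurable A -> P (Y @^-1` A) = normal_prob 0 s A) ->
  measurable_fun setT f -> (forall x, (0 <= f x)%E) ->
  (\int[P]_w f (Y w) = \int[mu]_x (f x * (normal_pdf 0 s x)%:E))%E.
Proof.
move=> mY PY mf f0; rewrite -ge0_integral_normal_prob//.
have mY' : measurable_fun setT (Y : Omega -> measurableTypeR R) by [].
transitivity (\int[pushforward P (Y : Omega -> measurableTypeR R)]_x f x)%E.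
  by rewrite (ge0_integral_pushforward mY').
by apply: eq_measure_integral => A mA _; exact: PY.
Qed.

Lemma integral_gaussian (s : R) (Y : Omega -> R) (f : R -> R) :
  measurable_fun setT Y ->
  (forall A, measurable A -> P (Y @^-1` A) = normal_prob 0 s A) ->
  measurable_fun setT f ->
  \int[P]_w f (Y w) = \int[mu]_x (f x * normal_pdf 0 s x).
Proof.
move=> mY PY mf; have mEf : measurable_fun setT (EFin \o f).
  exact/measurable_EFinP.
rewrite /Rintegral [in LHS]integralE [in RHS]integralE; congr (fine (_ - _)%E).
- transitivity (\int[P]_w (((EFin \o f)^\+)%E (Y w)))%E;
    first by apply: eq_integral => w _; rewrite ?funeposE ?funenegE.
  rewrite (ge0_integral_gaussian mY PY)//; last exact: measurable_funepos.
  apply: eq_integral => x _; rewrite !funeposE/= -!EFin_max -EFinM.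
  by rewrite maxr_pMl ?normal_pdf_ge0// mul0r.
- transitivity (\int[P]_w (((EFin \o f)^\-)%E (Y w)))%E;
    first by apply: eq_integral => w _; rewrite ?funeposE ?funenegE.
  rewrite (ge0_integral_gaussian mY PY)//; last exact: measurable_funeneg.
  apply: eq_integral => x _; rewrite !funenegE/= -!EFin_max -EFinM.
  by rewrite maxr_pMl ?normal_pdf_ge0// mul0r mulNr.
Qed.

Lemma integral_dirac_law (Y : Omega -> R) : measurable_fun setT Y ->
  (forall A : set R, measurable A -> P (Y @^-1` A) = \d_(0 : R) A) ->
  {ae P, forall w, Y w = 0}.
Proof.
move=> mY PY; exists (Y @^-1` (~` [set 0])); split.
- rewrite -[X in measurable X]setTI; apply: mY => //.
  exact: (measurableC (@measurable_set1 R 0)).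
- rewrite PY; last exact: (measurableC (@measurable_set1 R 0)).
  by rewrite diracE memNset//=; apply.
- by move=> w /=.
Qed.

(** The two cases of [centred_gaussian] merge here: a Dirac law satisfies the same identity with
    [s = 0], and no later argument distinguishes them. *)
Lemma centred_gaussian_stein (Y : Omega -> R) : centred_gaussian P Y ->
  P.-integrable setT (fun w => (`|Y w| ^+ 3)%:E) /\
  exists s : R, forall r th,
    \int[P]_w (Y w * sin (r * Y w + th)) =
    s ^+ 2 * r * \int[P]_w cos (r * Y w + th).
Proof.
move=> [mY [PY|[s s0 PY]]].
  have Y0 := integral_dirac_law mY PY; split.
    apply/integrableP; split.
      by apply/measurable_EFinP/measurable_funX; exact: measurableT_comp.
    rewrite (@ae_eq_integral _ _ _ P setT (cst 0%E)) ?integral0//.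
      apply: measurableT_comp => //.
      by apply/measurable_EFinP/measurable_funX; exact: measurableT_comp.
    by apply: filterS Y0 => w -> _ /=; rewrite normr0 expr0n/= normr0.
  exists 0 => r th; rewrite expr0n/= !mul0r.
  rewrite (@ae_eq_Rintegral _ _ _ P _ _ _ (cst 0)) ?Rintegral_cst ?mul0r//.
    apply: measurable_funM => //.
    by apply: measurable_fun_sin; exact: measurable_fun_affine.
  by apply: filterS Y0 => w -> _ /=; rewrite mul0r.
split.
  apply/integrableP; split.
    by apply/measurable_EFinP/measurable_funX; exact: measurableT_comp.
  rewrite (@ge0_integral_gaussian s Y (fun x => `|(`|x| ^+ 3)%:E|%E))//; last first.
    apply: measurableT_comp => //; apply/measurable_EFinP/measurable_funX.
    exact: normr_measurable.
  have /integrableP[_] := integrable_normal_cube s0; apply: le_lt_trans.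
  apply: ge0_le_integral => //.
  - by move=> x _; rewrite mule_ge0// lee_fin normal_pdf_ge0.
  - apply: emeasurable_funM; apply/measurable_EFinP.
      apply/measurableT_comp => //; apply/measurable_funX; exact: normr_measurable.
    exact: measurable_normal_pdf.
  - apply: measurableT_comp => //.
    exact: measurable_int (integrable_normal_cube s0).
  - move=> x _; rewrite abse_EFin -EFinM abse_EFin lee_fin.
    rewrite normrX normr_id [leRHS]normrM (ger0_norm (normal_pdf_ge0 _ _ _))
      ler_wpM2r ?normal_pdf_ge0//.
    by rewrite ger0_norm ?addr_ge0 ?exprn_ge0// lerDr.
exists s => r th.
rewrite (@integral_gaussian s Y (fun y => y * sin (r * y + th)))//; last first.
  apply: measurable_funM => //.
  by apply: measurable_fun_sin; exact: measurable_fun_affine.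
rewrite (@integral_gaussian s Y (fun y => cos (r * y + th)))//; last first.
  by apply: measurable_fun_cos; exact: measurable_fun_affine.
exact: normal_stein.
Qed.

Lemma MVT_is_derive (f f' : R -> R) (a b : R) :
  (forall x : R, is_derive x 1 f (f' x)) ->
  exists2 c, `|c - a| <= `|b - a| & f b - f a = f' c * (b - a).
Proof.
move=> df.
have cf x y : {within `[x, y], continuous f}.
  apply: continuous_subspaceT => z.
  by apply: differentiable_continuous; apply/derivable1_diffP; apply: ex_derive.
have [ab|ba] := leP a b.
  have [c + e] := MVT_segment ab (fun x _ => df x) (cf a b).
  rewrite in_itv/= => /andP[ac cb]; exists c => //.
  by rewrite !ger0_norm ?subr_ge0// lerB.
have [c + e] := MVT_segment (ltW ba) (fun x _ => df x) (cf b a).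
rewrite in_itv/= => /andP[bc ca]; exists c; last by rewrite -opprB e -mulrN opprB.
by rewrite (distrC c) (distrC b) !ger0_norm ?subr_ge0 ?(ltW ba)// lerB.
Qed.

Lemma cos_taylor_le (a b : R) : `|cos (a + b) - cos a + b * sin a| <= b ^+ 2.
Proof.
have dcos (x : R) : is_derive x 1 (fun x => cos (a + x) + x * sin a)
    (- sin (a + x) + sin a).
  by apply: is_derive_eq; rewrite /GRing.scale/=; ring.
have dsin (x : R) : is_derive x 1 (fun x => sin (a + x)) (cos (a + x)).
  by apply: is_derive_eq; rewrite /GRing.scale/=; ring.
have [c] := MVT_is_derive 0 b dcos.
rewrite !subr0 addr0 mul0r addr0 => cb; rewrite addrAC => ->.
have [c' _] := MVT_is_derive 0 c dsin.
rewrite subr0 addr0 => sc.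
rewrite normrM -(real_normK (num_real b)) expr2.
rewrite ler_wpM2r// (le_trans _ cb)// addrC -opprB normrN sc normrM.
by rewrite ler_piMl// ler_norml cos_geN1 cos_le1.
Qed.

(** The weight [M] permits iteration: [M = 1] gives a first derivative in [b], [M = G] a second one.
    By [cos_taylor_le] the increment error is at most [|M| G^2 h^2], whence the last integrability
    condition. *)
Lemma is_derive_Rintegral_cos (M Z G : Omega -> R) (b : R) :
  measurable_fun setT M -> measurable_fun setT Z -> measurable_fun setT G ->
  P.-integrable setT (EFin \o M) ->
  P.-integrable setT (EFin \o (fun w => M w * G w)) ->
  P.-integrable setT (EFin \o (fun w => `|M w| * G w ^+ 2)) ->
  is_derive b 1 (fun b => \int[P]_w (M w * cos (Z w + b * G w)))
    (- \int[P]_w (M w * G w * sin (Z w + b * G w))).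
Proof.
move=> mM mZ mG iM iMG iMG2.
have mZG h : measurable_fun setT (fun w => Z w + h * G w).
  by apply: measurable_funD => //; exact: measurable_funM.
have icos h : P.-integrable setT (EFin \o (fun w => M w * cos (Z w + h * G w))).
  apply: (@le_integrable_norm _ _ _ P setT measurableT _ (fun w => `|M w|)).
  - by apply: measurable_funM => //; exact: measurable_fun_cos.
  - by move=> w _; rewrite normrM ler_piMr// ler_norml cos_geN1 cos_le1.
  - exact: (integrable_norm iM).
have isin h : P.-integrable setT (EFin \o (fun w => M w * G w * sin (Z w + h * G w))).
  apply: (@le_integrable_norm _ _ _ P setT measurableT _ (fun w => `|M w * G w|)).
  - by apply: measurable_funM; [exact: measurable_funM|exact: measurable_fun_sin].
  - by move=> w _; rewrite normrM ler_piMr// ler_norml sin_geN1 sin_le1.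
  - exact: (integrable_norm iMG).
apply: (@derivable_quadratic _ _ _ _ (\int[P]_w (`|M w| * G w ^+ 2))) => h _.
rewrite mulrN opprK.
have isinh : P.-integrable setT (EFin \o (fun w => h * (M w * G w * sin (Z w + b * G w)))).
  by have := integrableZl measurableT h (isin b); apply: eq_integrable.
rewrite -RintegralZl// -RintegralB// -RintegralD//; last first.
  by have := integrableB measurableT (icos (b + h)) (icos b); apply: eq_integrable.
have ih : P.-integrable setT (EFin \o (fun w => `|M w| * G w ^+ 2 * h ^+ 2)).
  by have := integrableZr measurableT (h ^+ 2) iMG2; apply: eq_integrable.
rewrite -RintegralZr//; apply: normr_Rintegral_le => //.
  apply: measurable_funD.
    by apply: measurable_funB; apply: measurable_funM => //; exact: measurable_fun_cos.
  by do 2![apply: measurable_funM => //]; [exact: measurable_funM|exact: measurable_fun_sin].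
move=> w _; rewrite -[leRHS]mulrA.
rewrite (_ : _ - _ + _ = M w * (cos (Z w + b * G w + h * G w) -
  cos (Z w + b * G w) + h * G w * sin (Z w + b * G w))); last first.
  by rewrite mulrDl addrA; ring.
by rewrite normrM ler_wpM2l// -exprMn (mulrC (G w)) cos_taylor_le.
Qed.

Lemma is_derive_Rintegral_sin (M Z G : Omega -> R) (b : R) :
  measurable_fun setT M -> measurable_fun setT Z -> measurable_fun setT G ->
  P.-integrable setT (EFin \o M) ->
  P.-integrable setT (EFin \o (fun w => M w * G w)) ->
  P.-integrable setT (EFin \o (fun w => `|M w| * G w ^+ 2)) ->
  is_derive b 1 (fun b => \int[P]_w (M w * sin (Z w + b * G w)))
    (\int[P]_w (M w * G w * cos (Z w + b * G w))).
Proof.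
move=> mM mZ mG iM iMG iMG2.
(* Sine is cosine with the phase moved by a quarter period. *)
have mZ' : measurable_fun setT (fun w => Z w - pi / 2) by exact: measurable_funB.
have := is_derive_Rintegral_cos b mM mZ' mG iM iMG iMG2.
have cE x : cos (x - pi / 2) = sin x :> R.
  by rewrite cosB cos_pihalf sin_pihalf mulr0 add0r mulr1.
have sE x : sin (x - pi / 2) = - cos x :> R.
  by rewrite sinB cos_pihalf sin_pihalf mulr0 sub0r mulr1.
rewrite (_ : (fun b0 => _) = (fun b => \int[P]_w (M w * sin (Z w + b * G w)))); last first.
  by apply/funext => c; apply: eq_Rintegral => w _; rewrite addrAC cE.
move=> h; apply: (is_derive_eq h).
have -> : \int[P]_w (M w * G w * sin (Z w - pi / 2 + b * G w)) =
    \int[P]_w (-1 * (M w * G w * cos (Z w + b * G w))).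
  by apply: eq_Rintegral => w _; rewrite addrAC sE; ring.
rewrite RintegralZl// ?mulN1r ?opprK//.
apply: (@le_integrable_norm _ _ _ P setT measurableT _ (fun w => `|M w * G w|)).
- apply: measurable_funM; first exact: measurable_funM.
  apply: measurable_fun_cos; apply: measurable_funD => //; exact: measurable_funM.
- by move=> w _; rewrite normrM ler_piMr// ler_norml cos_geN1 cos_le1.
- exact: (integrable_norm iMG).
Qed.

Lemma integrable_cube_le (Y : Omega -> R) (k : nat) : (k <= 3)%N ->
  measurable_fun setT Y ->
  P.-integrable setT (fun w => (`|Y w| ^+ 3)%:E) ->
  P.-integrable setT (fun w => (`|Y w| ^+ k)%:E).
Proof.
move=> k3 mY iY.
apply: (@le_integrable_norm _ _ _ P setT measurableT _ (fun w => 1 + `|Y w| ^+ 3)).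
- by apply: measurable_funX; exact: measurableT_comp.
- move=> w _; rewrite normrX normr_id; have := normr_ge0 (Y w).
  move: `|Y w| => y y0; have [y1|y1] := leP y 1.
    by rewrite (le_trans (exprn_ile1 k y0 y1))// lerDl exprn_ge0.
  by rewrite (le_trans (ler_weXn2l (ltW y1) k3))// lerDr.
- have := integrableD measurableT
    (finite_measure_integrable_cst P 1 measurableT) iY.
  by apply: eq_integrable.
Qed.

(** By [centred_gaussian_stein], [phi th] solves phi' = - s^2 r phi with value cos th at 0, so its
    product with exp(s^2 r^2 / 2) is constant. *)
Lemma centred_gaussian_cos (Y : Omega -> R) : centred_gaussian P Y ->
  forall th, \int[P]_w cos (Y w + th) =
    cos th * expR (- (\int[P]_w (Y w ^+ 2)) / 2).
Proof.
move=> gY; have mY : measurable_fun setT Y := gY.1.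
have [iY3 [s st]] := centred_gaussian_stein gY.
have iY2 : P.-integrable setT (EFin \o (fun w => Y w ^+ 2)).
  have := integrable_cube_le (isT : 2 <= 3)%N mY iY3; apply: eq_integrable => //.
  by move=> w _ /=; rewrite real_normK ?num_real.
have iY1 : P.-integrable setT (EFin \o Y).
  apply: (@le_integrable_norm _ _ _ P setT measurableT _ (fun w => `|Y w| ^+ 1)) => //.
  exact: integrable_cube_le iY3.
have i1 : P.-integrable setT (EFin \o (fun=> 1 : R)).
  exact: (finite_measure_integrable_cst P 1 measurableT).
have m1 : measurable_fun setT ((fun=> 1) : Omega -> R) by [].
pose phi th r := \int[P]_w cos (r * Y w + th).
have dphi (th r : R) : is_derive r 1 (phi th) (- (s ^+ 2 * r * phi th r)).
  have mth : measurable_fun setT ((fun=> th) : Omega -> R) by [].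
  have := @is_derive_Rintegral_cos (fun=> 1) (fun=> th) Y r m1 mth mY i1.
  have -> : (fun b => \int[P]_w (1 * cos (th + b * Y w))) = phi th.
    by apply/funext => b; apply: eq_Rintegral => w _; rewrite mul1r addrC.
  have -> : \int[P]_w (1 * Y w * sin (th + r * Y w)) =
      \int[P]_w (Y w * sin (r * Y w + th)).
    by apply: eq_Rintegral => w _; rewrite mul1r addrC.
  rewrite st; apply.
    by apply: eq_integrable iY1 => // w _ /=; rewrite mul1r.
  by apply: eq_integrable iY2 => // w _ /=; rewrite normr1 mul1r.
have phi0 th : phi th 0 = cos th.
  rewrite /phi; under eq_Rintegral do rewrite mul0r add0r.
  by rewrite Rintegral_cst// [X in fine X](probability_setT P) mulr1.
have phiE th r : phi th r = cos th * expR (- (s ^+ 2 * r ^+ 2) / 2).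
  pose g := fun r => phi th r * expR (s ^+ 2 * r ^+ 2 / 2).
  have dg (x : R) : is_derive x 1 g 0.
    have := dphi th x => dp; rewrite /g; apply: is_derive_eq.
    by rewrite /GRing.scale/=; field.
  have := is_derive_0_is_cst r 0 dg; rewrite /g phi0 expr0n/= mulr0 mul0r expR0.
  by rewrite mulr1 => <-; rewrite mulNr expRN mulfK// gt_eqF// expR_gt0.
(* So far [s] is known only through [st]. Differentiating both sides of [st] at r = 0, with th = 0,
   identifies its square as the second moment. *)
have : \int[P]_w (Y w ^+ 2) = s ^+ 2.
  have dp := dphi 0 0.
  have h2 : is_derive (0 : R) 1 (fun b : R => s ^+ 2 * b * phi 0 b) (s ^+ 2).
    apply: is_derive_eq; rewrite phi0 cos0 /GRing.scale/=; ring.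
  have m0 : measurable_fun setT ((fun=> 0) : Omega -> R) by [].
  have iYY2 : P.-integrable setT (EFin \o (fun w => `|Y w| * Y w ^+ 2)).
    apply: eq_integrable iY3 => // w _ /=.
    by rewrite exprS real_normK ?num_real.
  have iYY : P.-integrable setT (EFin \o (fun w => Y w * Y w)) by [].
  have := @is_derive_Rintegral_sin Y (fun=> 0) Y 0 mY m0 mY iY1 iYY iYY2.
  have -> : (fun b => \int[P]_w (Y w * sin (0 + b * Y w))) =
      (fun b => s ^+ 2 * b * phi 0 b).
    apply/funext => b; rewrite -st; apply: eq_Rintegral => w _.
    by rewrite add0r addr0.
  move=> h1.
  have := @derive_val _ _ _ _ _ _ _ h2; rewrite (@derive_val _ _ _ _ _ _ _ h1) => <-.
  by apply: eq_Rintegral => w _; rewrite mul0r add0r cos0 mulr1 expr2.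
move=> e th; rewrite e; have := phiE th 1; rewrite /phi expr1n mulr1 => <-.
by apply: eq_Rintegral => w _; rewrite mul1r.
Qed.

End gaussian_transfer.

(** * Norming functionals *)

Section hahn_banach.
Context {R : realType} {E : normedModType R}.
Implicit Types (G : set (E * R)) (v x : E).

(* The last clause, rather than [G (v, `|v|)], admits the empty graph, so that
   Zorn's lemma applies to unions of arbitrary chains. *)
Definition dominated_graph v G : Prop :=
  [/\ forall c p q, G p -> G q -> G (c *: p.1 + q.1, c * p.2 + q.2),
      forall p, G p -> p.2 <= `|p.1| &
      forall p, G p -> G (v, `|v|)].

(** The maximal graph from Zorn's lemma could a priori be empty, but then the line through
    [(v, |v|)] would enlarge it. *)
Lemma maximal_dominated_graph v : exists G,
  [/\ dominated_graph v G, G (v, `|v|) &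
      forall G', G `<=` G' -> dominated_graph v G' -> G' `<=` G].
Proof.
have [F FP Ftot|G [Gd Gmax]] := @Zorn_bigcup _ (dominated_graph v).
  split.
  - move=> c p q [X FX Xp] [Y FY Yq].
    have [XY|YX] := Ftot _ _ FX FY.
      by exists Y => //; have [h _ _] := FP _ FY; apply: h => //; exact: XY.
    by exists X => //; have [h _ _] := FP _ FX; apply: h => //; exact: YX.
  - by move=> p [X FX Xp]; have [_ h _] := FP _ FX; exact: h.
  - by move=> p [X FX Xp]; exists X => //; have [_ _ h] := FP _ FX; exact: h Xp.
have Gmax' G' : G `<=` G' -> dominated_graph v G' -> G' `<=` G.
  move=> GG' dG' p G'p; apply: contrapT => Gp.
  by apply: (Gmax G') => //; split=> // /(_ _ G'p).
exists G; split => //; apply: contrapT => nG.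
have G0 p : ~ G p by case: Gd => _ _ /(_ p) h /h.
pose L := [set p : E * R | exists c, p = (c *: v, c * `|v|)].
have : L `<=` G.
  apply: Gmax'; first by move=> p /G0.
  split.
  - move=> c p q [a ->] [b ->]; exists (c * a + b) => /=.
    by rewrite scalerDl scalerA mulrDl mulrA.
  - move=> p [a ->] /=; rewrite normrZ.
    by rewrite ler_wpM2r// ler_norm.
  - by move=> p _; exists 1; rewrite scale1r mul1r.
by move=> /(_ (0, 0)) h; apply: (G0 (0, 0)); apply: h; exists 0; rewrite scale0r mul0r.
Qed.

(** One-dimensional Hahn-Banach extension: a value at [x0] preserves domination when it lies above
    every [p.2 - |p.1 - x0|] and below every [|p.1 + x0| - p.2]. The triangle inequality puts the
    first family below the second, [c] is the supremum of the first, and maximality of [G] then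
    gives [G (x0, c)]. *)
Lemma dominated_graph_extend v G x0 : dominated_graph v G -> G (v, `|v|) ->
  (forall G', G `<=` G' -> dominated_graph v G' -> G' `<=` G) ->
  exists r, G (x0, r).
Proof.
move=> [Gl Gd _] Gv Gmax.
have G0 : G (0, 0).
  have := Gl (-1) _ _ Gv Gv; rewrite /= scaleN1r mulN1r !addNr; exact.
have GZ c p : G p -> G (c *: p.1, c * p.2).
  by move=> Gp; have := Gl c _ _ Gp G0; rewrite /= !addr0.
pose A := [set p.2 - `|p.1 - x0| | p in G].
have Aub p : G p -> ubound A (`|p.1 + x0| - p.2).
  move=> Gp _ [q Gq <-]; rewrite lerBrDr addrAC lerBlDr.
  have := Gd _ (Gl 1 _ _ Gq Gp); rewrite /= scale1r mul1r => h.
  apply: (le_trans h); rewrite addrC.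
  apply: (le_trans _ (ler_normD _ _)).
  by rewrite (addrC q.1 (- _)) addrA addrK.
have hA : has_sup A.
  split; first by exists (0 - `|0 - x0|), (0, 0).
  by exists (`|0 + x0| - 0); exact: (Aub (0, 0)).
pose c := sup A.
have cub p : G p -> p.2 - `|p.1 - x0| <= c.
  by move=> Gp; apply: sup_upper_bound => //; exists p.
have clb p : G p -> c <= `|p.1 + x0| - p.2.
  by move=> Gp; apply: ge_sup; [case: hA|exact: Aub].
pose G' := [set q : E * R | exists2 p, G p & exists l,
  q = (p.1 + l *: x0, p.2 + l * c)].
exists c; suff : G' `<=` G.
  apply; exists (0, 0) => //; exists 1.
  by rewrite scale1r mul1r !add0r.
apply: Gmax.
  by move=> p Gp; exists p => //; exists 0; rewrite scale0r mul0r !addr0; case: p Gp.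
split.
- move=> k p q [p' Gp' [l ->]] [q' Gq' [m ->]].
  exists (k *: p'.1 + q'.1, k * p'.2 + q'.2); first exact: Gl.
  exists (k * l + m) => /=; congr pair.
    by rewrite scalerDr scalerA addrACA -scalerDl.
  by ring.
- move=> p [q Gq [l ->]] /=.
  have nz (m : R) (y : E) : 0 < m -> m * `|y| = `|m *: y|.
    by move=> m0; rewrite normrZ gtr0_norm.
  (* By homogeneity the claim for [l] is one of the two estimates on [c], at the point scaled by 1 /
     |l|: the lower one for l < 0, the upper one for l > 0. *)
  have [l0|l0|->] := ltgtP l 0; last by rewrite scale0r mul0r !addr0 Gd.
  + have m0 : 0 < - l by rewrite oppr_gt0.
    have := cub _ (GZ (- l)^-1 _ Gq) => /=.
    rewrite -(ler_pM2l m0) mulrBr mulVKf ?gt_eqF// (nz _ _ m0).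
    rewrite scalerBr scalerA divff ?gt_eqF// scale1r scaleNr opprK.
    by lra.
  + have := clb _ (GZ l^-1 _ Gq) => /=.
    rewrite -(ler_pM2l l0) mulrBr mulVKf ?gt_eqF// (nz _ _ l0).
    rewrite scalerDr scalerA divff ?gt_eqF// scale1r.
    by lra.
- move=> p _; exists (v, `|v|) => //; exists 0.
  by rewrite scale0r mul0r !addr0.
Qed.

(** A maximal graph is total, and single-valued because two values at one point differ by a value at
    0, which domination forces to be at most 0 in either order. These functionals later cut out
    closed balls by half-spaces. *)
Theorem norming_functional v : exists xs : {linear E -> R^o},
  [/\ continuous xs, forall x, `|xs x| <= `|x| & xs v = `|v|].
Proof.
have [G [Gd Gv Gmax]] := maximal_dominated_graph v.
have tot x := dominated_graph_extend x Gd Gv Gmax.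
pose f x : R^o := sval (cid (tot x)).
have Gf x : G (x, f x) by rewrite /f; case: cid.
have [Gl Gdom _] := Gd.
have f_le x : `|f x| <= `|x|.
  rewrite ler_norml; apply/andP; split; last exact: (Gdom (x, f x)).
  have := Gl (-2) _ _ (Gf x) (Gf x) => /Gdom/=.
  have -> : -2 *: x + x = - x.
    by rewrite (_ : (-2 : R) = -1 - 1)%R ?scalerBl ?scaleN1r ?scale1r ?addrNK//; ring.
  by rewrite normrN; move: (f x : R) `|x| => a b; lra.
have uniq x r s : G (x, r) -> G (x, s) -> r = s.
  have aux r' s' : G (x, r') -> G (x, s') -> r' <= s'.
    move=> Gr Gs; have := Gl (-1) _ _ Gs Gr => /Gdom/=.
    by rewrite scaleN1r addNr normr0 mulN1r addrC subr_le0.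
  by move=> Gr Gs; apply/eqP; rewrite eq_le !aux.
have lf : linear f.
  by move=> c x y; apply: (@uniq (c *: x + y)) => //; exact: (Gl c _ _ (Gf x) (Gf y)).
pose fL := GRing.isLinear.Build R E R^o *:%R f lf.
pose F : {linear E -> R^o} := HB.pack f fL.
exists F; split => //; last exact: (@uniq v).
move=> x; apply/cvgrPdist_le => e e0; near=> y.
rewrite -raddfB; apply: (le_trans (f_le _)).
by near: y; exact: cvgr_dist_le.
Unshelve. all: by end_near. Qed.

End hahn_banach.

Lemma countable_enum {I : Type} (Q : set I) : countable Q ->
  Q = set0 \/ exists2 q : nat -> I, forall n, Q (q n) &
    forall (T : Type) (F : I -> set T),
      \bigcup_(i in Q) F i = \bigcup_n F (q n).
Proof.
move=> /pfcard_geP[->|[q]]; [by left|right].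
exists q => [n|T F]; first exact: funS.
apply/seteqP; split=> [z [i Qi Fiz]|z [n _ Fnz]].
  by have [n _ qn] := @surj _ _ _ _ q i Qi; exists n => //; rewrite qn.
by exists (q n) => //; exact: funS.
Qed.

(** * Closure of a function algebra under bounded pointwise limits *)

(* Limits are required on [V] only: [V] will be a separable set carrying all
   the shifted variables, and [E] itself need not be separable. *)
Inductive bclos {R : realType} {T : Type} (V : set T) (A : set (T -> R)) :
    (T -> R) -> Prop :=
| bclos_base f : A f -> bclos V A f
| bclos_lin (c : R) f g : bclos V A f -> bclos V A g ->
    bclos V A (fun z => c * f z + g z)
| bclos_lim (u : nat -> T -> R) f (C : R) : (forall n, bclos V A (u n)) ->
    (forall n z, V z -> `|u n z| <= C) ->
    (forall z, V z -> (fun n => u n z) @ \oo --> f z) -> bclos V A f.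

Section bounded_closure.
Context {R : realType} {T : Type}.
Variables (V : set T) (A : set (T -> R)).
Hypothesis A_bounded :
  forall f, A f -> exists C : R, forall z, V z -> `|f z| <= C.
Hypothesis A_cst1 : bclos V A (fun=> 1).
Hypothesis A_mul : forall f g, A f -> A g -> bclos V A (fun z => f z * g z).
Local Notation cl := (bclos V A).
Implicit Types (f g h : T -> R) (D : set T).

Lemma bclos_bounded f : cl f -> exists C : R, forall z, V z -> `|f z| <= C.
Proof.
elim=> [h /A_bounded//|c h k _ [C hC] _ [C' kC]|u h C _ _ uC uh].
  exists (`|c| * C + C') => z Vz; rewrite (le_trans (ler_normD _ _))//.
  by rewrite lerD ?kC// normrM ler_wpM2l ?hC.
exists C => z Vz; apply: (cvgr_to_le (cvg_norm (uh z Vz))).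
by apply: nearW => n; exact: uC.
Qed.

(** A constant sequence is a bounded limit on [V], so membership depends only on the values on
    [V]. *)
Lemma bclos_eq f g : (forall z, V z -> f z = g z) -> cl f -> cl g.
Proof.
move=> fg cf; have [C fC] := bclos_bounded cf.
apply: (@bclos_lim _ _ _ _ (fun=> f) _ C); [by []|by move=> n z /fC|move=> z Vz].
by rewrite fg//; exact: cvg_cst.
Qed.

Lemma bclos0 : cl (fun=> 0).
Proof.
apply: bclos_eq (bclos_lin (-1) A_cst1 A_cst1) => z _.
by rewrite mulN1r addNr.
Qed.

Lemma bclosZ c f : cl f -> cl (fun z => c * f z).
Proof.
by move=> cf; apply: bclos_eq (bclos_lin c cf bclos0) => z _; rewrite addr0.
Qed.

Lemma bclosD f g : cl f -> cl g -> cl (fun z => f z + g z).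
Proof.
by move=> cf cg; apply: bclos_eq (bclos_lin 1 cf cg) => z _; rewrite mul1r.
Qed.

Lemma bclosB f g : cl f -> cl g -> cl (fun z => f z - g z).
Proof.
move=> cf cg; apply: bclos_eq (bclos_lin (-1) cg cf) => z _.
by rewrite mulN1r addrC.
Qed.

Lemma bclos_cst c : cl (fun=> c).
Proof. by apply: bclos_eq (bclosZ c A_cst1) => z _; rewrite mulr1. Qed.

Let bclos_limM (u : nat -> T -> R) f g (C C' : R) :
  (forall n, cl (fun z => u n z * g z)) ->
  (forall z, V z -> `|g z| <= C') ->
  (forall n z, V z -> `|u n z| <= C) ->
  (forall z, V z -> (fun n => u n z) @ \oo --> f z) ->
  cl (fun z => f z * g z).
Proof.
move=> cu gC uC uf.
apply: (bclos_lim (u := fun n z => u n z * g z) (C := C * C')) => //.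
- by move=> n z Vz; rewrite normrM ler_pM ?uC ?gC.
- by move=> z Vz; apply: cvgMl; exact: uf.
Qed.

(** Nested inductions: the outer one reduces [f] to a generator, the inner one then reduces [g],
    leaving [A_mul]. The limit cases need the other factor bounded on [V]. *)
Lemma bclosM f g : cl f -> cl g -> cl (fun z => f z * g z).
Proof.
move=> cf cg; have [C' gC] := bclos_bounded cg.
elim: cf => [{}f Af|c f1 f2 _ IH1 _ IH2|u {}f C _ IH uC uf].
- have [C fC] := bclos_bounded (bclos_base V Af).
  elim: cg {C' gC} => [{}g Ag|c g1 g2 _ IH1 _ IH2|u {}g C' _ IH uC ug].
  + exact: A_mul.
  + by apply: bclos_eq (bclos_lin c IH1 IH2) => z _; ring.
  + have -> : (fun z => f z * g z) = (fun z => g z * f z).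
      by apply/funext => z; rewrite mulrC.
    apply: (bclos_limM _ fC uC ug) => n.
    by apply: bclos_eq (IH n) => z _; rewrite mulrC.
- by apply: bclos_eq (bclos_lin c IH1 IH2) => z _; ring.
- exact: (bclos_limM IH gC uC uf).
Qed.

Lemma bclosX f n : cl f -> cl (fun z => f z ^+ n).
Proof.
move=> cf; elim: n => [|n IH]; first exact: A_cst1.
by apply: bclos_eq (bclosM cf IH) => z _; rewrite exprS.
Qed.

(* The iteration p <- p + (x^2 - p^2) / 2 increases from 0 to |x|; each step
   multiplies the error by 1 - (|x| + p) / 2. *)
Let sqrt_iter (n : nat) (x : R) : R :=
  iter n (fun p => p + (x ^+ 2 - p ^+ 2) / 2) 0.

Let sqrt_iter_bound n x : `|x| <= 1 ->
  0 <= sqrt_iter n x <= `|x| /\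
  `|x| - sqrt_iter n x <= `|x| * (1 - `|x| / 2) ^+ n.
Proof.
move=> x1; have x0 := normr_ge0 x; have x2 := real_normK (num_real x).
elim: n => [|n [/andP[p0 px] IH]]; first by rewrite /= lexx x0 subr0 mulr1.
rewrite [sqrt_iter _ _]/= -/(sqrt_iter n x) -x2.
move: (sqrt_iter n x) `|x| p0 px IH x0 x1 => p y p0 py IH y0 y1.
have e : y - (p + (y ^+ 2 - p ^+ 2) / 2) = (y - p) * (1 - (y + p) / 2) by field.
have yp0 : 0 <= (y - p) * (1 - (y + p) / 2).
  by apply: mulr_ge0; lra.
split.
  apply/andP; split; last by rewrite -subr_ge0 e.
  by apply: addr_ge0 => //; apply: divr_ge0 => //; rewrite subr_sqr mulr_ge0//; lra.
rewrite e exprSr mulrA; apply: ler_pM => //; lra.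
Qed.

Lemma bclos_norm f : cl f -> (forall z, V z -> `|f z| <= 1) ->
  cl (fun z => `|f z|).
Proof.
move=> cf f1; apply: (bclos_lim (u := fun n z => sqrt_iter n (f z)) (C := 1)).
- elim=> [|n IH]; first exact: bclos0.
  apply: bclosD => //; have := bclosB (bclosX 2 cf) (bclosX 2 IH).
  by move=> /(bclosZ 2^-1); apply: bclos_eq => z _; rewrite mulrC.
- move=> n z Vz; have [/andP[p0 p1] _] := sqrt_iter_bound n (f1 z Vz).
  by rewrite ger0_norm// (le_trans p1)// f1.
- move=> z Vz; apply/cvgrPdist_le => e e0.
  (* The ratio [1 - |f z| / 2] is below 1 only when [f z] is nonzero; at a zero of [f] the bounds
     squeeze the iterates to 0. *)
  have [fz0|fz0] := eqVneq (f z) 0.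
    near=> n; have [/andP[p0 p1] _] := sqrt_iter_bound n (f1 z Vz).
    rewrite ger0_norm ?subr_ge0// (le_trans _ (ltW e0))// fz0 normr0 sub0r.
    by move: p0; rewrite fz0 oppr_le0.
  have fn0 : 0 < `|f z| by rewrite normr_gt0.
  have q1 : `|1 - `|f z| / 2| < 1.
    by have := f1 z Vz; move: fn0; move: `|f z| => y y0 y1; rewrite ger0_norm; lra.
  near=> n; have [/andP[p0 p1] p2] := sqrt_iter_bound n (f1 z Vz).
  rewrite ger0_norm ?subr_ge0// (le_trans p2)//.
  rewrite (@le_trans _ _ (1 * (1 - `|f z| / 2) ^+ n))//.
    by rewrite ler_wpM2r ?f1// exprn_ge0//; have := f1 z Vz; lra.
  rewrite mul1r (le_trans (ler_norm _))// -normrN -sub0r.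
  by near: n; move/cvgrPdist_le : (cvg_expr q1); exact.
Unshelve. all: by end_near. Qed.

Definition bclos_set D : Prop := cl \1_D.

(** With [p] the positive part of [f], so that 0 <= p <= 1 on [V], the polynomials 1 - (1 - p)^n
    tend to 1 where p > 0 and vanish elsewhere. *)
Lemma bclos_set_gt0 f : cl f -> (forall z, V z -> `|f z| <= 1) ->
  bclos_set [set z | 0 < f z].
Proof.
move=> cf f1; pose p z := 2^-1 * (f z + `|f z|).
have cp : cl p by apply: bclosZ; apply: bclosD => //; exact: bclos_norm.
have p01 z : V z -> 0 <= p z <= 1.
  move=> /f1; rewrite /p ler_norml => /andP[]; have := ler_norm (f z).
  by have := ler_norm (- f z); rewrite normrN; case: (ler0P (f z)); lra.
apply: (bclos_lim (u := fun n z => 1 - (1 - p z) ^+ n) (C := 1)).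
- by move=> n; apply: bclosB => //; apply: bclosX; exact: bclosB.
- move=> n z /p01 /andP[p0 p1].
  have := @exprn_ge0 _ n (1 - p z); have := @exprn_ile1 _ n (1 - p z).
  by rewrite ler_norml; lra.
- move=> z Vz; rewrite indicE.
  have [f0|f0] := ltP 0 (f z).
    rewrite mem_set//= -[X in _ --> X]subr0; apply: cvgB; first exact: cvg_cst.
    apply: cvg_expr; have /andP[p0 p1] := p01 z Vz.
    have : 0 < p z by rewrite /p gtr0_norm//; lra.
    by rewrite ger0_norm; lra.
  rewrite memNset/=; last by rewrite ltNge f0.
  have -> : p z = 0 by rewrite /p ler0_norm// subrr mulr0.
  by under eq_fun do rewrite subr0 expr1n subrr; exact: cvg_cst.
Qed.

Lemma bclos_setC D : bclos_set D -> bclos_set (~` D).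
Proof.
move=> cD; apply: bclos_eq (bclosB A_cst1 cD) => z _.
by rewrite !indicE in_setC; case: (z \in D); rewrite /= ?subrr ?subr0.
Qed.

Lemma bclos_setU D1 D2 : bclos_set D1 -> bclos_set D2 -> bclos_set (D1 `|` D2).
Proof.
move=> c1 c2; apply: bclos_eq (bclosB (bclosD c1 c2) (bclosM c1 c2)) => z _.
rewrite !indicE in_setU; case: (z \in D1); case: (z \in D2) => /=; ring.
Qed.

Lemma bclos_set_bigcup (D : nat -> set T) :
  (forall n, bclos_set (D n)) -> bclos_set (\bigcup_n D n).
Proof.
move=> cD; apply: (bclos_lim (u := fun n => \1_(\big[setU/set0]_(i < n) D i)) (C := 1)).
- elim=> [|n IH]; first by rewrite big_ord0 indic0; exact: bclos0.
  by rewrite big_ord_recr/=; exact: bclos_setU.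
- by move=> n z _; rewrite indicE ger0_norm// lern1 leq_b1.
- move=> z _; apply: cvg_near_cst; rewrite indicE.
  have [[n _ Dn]|nD] := pselect ((\bigcup_n D n) z).
    near=> m; rewrite indicE !mem_set//; first by exists n.
    rewrite -bigcup_mkord; exists n => //=.
    by near: m; exact: nbhs_infty_gt.
  near=> m; rewrite indicE !memNset// -bigcup_mkord => -[k _ Dk].
  by apply: nD; exists k.
Unshelve. all: by end_near. Qed.

Lemma bclos_set_eq D1 D2 : (forall z, V z -> D1 z <-> D2 z) ->
  bclos_set D1 -> bclos_set D2.
Proof.
move=> D12; apply: bclos_eq => z /D12[D12z D21z]; rewrite !indicE.
have [h|h] := pselect (D1 z); first by rewrite !mem_set//; exact: D12z.
by rewrite !memNset// => /D21z.
Qed.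

Lemma bclos_set_bigcup_countable (I : Type) (Q : set I) (D : I -> set T) :
  countable Q -> (forall i, Q i -> bclos_set (D i)) ->
  bclos_set (\bigcup_(i in Q) D i).
Proof.
move=> /countable_enum[->|[q Qq qE]] cD.
  by rewrite bigcup_set0 /bclos_set indic0; exact: bclos0.
by rewrite qE; apply: bclos_set_bigcup => n; exact: cD.
Qed.

Import HBNNSimple.

(** Adding [C] makes the function nonnegative, so simple functions increase to it and stay bounded.
    The map [p] lets the sigma-algebra live on a type other than [T]; it becomes the identity from
    [E] to [borelType E]. *)
Lemma bclos_measurable_fun {d} {X : measurableType d} (p : T -> X)
    (f : X -> R) (C : R) :
  (forall D : set X, measurable D -> bclos_set (p @^-1` D)) ->
  measurable_fun setT f -> (forall x, `|f x| <= C) -> cl (fun z => f (p z)).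
Proof.
move=> cD mf fC; pose g x := (f x + C)%:E.
have mg : measurable_fun setT g.
  by apply/measurable_EFinP; exact: measurable_funD.
have g0 x : (0 <= g x)%E.
  by rewrite lee_fin; have := fC x; rewrite ler_norml; lra.
pose s := nnsfun_approx measurableT mg.
have sg x : (fun n => s n x) @ \oo --> f x + C.
  have := cvg_nnsfun_approx measurableT mg (fun x _ => g0 x) (I : setT x).
  by move/fine_cvg.
have sle n x : s n x <= f x + C.
  have nd : nondecreasing_seq (fun n => s n x).
    by move=> m k mk; exact/lefP/nd_nnsfun_approx.
  have := nondecreasing_cvgn_le nd (cvgP _ (sg x)) n.
  by rewrite (cvg_lim _ (sg x)).
suff cs : cl (fun z => f (p z) + C).
  by apply: bclos_eq (bclosB cs (bclos_cst C)) => z _; rewrite addrK.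
apply: (bclos_lim (u := fun n z => s n (p z)) (C := 2 * C)).
- move=> n; apply: (@bclos_eq (fun z => \sum_(y <- fset_set (range (s n)))
    y * \1_(p @^-1` (s n @^-1` [set y])) z)).
    move=> z _; rewrite [RHS]fimfunE fsbig_finite//=.
  elim: (fset_set _ : seq R) => [|y r IH].
    by apply: bclos_eq bclos0 => z _; rewrite big_nil.
  have cy : cl \1_(p @^-1` (s n @^-1` [set y])) by apply: cD; exact: measurable_sfunP.
  by apply: bclos_eq (bclos_lin y cy IH) => z _; rewrite big_cons.
- move=> n z _; rewrite ger0_norm// (le_trans (sle n (p z)))//.
  by have := fC (p z); rewrite ler_norml; lra.
- by move=> z _; exact: sg.
Qed.

End bounded_closure.

(** The balls kept are those centred in [C], of radius 1 / (n + 1), that lie inside [O]. A radius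
    below e / 2 keeps a ball containing z within the e-ball about z. *)
Lemma open_separable_cover {R : realType} {E : normedModType R} (C O : set E) :
  countable C -> open O -> exists2 Q : set (E * nat), countable Q &
    forall z, closure C z ->
      (O z <-> exists2 p, Q p & `|z - p.1| <= p.2.+1%:R^-1).
Proof.
move=> cC oO; pose B (p : E * nat) := [set z : E | `|z - p.1| <= p.2.+1%:R^-1].
exists [set p : E * nat | C p.1 /\ B p `<=` O].
  apply: (@sub_countable _ _ _ (C `*` [set: nat])); first by apply: subset_card_le => p [].
  by apply: countableX => //; exact: countableP.
move=> z Cz; split=> [Oz|[p [_ pO] Bz]]; last exact: pO.
have /nbhs_ballP[e /= e0 eO] := open_nbhs_nbhs (conj oO Oz).
have [n ne] : exists n, n.+1%:R^-1 < e / 2.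
  have [n _ /(_ n (leqnn n))] := near_infty_natSinv_lt (PosNum (divr_gt0 e0 (ltr0n _ 2))).
  by exists n.
have n0 : 0 < n.+1%:R^-1 :> R by rewrite invr_gt0.
have [d [Cd /= zd]] := Cz _ (nbhsx_ballx z _ n0).
move: zd; rewrite -ball_normE/= => zd.
exists (d, n); last by rewrite ltW.
split=> // y; rewrite /B/= => yd; apply: eO; rewrite -ball_normE/=.
rewrite -(subrK d z) -addrA (le_lt_trans (ler_normD _ _))//.
by rewrite (distrC d y); move: (n.+1%:R^-1) `|z - d| `|y - d| ne zd yd => r p q; lra.
Qed.

(** * Bounded Borel functions as bounded limits of cosines *)

Section borel_functions.
Context {R : realType} {E : normedModType R}.
Variables (V C : set E).
Hypothesis C_countable : countable C.
Hypothesis C_dense : V `<=` closure C.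

Definition trig_fun : set (E -> R) :=
  [set f | exists2 xs : {linear E -> R^o}, continuous xs &
    exists th : R, f = fun z => cos ((xs z : R) + th)].

Local Notation cl := (bclos V trig_fun).
Local Notation cl_set := (bclos_set V trig_fun).

Lemma trig_fun_bounded f : trig_fun f ->
  exists C : R, forall z, V z -> `|f z| <= C.
Proof.
move=> [xs _ [th ->]]; exists 1 => z _.
by rewrite ler_norml cos_geN1 cos_le1.
Qed.

Lemma trig_fun_cst1 : cl (fun=> 1).
Proof.
apply: bclos_base; exists (\0 : {linear E -> R^o}).
  by move=> z; exact: cvg_cst.
by exists 0; apply/funext => z; rewrite addr0 cos0.
Qed.

Lemma trig_funM f g : trig_fun f -> trig_fun g -> cl (fun z => f z * g z).
Proof.
move=> [xs cxs [a ->]] [ys cys [b ->]].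
have cD : cl (fun z => cos ((xs z : R) + ys z + (a + b))).
  apply: bclos_base; exists (xs \+ ys : {linear E -> R^o}); last by exists (a + b).
  by move=> z; apply: cvgD; [exact: cxs|exact: cys].
have cB : cl (fun z => cos ((xs z : R) - ys z + (a - b))).
  apply: bclos_base; exists (xs \- ys : {linear E -> R^o}); last by exists (a - b).
  by move=> z; apply: cvgB; [exact: cxs|exact: cys].
have := bclosZ trig_fun_bounded trig_fun_cst1 2^-1
  (bclosD trig_fun_bounded cD cB).
apply: (bclos_eq trig_fun_bounded) => z _.
rewrite (_ : _ + _ + (a + b) = ((xs z : R) + a) + ((ys z : R) + b)); last by ring.
rewrite (_ : _ - _ + (a - b) = ((xs z : R) + a) - ((ys z : R) + b)); last by ring.
by rewrite cosD cosB; field.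
Qed.

Let bnd := trig_fun_bounded.
Let c1 := trig_fun_cst1.

(** At each point, (xs z - c) / (n + 1) eventually lies in (-pi, pi), where sine has the sign of its
    argument; so the indicators of the sets [D n] become constant with the right value. *)
Lemma bclos_halfspace (xs : {linear E -> R^o}) (c : R) : continuous xs ->
  cl_set [set z | c < xs z].
Proof.
move=> cxs.
pose D n := [set z | 0 < sin (n.+1%:R^-1 * ((xs z : R) - c))].
have cD n : cl_set (D n).
  apply: (bclos_set_gt0 bnd c1 trig_funM); last first.
    by move=> z _; rewrite ler_norml sin_geN1 sin_le1.
  apply: bclos_base; exists (n.+1%:R^-1 \*: xs : {linear E -> R^o}).
    by move=> z; apply: cvgZr; exact: cxs.
  exists (- (n.+1%:R^-1 * c) - pi / 2); apply/funext => z.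
  rewrite addrA cosB cos_pihalf sin_pihalf mulr0 add0r mulr1; congr sin.
  by rewrite mulrBr.
apply: (bclos_lim (u := fun n => \1_(D n)) (C := 1)) => //.
  by move=> n z _; rewrite indicE ger0_norm// lern1 leq_b1.
move=> z _; apply: cvg_near_cst; near=> n.
have n0 : 0 < n.+1%:R^-1 :> R by rewrite invr_gt0.
have hn : n.+1%:R^-1 * `|(xs z : R) - c| < pi.
  rewrite mulrC ltr_pdivrMr ?ltr0n//.
  have : `|(xs z : R) - c| < n.+1%:R.
    rewrite -natr1 ltr_wpDr//; near: n; exact: nbhs_infty_gtr.
  have := @pi_ge2 R; have := normr_ge0 ((xs z : R) - c).
  by move: (n.+1%:R : R) => m; nra.
rewrite !indicE; congr (_%:R); congr nat_of_bool.
have [h|h] := ltP c (xs z).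
  rewrite !mem_set//=; apply: sin_gt0_pi.
  by rewrite mulr_gt0 ?subr_gt0//= -(gtr0_norm (_ : 0 < (xs z : R) - c)) ?subr_gt0.
rewrite !memNset//=; apply/negP; rewrite -leNgt //.
rewrite -oppr_ge0 -sinN -mulrN opprB; apply: sin_ge0_pi.
rewrite mulr_ge0 ?(ltW n0) ?subr_ge0//= ltW//.
by rewrite -(ger0_norm (_ : 0 <= c - (xs z : R))) ?subr_ge0// distrC.
Unshelve. all: by end_near. Qed.

(** On [V] the ball is the intersection of countably many closed half-spaces, one for each
    functional norming [d - c] with [d] in [C]. *)
Lemma bclos_closed_ball (c : E) (r : R) : cl_set [set z | `|z - c| <= r].
Proof.
pose nf v : {linear E -> R^o} := sval (cid (norming_functional v)).
have nfP v : [/\ continuous (nf v), forall x, `|nf v x| <= `|x| & nf v v = `|v|].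
  by rewrite /nf; case: cid.
apply: (bclos_set_eq bnd (D1 := ~` \bigcup_(d in C) [set z | r + nf (d - c) c < nf (d - c) z])).
  move=> z Vz; split=> [h|/= h [d Cd] /=].
    rewrite /= leNgt; apply/negP => rz; apply: h.
    (* For [d] within [e] of [z], the functional norming [d - c] takes at [z - c] a value at least
       |d - c| - |z - d| > |z - c| - 2 e = r. *)
    pose e := (`|z - c| - r) / 2.
    have e0 : 0 < e by rewrite divr_gt0// subr_gt0.
    have [d [Cd /= zd]] := C_dense Vz (nbhsx_ballx z _ e0).
    exists d => //=; have [_ nle nE] := nfP (d - c).
    rewrite -ltrBrDr -raddfB/=.
    rewrite (_ : z - c = (z - d) + (d - c)); last by rewrite addrA subrK.
    rewrite raddfD/= nE.
    have h1 := nle (z - d); have : `|z - d| < e by move: zd; rewrite -ball_normE.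
    have : `|z - c| <= `|z - d| + `|d - c|.
      by rewrite (le_trans _ (ler_normD _ _))// addrA subrK.
    move: h1; rewrite ler_norml => /andP[h1 _].
    rewrite /e; move: `|z - d| `|d - c| `|z - c| (nf (d - c) (z - d) : R) h1 => p q s u.
    by lra.
  have [_ nle nE] := nfP (d - c).
  rewrite -ltrBrDr -raddfB/=; apply/negP; rewrite -leNgt (le_trans _ h)//.
  exact: (le_trans (ler_norm _) (nle _)).
apply: (bclos_setC bnd c1); apply: (bclos_set_bigcup_countable bnd c1 trig_funM) => // d _.
by apply: bclos_halfspace; have [] := nfP (d - c).
Qed.

Lemma bclos_open (O : set E) : open O -> cl_set O.
Proof.
move=> oO; have [Q cQ QO] := open_separable_cover C_countable oO.
apply: (bclos_set_eq bnd (D1 := \bigcup_(p in Q) [set z | `|z - p.1| <= p.2.+1%:R^-1])).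
  move=> z Vz; have [h1 h2] := QO z (C_dense Vz).
  by split=> [[p Qp pz]|/h1[p Qp pz]]; [apply: h2; exists p|exists p].
apply: (bclos_set_bigcup_countable bnd c1 trig_funM) => // p _.
exact: bclos_closed_ball.
Qed.

Lemma bclos_borel (D : set (borelType E)) : measurable D -> cl_set D.
Proof.
move=> mD; apply: (mD cl_set); split; last by move=> O; exact: bclos_open.
split.
- by rewrite /bclos_set indic0; exact: bclos0.
- by move=> A cA; rewrite setTD; exact: bclos_setC.
- by move=> A cA; exact: (bclos_set_bigcup bnd c1 trig_funM).
Qed.

Lemma bclos_bounded_borel (f : E -> R) (K : R) :
  measurable_fun setT (f : borelType E -> R) -> (forall z, `|f z| <= K) -> cl f.
Proof.
move=> mf fK.
exact: (@bclos_measurable_fun _ _ _ _ bnd c1 _ (borelType E)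
  (fun z => z) f K bclos_borel mf fK).
Qed.

End borel_functions.

(** * Differentiation along a Gaussian shift *)

Section gaussian_shift.
Context {R : realType} {E : normedModType R}.
Context {d : measure_display} {Omega : measurableType d}.
Variable P : probability Omega R.
Variables (V : set E) (X : Omega -> E) (G : Omega -> R) (y : E) (s2 : R).
Notation mu := (@lebesgue_measure R).
Hypothesis mX : forall xs : {linear E -> R^o}, continuous xs ->
  measurable_fun setT (fun w => xs (X w) : R).
Hypothesis mG : measurable_fun setT G.
Hypothesis iG : P.-integrable setT (fun w => (`|G w| ^+ 3)%:E).
Hypothesis XV : forall w q, V (X w + q *: y).
(** This is what the section retains of joint normality of <X, x*> and G: in the application [v] is
    the variance of <X, x*>, [s2] that of [G], and <y, x*> their covariance. *)
Hypothesis char_fun : forall xs : {linear E -> R^o}, continuous xs ->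
  exists v : R, forall b th : R,
    \int[P]_w cos ((xs (X w) : R) + b * G w + th) =
    cos th * expR (- (v + 2 * b * xs y + b ^+ 2 * s2) / 2).
Local Notation cl := (bclos V (@trig_fun R E)).

Let iG1 : P.-integrable setT (EFin \o G).
Proof.
apply: (@le_integrable_norm _ _ _ P setT measurableT _ (fun w => `|G w| ^+ 1)) => //.
exact: (integrable_cube_le _ mG iG).
Qed.

Let iG2 : P.-integrable setT (EFin \o (fun w => G w ^+ 2)).
Proof.
have := integrable_cube_le (isT : 2 <= 3)%N mG iG; apply: eq_integrable => //.
by move=> w _ /=; rewrite real_normK ?num_real.
Qed.

Let i1 : P.-integrable setT (EFin \o (fun=> 1)).
Proof. exact: (finite_measure_integrable_cst P 1 measurableT). Qed.

Let m1 : measurable_fun setT ((fun=> 1) : Omega -> R). Proof. by []. Qed.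

(** Each derivative of [char_fun] in b at 0 brings down a factor [G]. Subtracting [s2] in the last
    identity leaves exactly the second derivative at q = 0 of E cos(<X + q y, x*> + th) = K cos(q
    <y, x*> + th); the middle identity is the first derivative. *)
Lemma gaussian_trig_moments (xs : {linear E -> R^o}) : continuous xs ->
  exists K : R, forall th : R,
  [/\ \int[P]_w cos ((xs (X w) : R) + th) = K * cos th,
      \int[P]_w (cos ((xs (X w) : R) + th) * G w) = - (K * xs y * sin th) &
      \int[P]_w (cos ((xs (X w) : R) + th) * (G w ^+ 2 - s2)) =
        - (K * (xs y : R) ^+ 2 * cos th)].
Proof.
move=> cxs; have [v hv] := char_fun cxs; exists (expR (- v / 2)).
pose e b := expR (- (v + 2 * b * xs y + b ^+ 2 * s2) / 2).
have e0 : e 0 = expR (- v / 2) by rewrite /e; congr expR; ring.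
have de (b : R) : is_derive b 1 e (- (xs y + b * s2) * e b).
  by rewrite /e; apply: is_derive_eq; rewrite /GRing.scale/=; field.
have mZ th : measurable_fun setT (fun w => (xs (X w) : R) + th).
  by apply: measurable_funD => //; exact: mX.
have sE x : cos (x - pi / 2) = sin x :> R.
  by rewrite cosB cos_pihalf sin_pihalf mulr0 add0r mulr1.
have i1G : P.-integrable setT (EFin \o (fun w => 1 * G w)).
  by apply: eq_integrable iG1 => // w _ /=; rewrite mul1r.
have i1G2 : P.-integrable setT (EFin \o (fun w => `|1| * G w ^+ 2)).
  by apply: eq_integrable iG2 => // w _ /=; rewrite normr1 mul1r.
(* Stated for every [b], not only 0, because it is differentiated once more for [T2]. *)
have T1 th b : \int[P]_w (G w * cos ((xs (X w) : R) + th + b * G w)) =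
    sin th * (- (xs y + b * s2) * e b).
  have h1 := is_derive_Rintegral_sin b m1 (mZ th) mG i1 i1G i1G2.
  have h2 : is_derive b 1 (fun b => \int[P]_w (1 * sin ((xs (X w) : R) + th + b * G w)))
      (sin th * (- (xs y + b * s2) * e b)).
    rewrite (_ : (fun b => _) = (fun b => sin th * e b)).
      by have db := de b; apply: is_derive_eq; rewrite /GRing.scale/=; ring.
    apply/funext => c; rewrite -sE -hv; apply: eq_Rintegral => w _.
    by rewrite mul1r -sE; congr cos; ring.
  have := @derive_val _ _ _ _ _ _ _ h1; rewrite (@derive_val _ _ _ _ _ _ _ h2) => ->.
  by apply: eq_Rintegral => w _; rewrite mul1r.
have iGG2 : P.-integrable setT (EFin \o (fun w => `|G w| * G w ^+ 2)).
  by apply: eq_integrable iG => // w _ /=; rewrite exprS real_normK ?num_real.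
have iGG : P.-integrable setT (EFin \o (fun w => G w * G w)) by [].
have T2 th : \int[P]_w (G w * G w * sin ((xs (X w) : R) + th)) =
    sin th * ((s2 - (xs y : R) ^+ 2) * e 0).
  have h1 := is_derive_Rintegral_cos 0 mG (mZ th) mG iG1 iGG iGG2.
  have h2 : is_derive (0 : R) 1 (fun b => \int[P]_w (G w * cos ((xs (X w) : R) + th + b * G w)))
      (- (sin th * ((s2 - (xs y : R) ^+ 2) * e 0))).
    rewrite (_ : (fun b => _) = (fun b => sin th * (- (xs y + b * s2) * e b))).
      have db := de 0; apply: is_derive_eq; rewrite /GRing.scale/=; ring.
    by apply/funext => c; exact: T1.
  have := @derive_val _ _ _ _ _ _ _ h1; rewrite (@derive_val _ _ _ _ _ _ _ h2).
  move=> /oppr_inj ->.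
  by apply: eq_Rintegral => w _; rewrite mul0r addr0.
have T0 th : \int[P]_w cos ((xs (X w) : R) + th) = expR (- v / 2) * cos th.
  rewrite -e0 mulrC -hv; apply: eq_Rintegral => w _.
  by rewrite mul0r addr0.
move=> th; split=> //.
  transitivity (\int[P]_w (G w * cos ((xs (X w) : R) + th + 0 * G w))).
    by apply: eq_Rintegral => w _; rewrite mul0r addr0 mulrC.
  by rewrite T1 e0; ring.
have sE' x : sin (x + pi / 2) = cos x :> R.
  by rewrite sinD cos_pihalf sin_pihalf mulr0 add0r mulr1.
have icos : P.-integrable setT (EFin \o (fun w => cos ((xs (X w) : R) + th))).
  apply: (@bounded_integrable _ _ _ P _ 1); first exact: measurable_fun_cos.
  by move=> w; rewrite ler_norml cos_geN1 cos_le1.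
have icosG : P.-integrable setT (EFin \o (fun w => G w * G w * cos ((xs (X w) : R) + th))).
  apply: (@le_integrable_norm _ _ _ P setT measurableT _ (fun w => G w ^+ 2)) => //.
    by apply: measurable_funM; [exact: measurable_funM|exact: measurable_fun_cos].
  move=> w _; rewrite normrM -expr2 (ger0_norm (sqr_ge0 _)) ler_piMr ?sqr_ge0//.
  by rewrite ler_norml cos_geN1 cos_le1.
transitivity (\int[P]_w (G w * G w * cos ((xs (X w) : R) + th) - s2 * cos ((xs (X w) : R) + th))).
  by apply: eq_Rintegral => w _; ring.
rewrite RintegralB//; last by have := integrableZl measurableT s2 icos; apply: eq_integrable.
rewrite RintegralZl// T0.
transitivity (\int[P]_w (G w * G w * sin ((xs (X w) : R) + (th + pi / 2))) -
    s2 * (expR (- v / 2) * cos th)).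
  by congr (_ - _); apply: eq_Rintegral => w _; rewrite addrA sE'.
by rewrite T2 sE' e0; ring.
Qed.

(* Unlike differentiability at 0, this integrated second-order Taylor formula
   involves no derivative of [F] and is stable under bounded limits. *)
Definition shift_taylor (F : E -> R) : Prop :=
  [/\ forall q, measurable_fun setT (fun w => F (X w + q *: y)),
      measurable_fun setT
        (fun q : R => \int[P]_w (F (X w + q *: y) * (G w ^+ 2 - s2))) &
      forall e : R, 0 < e ->
        \int[P]_w F (X w + e *: y) - \int[P]_w F (X w + 0 *: y) -
          e * \int[P]_w (F (X w + 0 *: y) * G w) =
        \int[mu]_(q in `[0, e])
          ((e - q) * \int[P]_w (F (X w + q *: y) * (G w ^+ 2 - s2)))].

Lemma shift_taylor_trig (xs : {linear E -> R^o}) (th : R) : continuous xs ->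
  shift_taylor (fun z => cos ((xs z : R) + th)).
Proof.
move=> cxs; have [K hK] := gaussian_trig_moments cxs.
pose k : R := xs y.
have xE w q : (xs (X w + q *: y) : R) + th = (xs (X w) : R) + (q * k + th).
  by rewrite linearD linearZ/= addrA.
have hE q : \int[P]_w (cos ((xs (X w + q *: y) : R) + th) * (G w ^+ 2 - s2)) =
    - (K * k ^+ 2 * cos (q * k + th)).
  have [_ _ <-] := hK (q * k + th); apply: eq_Rintegral => w _.
  by rewrite xE.
have caff : continuous (fun q : R => q * k + th).
  by move=> q; apply: cvgD; [apply: cvgMl; exact: cvg_id|exact: cvg_cst].
have ccos : continuous (fun q : R => cos (q * k + th)).
  by move=> q; apply: continuous_comp; [exact: caff|exact: continuous_cos].
split.
- move=> q; under eq_fun do rewrite xE.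
  by apply: measurable_fun_cos; apply: measurable_funD => //; exact: mX.
- under eq_fun do rewrite hE.
  apply: measurableT_comp => //; apply: measurable_funM => //.
  exact: continuous_measurable_fun.
- move=> e e0.
  have mE q : \int[P]_w cos ((xs (X w + q *: y) : R) + th) = K * cos (q * k + th).
    have [<- _ _] := hK (q * k + th).
    by apply: eq_Rintegral => w _; rewrite xE.
  have -> : \int[P]_w (cos ((xs (X w + 0 *: y) : R) + th) * G w) = - (K * k * sin th).
    have [_ <- _] := hK th.
    by apply: eq_Rintegral => w _; rewrite scale0r addr0.
  rewrite !mE mul0r add0r; under eq_Rintegral do rewrite hE.
  (* With u(q) = K cos(q k + th), this is u + (e - q) u'; its derivative collapses to (e - q) u'',
     and Phi(e) - Phi(0) is the left-hand side. *)
  pose Phi := fun q : R => K * cos (q * k + th) + (e - q) * (- (K * k * sin (q * k + th))).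
  have dPhi (q : R) : is_derive q 1 Phi ((e - q) * (- (K * k ^+ 2 * cos (q * k + th)))).
    by rewrite /Phi; apply: is_derive_eq; rewrite /GRing.scale/=; ring.
  rewrite (continuous_Rintegral_FTC2 e0 _ dPhi).2.
    by rewrite /Phi mul0r add0r; ring.
  move=> q; apply: cvgM.
    by apply: cvgB; [exact: cvg_cst|exact: cvg_id].
  by apply: cvgN; apply: cvgMr; exact: ccos.
Qed.

Let bounded_shiftM (F : E -> R) (M : Omega -> R) (C : R) q :
  (forall z, V z -> `|F z| <= C) ->
  measurable_fun setT (fun w => F (X w + q *: y)) ->
  measurable_fun setT M -> P.-integrable setT (EFin \o M) ->
  P.-integrable setT (EFin \o (fun w => F (X w + q *: y) * M w)) /\
  `|\int[P]_w (F (X w + q *: y) * M w)| <= C * \int[P]_w `|M w|.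
Proof.
move=> FC mF mM iM.
have iCM : P.-integrable setT (EFin \o (fun w => C * `|M w|)).
  have := integrableZl measurableT C (integrable_norm iM).
  by apply: eq_integrable.
have le w : `|F (X w + q *: y) * M w| <= C * `|M w|.
  by rewrite normrM ler_wpM2r// FC.
have mFM : measurable_fun setT (fun w => F (X w + q *: y) * M w).
  exact: measurable_funM.
split; first exact: (le_integrable_norm measurableT mFM (fun w _ => le w) iCM).
rewrite -RintegralZl//; last exact: (integrable_norm iM).
exact: normr_Rintegral_le.
Qed.

Let W2 (w : Omega) : R := G w ^+ 2 - s2.

Let mW2 : measurable_fun setT W2.
Proof. by apply: measurable_funB => //; exact: measurable_funX. Qed.

Let iW2 : P.-integrable setT (EFin \o W2).
Proof.
have := integrableB measurableT iG2 (finite_measure_integrable_cst P s2 measurableT).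
by apply: eq_integrable.
Qed.

Let remainder_le (F : E -> R) (C e : R) : 0 < e ->
  (forall z, V z -> `|F z| <= C) -> shift_taylor F ->
  forall q, q \in `[0, e] -> `|(e - q) * \int[P]_w (F (X w + q *: y) * W2 w)| <=
    e * (C * \int[P]_w `|W2 w|).
Proof.
move=> e0 FC [mF _ _] q; rewrite in_itv/= => /andP[q0 qe].
have [_ h] := bounded_shiftM FC (mF q) mW2 iW2.
rewrite normrM ler_pM// ger0_norm ?subr_ge0//.
by rewrite lerBlDr lerDl.
Qed.

Let measurable_remainder (F : E -> R) (e : R) : shift_taylor F ->
  measurable_fun (`[0, e] : set (measurableTypeR R))
    (fun q : R => (e - q) * \int[P]_w (F (X w + q *: y) * W2 w)).
Proof.
move=> [_ mh _]; apply: measurable_funTS.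
apply: measurable_funM; last exact: mh.
exact: measurable_funB.
Qed.

Let integrable_cst_itv (e c : R) : mu.-integrable `[0, e] (EFin \o cst c).
Proof.
apply: continuous_compact_integrable; first exact: segment_compact.
by apply: continuous_subspaceT => x; exact: cvg_cst.
Qed.

Let integrable_remainder (F : E -> R) (C e : R) : 0 < e ->
  (forall z, V z -> `|F z| <= C) -> shift_taylor F ->
  mu.-integrable `[0, e]
    (EFin \o (fun q => (e - q) * \int[P]_w (F (X w + q *: y) * W2 w))).
Proof.
move=> e0 FC tF; apply: (@le_integrable_norm _ _ _ mu `[0, e] _ _
  (cst (e * (C * \int[P]_w `|W2 w|)))) => //.
- exact: measurable_remainder.
- by move=> q eq; exact: (remainder_le e0 FC tF).
Qed.

(** In the limit case dominated convergence is used first in w for each q, then in q with the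
    constant bound of [remainder_le]. Measurability in q is itself inherited by limits, which avoids
    joint measurability in (q, w). *)
Lemma shift_taylor_bclos (F : E -> R) : cl F -> shift_taylor F.
Proof.
elim=> [f [xs cxs [th ->]]|c f g cf tf cg tg|u f C cu tu uC uf].
- exact: shift_taylor_trig.
- have [C fC] := bclos_bounded (@trig_fun_bounded R E V) cf.
  have [C' gC] := bclos_bounded (@trig_fun_bounded R E V) cg.
  have [mf hf Tf] := tf; have [mg hg Tg] := tg.
  have linM (M : Omega -> R) q : measurable_fun setT M -> P.-integrable setT (EFin \o M) ->
      \int[P]_w ((c * f (X w + q *: y) + g (X w + q *: y)) * M w) =
      c * \int[P]_w (f (X w + q *: y) * M w) + \int[P]_w (g (X w + q *: y) * M w).
    move=> mM iM.
    have [iF _] := bounded_shiftM fC (mf q) mM iM.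
    have [iK _] := bounded_shiftM gC (mg q) mM iM.
    rewrite -RintegralZl// -RintegralD//.
      by apply: eq_Rintegral => w _; rewrite mulrDl mulrA.
    by have := integrableZl measurableT c iF; apply: eq_integrable.
  have lin1 q : \int[P]_w (c * f (X w + q *: y) + g (X w + q *: y)) =
      c * \int[P]_w f (X w + q *: y) + \int[P]_w g (X w + q *: y).
    have := linM _ q m1 i1; under eq_Rintegral do rewrite mulr1.
    by move=> ->; congr (_ * _ + _); apply: eq_Rintegral => w _; rewrite mulr1.
  split.
  + by move=> q; apply: measurable_funD => //; exact: measurable_funM.
  + under eq_fun do rewrite linM//.
    by apply: measurable_funD => //; exact: measurable_funM.
  + move=> e e0; rewrite !lin1 linM//.
    under [RHS]eq_Rintegral do rewrite linM// mulrDr mulrCA.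
    have ir := integrable_remainder e0 fC tf.
    rewrite RintegralD//; last exact: (integrable_remainder e0 gC tg).
      rewrite RintegralZl// -Tf// -Tg//; ring.
    have mI : measurable (`[0, e] : set (measurableTypeR R)) by [].
    by have := integrableZl mI c ir; apply: eq_integrable.
- have mf q : measurable_fun setT (fun w => f (X w + q *: y)).
    apply: (@measurable_realfun.measurable_fun_cvg _ _ _ _
      (fun n w => u n (X w + q *: y))).
      by move=> n; have [m _ _] := tu n; exact: m.
    by move=> w _; exact: uf.
  have cvM (M : Omega -> R) q : measurable_fun setT M -> P.-integrable setT (EFin \o M) ->
      (fun n => \int[P]_w (u n (X w + q *: y) * M w)) @ \oo -->
      \int[P]_w (f (X w + q *: y) * M w).
    move=> mM iM; apply: (@Rintegral_dominated_cvg _ _ _ P setT measurableT _ _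
      (fun w => C * `|M w|) _ _ _ _).2.
    + by move=> n; apply: measurable_funM => //; have [m _ _] := tu n; exact: m.
    + have := integrableZl measurableT C (integrable_norm iM).
      by apply: eq_integrable.
    + by move=> n w _; rewrite normrM ler_wpM2r// uC.
    + by move=> w _; apply: cvgMl; exact: uf.
  have cv1 q : (fun n => \int[P]_w u n (X w + q *: y)) @ \oo -->
      \int[P]_w f (X w + q *: y).
    have := cvM _ q m1 i1; under eq_Rintegral do rewrite mulr1.
    apply: cvg_trans; apply: near_eq_cvg; apply: nearW => n.
    by apply: eq_Rintegral => w _; rewrite mulr1.
  split => //.
    apply: (@measurable_realfun.measurable_fun_cvg _ (measurableTypeR R) R setT
      (fun n (q : R) => \int[P]_w (u n (X w + q *: y) * W2 w))).
      by move=> n; have [_ m _] := tu n; exact: m.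
    by move=> q _; exact: cvM.
  move=> e e0.
  have L : (fun n => \int[P]_w u n (X w + e *: y) - \int[P]_w u n (X w + 0 *: y) -
      e * \int[P]_w (u n (X w + 0 *: y) * G w)) @ \oo -->
      \int[P]_w f (X w + e *: y) - \int[P]_w f (X w + 0 *: y) -
      e * \int[P]_w (f (X w + 0 *: y) * G w).
    by apply: cvgB; [apply: cvgB; exact: cv1|apply: cvgMr; exact: cvM].
  apply: (cvg_unique _ L) => //.
  have -> : (fun n => \int[P]_w u n (X w + e *: y) - \int[P]_w u n (X w + 0 *: y) -
      e * \int[P]_w (u n (X w + 0 *: y) * G w)) =
      (fun n => \int[mu]_(q in `[0, e]) ((e - q) * \int[P]_w (u n (X w + q *: y) * W2 w))).
    by apply/funext => n; have [_ _ ->] := tu n.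
  apply: (@Rintegral_dominated_cvg _ _ _ mu `[0, e] (measurable_itv _) _ _
    (cst (e * (C * \int[P]_w `|W2 w|))) _ _ _ _).2.
  + by move=> n; exact: measurable_remainder.
  + exact: integrable_cst_itv.
  + by move=> n q eq; exact: (remainder_le e0 (uC n) (tu n)).
  + by move=> q _; apply: cvgMr; exact: cvM.
Qed.

Lemma shift_expansion (F : E -> R) (C : R) : cl F ->
  (forall z, V z -> `|F z| <= C) -> forall e : R, 0 <= e ->
  `|\int[P]_w F (X w + e *: y) - \int[P]_w F (X w) - e * \int[P]_w (F (X w) * G w)|
    <= C * \int[P]_w `|W2 w| * e ^+ 2.
Proof.
move=> cF FC e; rewrite le_eqVlt => /predU1P[<-|e0].
  rewrite expr0n/= mulr0 mul0r subr0.
  under eq_Rintegral do rewrite scale0r addr0.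
  by rewrite subrr normr0.
have tF := shift_taylor_bclos cF; have [_ _ /(_ e e0)] := tF.
under [X in _ - X - _]eq_Rintegral do rewrite scale0r addr0.
under [X in _ - _ * X]eq_Rintegral do rewrite scale0r addr0.
move=> ->; have mI : measurable (`[0, e] : set (measurableTypeR R)) by [].
have := normr_Rintegral_le mI (measurable_remainder tF)
  (integrable_cst_itv e (e * (C * \int[P]_w `|W2 w|))) (remainder_le e0 FC tF).
move=> /le_trans; apply.
rewrite Rintegral_cst//= lebesgue_measure_itv/= lte_fin e0 -EFinB subr0.
by rewrite le_eqVlt; apply/orP; left; apply/eqP => /=; ring.
Qed.

End gaussian_shift.

(** * Borel maps and continuous compositions *)

Section borel_measurability.
Context {d : measure_display} {T : measurableType d}.

Lemma measurable_borelP {E : ptopologicalType} (D : set T) (f : T -> E) :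
  (measurable D -> forall O : set E, open O -> measurable (D `&` f @^-1` O)) ->
  measurable_fun D (f : T -> borelType E).
Proof.
move=> mf mD; have := @measurability _ _ T (borelType E) D f (@open E) erefl; apply=> //.
by move=> _ [A oA <-]; exact: mf.
Qed.

Lemma measurable_fun_borel_continuous {E F : ptopologicalType} (D : set T)
    (f : T -> E) (g : E -> F) : measurable_fun D (f : T -> borelType E) ->
  continuous g -> measurable_fun D ((g \o f) : T -> borelType F).
Proof.
move=> mf /continuousP cg; apply: measurable_borelP => mD O oO.
by apply: (mf mD (g @^-1` O)); apply: sub_gen_smallest; exact: cg.
Qed.

Lemma measurable_fun_borel_real {R : realType} {E : ptopologicalType} (D : set T)
    (f : T -> E) (g : E -> R) : measurable_fun D (f : T -> borelType E) ->
  continuous g -> measurable_fun D (g \o f).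
Proof.
move=> mf /continuousP cg mD; apply: (measurability _ (RGenOpens.measurableE R)) => //.
move=> _ [_ [a [b ->] <-]]; apply: (mf mD (g @^-1` `]a, b[)).
apply: sub_gen_smallest; apply: cg; exact: interval_open.
Qed.

End borel_measurability.

(** * The two-sided derivative along the shift *)

Section gaussian_shift_derivative.
Context {R : realType} {E : normedModType R}.
Context {d : measure_display} {Omega : measurableType d}.
Variable P : probability Omega R.
Variables (X : Omega -> E) (G : Omega -> R) (y : E) (s2 : R).
Hypothesis X_sm : strongly_measurable setT X.
Hypothesis mG : measurable_fun setT G.
Hypothesis iG : P.-integrable setT (fun w => (`|G w| ^+ 3)%:E).
Hypothesis char_fun : forall xs : {linear E -> R^o}, continuous xs ->
  exists v : R, forall b th : R,
    \int[P]_w cos ((xs (X w) : R) + b * G w + th) =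
    cos th * expR (- (v + 2 * b * xs y + b ^+ 2 * s2) / 2).

Let V := [set z | exists w q, z = X w + q *: y].

Let V_separable : exists2 C : set E, countable C & V `<=` closure C.
Proof.
have [_ [C cC XC]] := X_sm.
exists [set p.1 + ratr p.2 *: y | p in C `*` [set: rat]].
  apply: card_le_trans (card_image_le _ _) _.
  by apply: countableX => //; exact: countableP.
move=> _ [w [q ->]]; have /XC Xw : (X @` setT) (X w) by exists w.
move=> O /nbhs_ballP[e /= e0 eO].
have e20 : 0 < e / 2 by rewrite divr_gt0.
have [c [Cc /=]] := Xw _ (nbhsx_ballx (X w) _ e20).
rewrite -ball_normE /= => Xc.
(* Half of [e] is left for replacing [q] by a rational; adding 1 to [|y|] covers [y = 0]. *)
pose k := e / 2 / (`|y| + 1).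
have k0 : 0 < k by rewrite divr_gt0// ltr_wpDl.
have qk : q < q + k by rewrite ltrDl.
have [r] := rat_in_itvoo qk.
rewrite in_itv/= => /andP[qr rk].
exists (c + ratr r *: y); split; first by exists (c, r).
apply: eO; rewrite -ball_normE/= opprD addrACA -scalerBl.
rewrite (le_lt_trans (ler_normD _ _))// [ltRHS](splitr e) ltrD// normrZ.
have qk' : `|q - ratr r| < k by rewrite distrC ger0_norm; lra.
have y1 : 0 < `|y| + 1 by rewrite ltr_wpDl.
have kE : k * (`|y| + 1) = e / 2 by rewrite /k; field; rewrite gt_eqF.
rewrite -kE (le_lt_trans _ (_ : `|q - ratr r| * (`|y| + 1) < _)) ?ltr_pM2r//.
by rewrite ler_wpM2l// lerDl.
Qed.

Let mX (xs : {linear E -> R^o}) : continuous xs ->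
  measurable_fun setT (fun w => xs (X w) : R).
Proof. by move=> cxs; exact: (measurable_fun_borel_real X_sm.1 cxs). Qed.

(** The expansion is available for e >= 0 only. Negative steps are reduced to it by replacing
    [(y, G)] with [(- y, - G)], which preserves [char_fun] and the product of the step with the
    first-order term. *)
Lemma is_derive_gaussian_shift (F : E -> R) (C : R) :
  measurable_fun setT (F : borelType E -> R) -> (forall z, `|F z| <= C) ->
  is_derive (0 : R) 1 (fun e => \int[P]_w F (X w + e *: y))
    (\int[P]_w (F (X w) * G w)).
Proof.
move=> mF FC; have [D cD VD] := V_separable.
have clF := bclos_bounded_borel cD VD mF FC.
have XV w q : V (X w + q *: y) by exists w, q.
have XVN w q : V (X w + q *: - y) by exists w, (- q); rewrite scalerN scaleNr.
have FCV z : V z -> `|F z| <= C by [].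
have mGN : measurable_fun setT (fun w => - G w) by exact: measurableT_comp.
have iGN : P.-integrable setT (fun w => (`|- G w| ^+ 3)%:E).
  by apply: eq_integrable iG => // w _; rewrite normrN.
have char_funN (xs : {linear E -> R^o}) : continuous xs ->
  exists v : R, forall b th : R,
    \int[P]_w cos ((xs (X w) : R) + b * - G w + th) =
    cos th * expR (- (v + 2 * b * xs (- y) + b ^+ 2 * s2) / 2).
  move=> /char_fun[v hv]; exists v => b th.
  under eq_Rintegral do rewrite mulrN -mulNr.
  rewrite hv raddfN/=; congr (_ * expR (- _ / 2)).
  by rewrite sqrrN; congr (_ + _ + _); rewrite !mulrN mulNr.
apply: (@derivable_quadratic _ _ _ _ (C * \int[P]_w `|G w ^+ 2 - s2|)) => h _.
rewrite add0r; under [X in _ - X - _]eq_Rintegral do rewrite scale0r addr0.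
have [h0|h0] := leP 0 h.
  exact: (shift_expansion mX mG iG XV char_fun clF FCV h0).
have hN : 0 <= - h by rewrite oppr_ge0 ltW.
have := shift_expansion mX mGN iGN XVN char_funN clF FCV hN.
rewrite sqrrN; under [X in _ * X * _]eq_Rintegral do rewrite sqrrN.
have -> : \int[P]_w F (X w + - h *: - y) = \int[P]_w F (X w + h *: y).
  by apply: eq_Rintegral => w _; rewrite scalerN scaleNr opprK.
have -> : \int[P]_w (F (X w) * - G w) = - \int[P]_w (F (X w) * G w).
  transitivity (\int[P]_w (-1 * (F (X w) * G w))).
    by apply: eq_Rintegral => w _; ring.
  rewrite RintegralZl ?mulN1r//.
  have mFX : measurable_fun setT (F \o X).
    exact: (measurableT_comp mF X_sm.1).
  apply: (@le_integrable_norm _ _ _ P setT measurableT _ (fun w => C * `|G w| ^+ 1)).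
  - exact: measurable_funM.
  - by move=> w _; rewrite normrM ler_wpM2r.
  - have i1 := integrable_cube_le (isT : 1 <= 3)%N mG iG.
    by have := integrableZl measurableT C i1; apply: eq_integrable.
by rewrite mulrNN.
Qed.

End gaussian_shift_derivative.

(** * The pseudo-inverse of B *)

Section inner_product.
Context {R : realType} {H : completeNormedModType R}.
Variable ip : {dot H for (@idfun R)}.
Hypothesis ip_norm : forall h : H, ip h h = `|h| ^+ 2.
Implicit Types h k : H.

Lemma dotC h k : ip h k = ip k h.
Proof. by rewrite hermitian_subproof expr0 mul1r. Qed.

Lemma dotDl h h' k : ip (h + h') k = ip h k + ip h' k.
Proof. exact: linearDl. Qed.

Lemma dotZl (c : R) h k : ip (c *: h) k = c * ip h k.
Proof. exact: linearZl_LR. Qed.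

Lemma dotDr h k k' : ip h (k + k') = ip h k + ip h k'.
Proof. by rewrite !(dotC h) dotDl. Qed.

Lemma dotZr (c : R) h k : ip h (c *: k) = c * ip h k.
Proof. by rewrite !(dotC h) dotZl. Qed.

Lemma sqr_normD h k : `|h + k| ^+ 2 = `|h| ^+ 2 + 2 * ip h k + `|k| ^+ 2.
Proof. by rewrite -!ip_norm dotDl !dotDr (dotC k h); ring. Qed.

Lemma sqr_normZ (c : R) h : `|c *: h| ^+ 2 = c ^+ 2 * `|h| ^+ 2.
Proof. by rewrite normrZ exprMn real_normK ?num_real. Qed.

Lemma sqr_normB h k : `|h - k| ^+ 2 = `|h| ^+ 2 - 2 * ip h k + `|k| ^+ 2.
Proof. by rewrite sqr_normD normrN -scaleN1r dotZr; ring. Qed.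

Lemma dot_le h k : `|ip h k| <= `|h| * `|k|.
Proof.
have aux h' : ip h' k <= `|h'| * `|k|.
  have : `|h' + k| ^+ 2 <= (`|h'| + `|k|) ^+ 2.
    by rewrite ler_sqr ?nnegrE ?addr_ge0// ler_normD.
  by rewrite sqr_normD sqrrD; lra.
rewrite ler_norml aux andbT lerNl.
by have := aux (- h); rewrite -scaleN1r dotZl mulN1r scaleN1r normrN.
Qed.

(** The polynomial |h + c k|^2 - |h|^2 in c is nonnegative, but at its vertex c = -(h|k) / |k|^2 it
    equals -(h|k)^2 / |k|^2. *)
Lemma min_norm_orthogonal h k :
  (forall c : R, `|h| <= `|h + c *: k|) -> ip h k = 0.
Proof.
move=> hmin; have aux (c : R) : 0 <= c * (2 * ip h k + c * `|k| ^+ 2).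
  have : `|h| ^+ 2 <= `|h + c *: k| ^+ 2 by rewrite ler_sqr ?nnegrE.
  by rewrite sqr_normD dotZr sqr_normZ; lra.
have [k0|k0] := eqVneq `|k| 0.
  have /normr0_eq0 -> : `|k| = 0 by [].
  by rewrite -(scale0r 0) dotZr mul0r.
have k2 : 0 < `|k| ^+ 2 by rewrite exprn_gt0// lt0r k0/=.
have := aux (- (ip h k / `|k| ^+ 2)).
rewrite (_ : _ * _ = - (ip h k ^+ 2 / `|k| ^+ 2)); last by field.
rewrite oppr_ge0 pmulr_lle0 ?invr_gt0// => ip0; apply/eqP.
by rewrite -sqrf_eq0 eq_le ip0 sqr_ge0.
Qed.

Context {E : completeNormedModType R}.
Variable B : {linear H -> E}.
Hypothesis B_bounded : continuous B.

(** The projection theorem for the affine set of preimages: it contains midpoints, so the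
    parallelogram identity makes a minimising sequence Cauchy, and continuity of [B] keeps the limit
    in the set. *)
Lemma min_norm_preimage h0 : exists h, B h = B h0 /\
  forall k, B k = B h0 -> `|h| <= `|k|.
Proof.
pose A := [set `|h| | h in [set h | B h = B h0]].
have hA : has_inf A.
  by split; [exists `|h0|, h0|exists 0 => _ [h _ <-]].
pose m := inf A.
have m0 : 0 <= m by apply: lb_le_inf; [case: hA|move=> _ [h _ <-]].
have mle k : B k = B h0 -> m <= `|k| by move=> Bk; apply: ge_inf; [case: hA|exists k].
have ex n : exists h, B h = B h0 /\ `|h| < m + n.+1%:R^-1.
  have n0 : 0 < n.+1%:R^-1 :> R by rewrite invr_gt0.
  by have [_ [h Bh <-] hm] := inf_adherent n0 hA; exists h.
pose u n := sval (cid (ex n)).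
have uB n : B (u n) = B h0 by rewrite /u; case: cid => /= ? [].
have um n : `|u n| < m + n.+1%:R^-1 by rewrite /u; case: cid => /= ? [].
have ucauchy : cvgn u.
  apply/cauchy_cvgP/cauchy_ballP => e e0.
  (* The parallelogram identity then bounds |u n - u k|^2 by 4 (m^2 + e^2 / 5) - 4 m^2 = 4 e^2 / 5,
     which is below e^2. *)
  have near_sq : \forall n \near \oo, `|u n| ^+ 2 <= m ^+ 2 + e ^+ 2 / 5.
    (* For 0 <= p <= 1 one has (m + p)^2 <= m^2 + p (2 m + 1). *)
    pose c := e ^+ 2 / 5 / (2 * m + 1).
    have c0 : 0 < c by rewrite !divr_gt0 ?exprn_gt0// ltr_wpDl// mulr_ge0.
    near=> n.
    have n1 : n.+1%:R^-1 <= 1 :> R by rewrite invf_le1// ler1n.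
    have nc : n.+1%:R^-1 < c by near: n; apply: (near_infty_natSinv_lt (PosNum c0)).
    have n0 : 0 < n.+1%:R^-1 :> R by rewrite invr_gt0.
    have := um n; have := normr_ge0 (u n).
    have : c * (2 * m + 1) = e ^+ 2 / 5 by rewrite /c divfK// gt_eqF// ltr_wpDl// mulr_ge0.
    move: (n.+1%:R^-1 : R) `|u n| n1 nc n0 => p q p1 pc p0 <- q0 qp.
    have mp0 : 0 <= m + p by rewrite addr_ge0// ltW.
    have : q ^+ 2 <= (m + p) ^+ 2 by rewrite ler_sqr ?nnegrE// ltW.
    have pp : 0 <= p * (1 - p) by rewrite mulr_ge0 ?subr_ge0// ltW.
    have pcm : 0 <= (c - p) * (2 * m + 1).
      by rewrite mulr_ge0 ?subr_ge0 ?(ltW pc)// addr_ge0// mulr_ge0.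
    by rewrite sqrrD; lra.
  near_simpl => /=.
  near=> n k.
  have h1 : `|u n| ^+ 2 <= m ^+ 2 + e ^+ 2 / 5 by near: n.
  have h2 : `|u k| ^+ 2 <= m ^+ 2 + e ^+ 2 / 5 by near: k.
  have h3 : m ^+ 2 <= `|2^-1 *: (u n + u k)| ^+ 2.
    rewrite ler_sqr ?nnegrE//; apply: mle.
    rewrite linearZ linearD/= !uB scalerDr -scalerDl.
    by rewrite (_ : 2^-1 + 2^-1 = 1 :> R) ?scale1r//; field.
  rewrite sqr_normZ sqr_normD in h3.
  rewrite -ball_normE/= -ltr_sqr ?nnegrE ?(ltW e0)// sqr_normB.
  have : 0 < e ^+ 2 by rewrite exprn_gt0.
  lra.
have uh : u @ \oo --> lim (u @ \oo) by exact: ucauchy.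
exists (lim (u @ \oo)); split.
  have Bu : (B \o u) n @[n --> \oo] --> B (limn u).
    exact: (cvg_comp _ _ uh (@B_bounded (limn u))).
  rewrite (_ : B \o u = fun=> B h0) in Bu; last exact/funext.
  by apply: (cvg_unique _ Bu); [exact: norm_hausdorff|exact: cvg_cst].
move=> k Bk; apply: le_trans (mle k Bk).
have mh : (fun n => m + harmonic n) @ \oo --> m.
  by rewrite -[X in _ --> X]addr0; apply: cvgD; [exact: cvg_cst|exact: cvg_harmonic].
apply: (ler_cvg_to (cvg_norm uh) mh).
by apply: nearW => n; exact: ltW.
Unshelve. all: by end_near. Qed.

(** The default value of [xget] is excluded: a preimage of minimal norm is orthogonal to the kernel
    of [B]. *)
Lemma BdaggerK e : range B e -> B (Bdagger ip B e) = e.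
Proof.
move=> [h0 _ <-]; rewrite /Bdagger; case: xgetP => [h -> [//]|nh].
have [h [Bh hmin]] := min_norm_preimage h0.
case: (nh h); split=> // k Bk; apply: min_norm_orthogonal => c.
by apply: hmin; rewrite linearD linearZ/= Bk scaler0 addr0.
Qed.

Lemma Bdagger_notin e : ~ range B e -> Bdagger ip B e = 0.
Proof.
move=> eB; rewrite /Bdagger; case: xgetP => // h _ [Bh _].
by case: eB; exists h.
Qed.

(** The test is on [Bdagger], not on membership in the range: along S(s) xi the former is measurable
    in s by admissibility, the latter is not known to be. *)
Lemma B_Bdagger e : B (Bdagger ip B e) = if Bdagger ip B e == 0 then 0 else e.
Proof.
have [eB|eB] := pselect (range B e).
  by case: eqP => [->|_]; [exact: linear0|exact: BdaggerK].
by rewrite Bdagger_notin// eqxx linear0.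
Qed.

Lemma Bdagger_neq0 e : range B e -> e != 0 -> Bdagger ip B e != 0.
Proof.
by move=> eB; apply: contra_neq => h; rewrite -(BdaggerK eB) h linear0.
Qed.

End inner_product.

(** * Smooth steps and weak derivatives *)

Section smooth_steps.
Context {R : realType}.
Notation mu := (@lebesgue_measure R).

(* The factor x^-n makes the family closed under differentiation. *)
Definition flat_exp (n : nat) (x : R) : R :=
  if 0 < x then x^-1 ^+ n * expR (- x^-1) else 0.

Lemma flat_exp_ge0 n x : 0 <= flat_exp n x.
Proof.
rewrite /flat_exp; case: ifP => // x0.
by rewrite mulr_ge0 ?expR_ge0// exprn_ge0// invr_ge0 ltW.
Qed.

Lemma flat_exp_gt0 n x : 0 < x -> 0 < flat_exp n x.
Proof.
by move=> x0; rewrite /flat_exp x0 mulr_gt0 ?expR_gt0// exprn_gt0// invr_gt0.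
Qed.

Lemma flat_exp_le0 n x : x <= 0 -> flat_exp n x = 0.
Proof. by rewrite /flat_exp leNgt => /negbTE ->. Qed.

Lemma is_derive_flat_exp n (x : R) : is_derive x 1 (flat_exp n)
  (flat_exp n.+2 x - n%:R * flat_exp n.+1 x).
Proof.
have [x0|x0|->] := ltgtP x 0.
- rewrite !flat_exp_le0 ?(ltW x0)// mulr0 subr0.
  apply: (@near_eq_is_derive _ _ _ (cst 0)) => //.
  near=> y; rewrite flat_exp_le0// ltW//.
  by near: y; exact: lt_nbhsl.
- apply: (@near_eq_is_derive _ _ _ (fun y : R => y^-1 ^+ n * expR (- y^-1))).
    near=> y; rewrite /flat_exp ifT//.
    by near: y; exact: lt_nbhsr.
  have dV : is_derive x 1 (fun y : R => y^-1) (- x ^- 2 *: 1).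
    by apply: is_deriveV; rewrite gt_eqF.
  have dX : is_derive x^-1 1 (fun u : R => u ^+ n) (n%:R * x^-1 ^+ n.-1).
    have -> : (fun u : R => u ^+ n) = (id : R -> R) ^+ n.
      by apply/funext => u; rewrite fctE.
    apply: is_derive_eq; rewrite ?mulr1.
    by rewrite /GRing.scale/= mulr1.
  have dE : is_derive x^-1 1 (fun u : R => u ^+ n * expR (- u))
      (n%:R * x^-1 ^+ n.-1 * expR (- x^-1) - x^-1 ^+ n * expR (- x^-1)).
    by apply: is_derive_eq; rewrite /GRing.scale/=; ring.
  apply: (is_derive_eq (is_derive1_comp dE dV)).
  rewrite /flat_exp x0 /GRing.scale/= mulr1 -exprVn.
  case: n {dX dE} => [|n] /=; last by rewrite !exprS; ring.
  by rewrite !expr0 !mul0r; ring.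
- rewrite !flat_exp_le0// mulr0 subr0.
  (* From exp(u) >= u^(n+2) / (n+2)! at u = 1 / h, one gets h^(-n) exp(-1/h) <= (n+2)! h^2. *)
  apply: (@derivable_quadratic _ _ _ _ (n.+2)`!%:R) => h h1.
  rewrite add0r [flat_exp n 0]flat_exp_le0// mulr0 !subr0 ger0_norm ?flat_exp_ge0//.
  have [h0|h0] := leP h 0; first by rewrite flat_exp_le0// mulr_ge0 ?sqr_ge0.
  rewrite /flat_exp h0 expRN ler_pdivrMr ?expR_gt0//.
  have u0 : 0 <= h^-1 by rewrite invr_ge0 ltW.
  have e := expR_ge1Dxn n.+1 u0.
  have f0 : 0 < n.+2`!%:R :> R by rewrite ltr0n fact_gt0.
  have -> : h^-1 ^+ n = h^-1 ^+ n.+2 * h ^+ 2.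
    by rewrite -addn2 exprD -mulrA -exprMn mulVf ?gt_eqF// expr1n mulr1.
  rewrite [leRHS]mulrAC ler_wpM2r ?sqr_ge0// [leRHS]mulrC -ler_pdivrMr//.
  by apply: le_trans e; rewrite lerDr.
Unshelve. all: by end_near. Qed.

(** A class of functions closed under differentiation, so that smoothness of all orders follows by
    induction without a formula for higher derivatives. *)
Inductive bump_span (a b : R) : (R -> R) -> Prop :=
| bump_span_prod m n : bump_span a b (fun x => flat_exp m (x - a) * flat_exp n (b - x))
| bump_span_lin (c : R) f g : bump_span a b f -> bump_span a b g ->
    bump_span a b (fun x => c * f x + g x).

Lemma bump_span_derive a b f : bump_span a b f ->
  exists2 g, bump_span a b g & forall x : R, is_derive x 1 f (g x).
Proof.
elim=> [m n|c {}f g _ [f' sf df] _ [g' sg dg]].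
  pose p k l x := flat_exp k (x - a) * flat_exp l (b - x).
  have sp k l : bump_span a b (p k l) by exact: bump_span_prod.
  exists (fun x => - m%:R * p m.+1 n x + (n%:R * p m n.+1 x +
      (-1 * p m n.+2 x + p m.+2 n x))).
    by do 3![apply: bump_span_lin => //].
  move=> x.
  have da : is_derive x 1 (fun x : R => x - a) 1.
    by apply: is_derive_eq; rewrite subr0.
  have db : is_derive x 1 (fun x : R => b - x) (-1).
    by apply: is_derive_eq; rewrite add0r mul1r.
  have dl := @is_derive1_comp _ _ (fun x => x - a) x _ _ (is_derive_flat_exp m (x - a)) da.
  have dr := @is_derive1_comp _ _ (fun x => b - x) x _ _ (is_derive_flat_exp n (b - x)) db.
  apply: (is_derive_eq (is_deriveM dl dr)).
  by rewrite /GRing.scale/= /p; ring.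
exists (fun x => c * f' x + g' x); first exact: bump_span_lin.
by move=> x; have := df x; have := dg x => ? ?; apply: is_derive_eq.
Qed.

Lemma bump_span_continuous a b f : bump_span a b f -> continuous f.
Proof.
move=> /bump_span_derive[g _ df] x; apply: differentiable_continuous.
by apply/derivable1_diffP; apply: ex_derive.
Qed.

Lemma bump_span_smooth a b f n : bump_span a b f ->
  forall x, derivable (derive1n n f) x 1.
Proof.
elim: n f => [|n IH] f bf x; have [g bg df] := bump_span_derive bf.
  exact: ex_derive.
rewrite derive1Sn (_ : f^`()%classic = g); first exact: IH.
by apply/funext => z; rewrite derive1E; exact: derive_val.
Qed.

Section one_step.
Variables a b : R.
Hypothesis ab : a < b.

Let bump (x : R) := flat_exp 0 (x - a) * flat_exp 0 (b - x).

Let bump_in : bump_span a b bump. Proof. exact: bump_span_prod. Qed.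

Let bump_ge0 x : 0 <= bump x.
Proof. by rewrite mulr_ge0 ?flat_exp_ge0. Qed.

Let bump_out x : x \notin `]a, b[ -> bump x = 0.
Proof.
rewrite in_itv/= negb_and -!leNgt /bump => /orP[xa|bx].
  by rewrite flat_exp_le0 ?mul0r// subr_le0.
by rewrite mulrC flat_exp_le0 ?mul0r// subr_le0.
Qed.

Let bump_gt0 x : x \in `]a, b[ -> 0 < bump x.
Proof.
by rewrite in_itv/= => /andP[ax xb]; rewrite mulr_gt0 ?flat_exp_gt0 ?subr_gt0.
Qed.

Let prim (x : R) : R := \int[mu]_(s in `]-oo, x]) bump s.

Let cbump : continuous bump. Proof. exact: bump_span_continuous bump_in. Qed.

Let ibump u : mu.-integrable `]-oo, u] (EFin \o bump).
Proof.
have iab : mu.-integrable `[a, b] (EFin \o bump).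
  apply: continuous_compact_integrable; first exact: segment_compact.
  exact: continuous_subspaceT.
apply: (integrableS measurableT) => //.
have mI : measurable (`[a, b] : set (measurableTypeR R)) by [].
have {}iab := (@integrable_mkcond _ (measurableTypeR R) R mu _ (EFin \o bump) mI).1 iab.
apply: eq_integrable iab => // x _; rewrite patchE/=; case: ifPn => // xab.
rewrite bump_out//; apply: contra xab => xab; apply/mem_set.
exact: subset_itv_oo_cc.
Qed.

Let dprim (x : R) : is_derive x 1 prim (bump x).
Proof.
have x1 : x < x + 1 by rewrite ltrDl.
have [] := @continuous_FTC1 _ bump -oo%O x (x + 1) x1 (ibump _) (ltNyr x) (@cbump x).
by rewrite derive1E => dp pE; split.
Qed.

Let prim_le x y : x <= y -> prim x <= prim y.
Proof.
rewrite le_eqVlt => /predU1P[->//|xy].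
have [||c _ e] := @MVT _ prim bump x y xy.
- by move=> z _; exact: dprim.
- apply: continuous_subspaceT => z; apply: differentiable_continuous.
  by apply/derivable1_diffP; apply: ex_derive.
- by rewrite -subr_ge0 e mulr_ge0 ?subr_ge0// ltW.
Qed.

Let prim_a x : x <= a -> prim x = 0.
Proof.
move=> xa; rewrite /prim (@eq_Rintegral _ _ _ _ _ (cst 0)).
  by rewrite Rintegral_cst// mul0r.
move=> s; rewrite inE/= in_itv/= => sx; rewrite bump_out// in_itv/= negb_and.
by rewrite -leNgt (le_trans sx).
Qed.

Let prim_b x : b <= x -> prim x = prim b.
Proof.
rewrite le_eqVlt => /predU1P[->//|bx].
have [||c] := @MVT _ prim bump b x bx.
- by move=> z _; exact: dprim.
- apply: continuous_subspaceT => z; apply: differentiable_continuous.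
  by apply/derivable1_diffP; apply: ex_derive.
- rewrite in_itv/= => /andP[bc _]; rewrite bump_out ?mul0r.
    by move/eqP; rewrite subr_eq0 => /eqP.
  by rewrite in_itv/= negb_and -!leNgt (ltW bc) orbT.
Qed.

Let prim_gt0 : 0 < prim b.
Proof.
have [||c cab] := @MVT _ prim bump a b ab.
- by move=> z _; exact: dprim.
- apply: continuous_subspaceT => z; apply: differentiable_continuous.
  by apply/derivable1_diffP; apply: ex_derive.
- rewrite (prim_a (lexx a)) subr0 => ->.
  by rewrite mulr_gt0 ?bump_gt0// subr_gt0.
Qed.

(** The primitive of a bump, divided by the mass of the bump. The difference of two such steps is a
    test function close to 1 on an interval, and the derivative of each step is a unit mass
    concentrated on a short interval. *)
Lemma smooth_step_exists : exists th th' : R -> R,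
  [/\ forall x : R, is_derive x 1 th (th' x) /\ continuous th',
      forall n x, derivable (derive1n n th') x 1,
      forall x, 0 <= th' x /\ (x \notin `]a, b[ -> th' x = 0),
      forall x, 0 <= th x <= 1 &
      (forall x, x <= a -> th x = 0) /\ (forall x, b <= x -> th x = 1)].
Proof.
pose k := (prim b)^-1; have k0 : 0 <= k by rewrite invr_ge0 ltW.
(* [bump_span] has no constructor for a scalar multiple alone; everything after the first term adds
   up to zero. *)
have bk : bump_span a b (fun x => k * bump x + (0 * bump x + (-1 * bump x + bump x))).
  by do 3![apply: bump_span_lin => //].
have bkE : (fun x => k * bump x + (0 * bump x + (-1 * bump x + bump x))) =
    (fun x => k * bump x).
  by apply/funext => x; ring.
rewrite {}bkE in bk.
exists (fun x => k * prim x), (fun x => k * bump x); split.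
- move=> x; split; last exact: bump_span_continuous bk.
  by have := dprim x => dp; apply: is_derive_eq.
- by move=> n; exact: bump_span_smooth bk.
- by move=> x; split; [rewrite mulr_ge0|move=> /bump_out ->; rewrite mulr0].
- move=> x; rewrite mulr_ge0//=.
    rewrite mulrC ler_pdivrMr ?mul1r//; have [xb|bx] := leP x b.
      exact: prim_le.
    by rewrite prim_b// ltW.
  have [xa|ax] := leP x a; first by rewrite prim_a.
  by rewrite -(prim_a (lexx a)) prim_le// ltW.
- split=> x xx; first by rewrite prim_a// mulr0.
  by rewrite prim_b// mulVf// gt_eqF.
Qed.

End one_step.
End smooth_steps.

Lemma derive1n_sub {R : realType} (f g : R -> R) (m : nat) :
  (forall n x, derivable (derive1n n f) x 1) ->
  (forall n x, derivable (derive1n n g) x 1) ->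
  derive1n m (fun x => f x - g x) = derive1n m f \- derive1n m g.
Proof.
move=> df dg; elim: m => [//|m IH]; rewrite !derive1nS IH; apply/funext => z.
by rewrite derive1E (deriveB (df m z) (dg m z)) -!derive1E.
Qed.

(** * The integral of a weak derivative *)

Section sobolev_derivative.
Context {R : realType}.
Notation mu := (@lebesgue_measure R).
Variable t : R.
Hypothesis t0 : 0 < t.
Local Notation D := (`]0, t[%classic : set (measurableTypeR R)).

Let mD : measurable D. Proof. by []. Qed.

Lemma integrable_Linfty (f : R -> R) : Linfty t f -> mu.-integrable D (EFin \o f).
Proof.
move=> [mf [C fC]]; apply/integrableP; split; first exact/measurable_EFinP.
apply: (@le_lt_trans _ _ (\int[mu]_(x in D) (`|C|)%:E)%E); last first.
  by rewrite integral_cst//= [mu _]lebesgue_measure_itv/= lte_fin t0 -EFinB -EFinM ltry.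
apply: ae_ge0_le_integral => //.
- by apply: measurableT_comp => //; exact/measurable_EFinP.
- apply: (@filterS _ _ (ae_filter_ringOfSetsType mu) _ _ _ fC) => x fx Dx;
    rewrite lee_fin (le_trans _ (ler_norm C))//.
  by apply: fx; rewrite /D/= in Dx.
Qed.

(** Test functions [phi n] rise from 0 to 1 just after 0 and fall back just before t. The integral
    of a' phi_n tends to that of a', while the weak formula turns it into an average of [b] near t
    minus an average of [b] near 0. *)
Lemma integral_weak_derivative (a a' : R -> R) :
  W1infty t a a' -> boundary_values t a 0 1 -> \int[mu]_(s in D) a' s = 1.
Proof.
move=> [aL a'L weak] [b [ab bc b0 b1]].
have ia' := integrable_Linfty a'L; have ma' : measurable_fun D a' := a'L.1.
have mb : measurable_fun D b.
  apply: open_continuous_measurable_fun; first exact: interval_open.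
  by move=> x /set_mem xD; exact: bc.
apply/eqP; rewrite -subr_eq0 -normr_eq0 eq_le normr_ge0 andbT.
apply/ler_addgt0Pr => e e0; rewrite add0r.
have e20 : 0 < e / 2 by rewrite divr_gt0.
have [r /= r0 br] : exists2 r : R, 0 < r & forall x, 0 < x < r -> `|b x| <= e / 2.
  move/cvgrPdist_le : b0 => /(_ _ e20)[r /= r0 hr]; exists r => // x /andP[x0 xr].
  have := hr x; rewrite /= !sub0r !normrN; apply => //.
  by rewrite gtr0_norm.
have [l /= l0 bl] : exists2 l : R, 0 < l & forall x, t - l < x < t -> `|b x - 1| <= e / 2.
  move/cvgrPdist_le : b1 => /(_ _ e20)[l /= l0 hl]; exists l => // x /andP[xl xt].
  rewrite distrC; apply: (hl x) => //=.
  by rewrite gtr0_norm ?subr_gt0// ltrBlDr -ltrBlDl.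
(* The bound 1/5 keeps 2 [al n] below t - 2 [al n], so the rising step ends before the falling one
   begins. *)
pose k n : R := n.+4.+1%:R^-1.
have k0 n : 0 < k n by rewrite invr_gt0.
have k5 n : k n <= 5^-1 by rewrite lef_pV2 ?posrE// ler_nat.
pose al n := t * k n.
have al0 n : 0 < al n by rewrite mulr_gt0.
have al5 n : al n <= t / 5 by rewrite ler_wpM2l ?(ltW t0).
have s1 n : al n < 2 * al n by have := al0 n; lra.
have s2 n : t - 2 * al n < t - al n by have := al0 n; lra.
have [th1 /choice[d1 P1]] := choice (fun n => smooth_step_exists (s1 n)).
have [th2 /choice[d2 P2]] := choice (fun n => smooth_step_exists (s2 n)).
have dth1 n (x : R) : is_derive x 1 (th1 n) (d1 n x) by have [h _ _ _ _] := P1 n; exact: (h x).1.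
have dth2 n (x : R) : is_derive x 1 (th2 n) (d2 n x) by have [h _ _ _ _] := P2 n; exact: (h x).1.
have cd1 n : continuous (d1 n) by have [h _ _ _ _] := P1 n; exact: (h 0).2.
have cd2 n : continuous (d2 n) by have [h _ _ _ _] := P2 n; exact: (h 0).2.
pose phi n x := th1 n x - th2 n x.
have dphi n (x : R) : is_derive x 1 (phi n) (d1 n x - d2 n x).
  by have := dth1 n x; have := dth2 n x => ? ?; exact: is_deriveB.
have phi' n : derive1 (phi n) = (fun x => d1 n x - d2 n x).
  by apply/funext => x; rewrite derive1E; exact: derive_val.
have phi_test n : test_function t (phi n).
  split.
    case=> [|m] x; first exact: ex_derive.
    rewrite derive1Sn phi'; have [_ h1 _ _ _] := P1 n; have [_ h2 _ _ _] := P2 n.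
    by rewrite derive1n_sub//; exact: derivableB.
  exists (al n), (t - al n); split => //; have := al0 n; have := al5 n; try lra.
  move=> h5 h0 x; rewrite in_itv/= negb_and -!ltNge /phi => /orP[xa|ax].
    have [_ _ _ _ [h1 _]] := P1 n; have [_ _ _ _ [h2 _]] := P2 n.
    by rewrite h1 ?h2 ?subrr//; lra.
  have [_ _ _ _ [_ h1]] := P1 n; have [_ _ _ _ [_ h2]] := P2 n.
  by rewrite h1 ?h2 ?subrr//; lra.
have phi_le n x : `|phi n x| <= 1.
  have [_ _ _ /(_ x) h1 _] := P1 n; have [_ _ _ /(_ x) h2 _] := P2 n.
  by rewrite ler_norml /phi; lra.
have al_cvg (c : R) : 0 < c -> \forall n \near \oo, 2 * al n < c.
  move=> c0; have c1 : 0 < c / (2 * t) by rewrite divr_gt0// mulr_gt0.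
  have : \forall n \near \oo, n.+1%:R^-1 < c / (2 * t).
    exact: (near_infty_natSinv_lt (PosNum c1)).
  apply: filterS => n hn; rewrite /al /k mulrA mulrC -ltr_pdivlMr ?mulr_gt0//.
  by apply: le_lt_trans hn; rewrite lef_pV2 ?posrE// ler_nat !ltnS -addn4 leq_addr.
have phi1 x : D x -> (fun n => phi n x) @ \oo --> (1 : R).
  rewrite /D/= in_itv/= => /andP[x0 xt]; apply: cvg_near_cst; near=> n.
  have [_ _ _ _ [_ h1]] := P1 n; have [_ _ _ _ [h2 _]] := P2 n.
  have a1 : 2 * al n < x by near: n; exact: al_cvg.
  have a2 : 2 * al n < t - x by near: n; apply: al_cvg; rewrite subr_gt0.
  by rewrite /phi h1 ?(ltW a1)// h2 ?subr0//; lra.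
have La' : (fun n => \int[mu]_(s in D) (a' s * phi n s)) @ \oo --> \int[mu]_(s in D) a' s.
  apply: (@Rintegral_dominated_cvg _ _ _ mu D mD _ _ (fun x => `|a' x|) _ _ _ _).2.
  - move=> n; apply: measurable_funM => //; apply: measurable_funTS.
    apply: continuous_measurable_fun => x; apply: differentiable_continuous.
    by apply/derivable1_diffP; apply: ex_derive.
  - exact: (integrable_norm ia').
  - by move=> n x _; rewrite normrM ler_piMr.
  - move=> x Dx; rewrite -[X in _ --> X]mulr1; apply: cvgMr; exact: phi1.
have mass (d th : R -> R) : continuous d -> (forall x : R, is_derive x 1 th (d x)) ->
    th 0 = 0 -> th t = 1 -> mu.-integrable D (EFin \o d) /\ \int[mu]_(s in D) d s = 1.
  move=> cd dd d0 dt; have [id ed] := continuous_Rintegral_FTC2 t0 cd dd.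
  have iD : mu.-integrable D (EFin \o d).
    by apply: integrableS id => //; exact: subset_itv_oo_cc.
  split=> //; rewrite dt d0 subr0 in ed; rewrite -ed.
  rewrite Rintegral_itv_bndo_bndc// Rintegral_itv_obnd_cbnd//.
  by apply: integrableS id => //; exact: subset_itv_oc_cc.
have conc (g d : R -> R) : measurable_fun D g -> mu.-integrable D (EFin \o d) ->
    \int[mu]_(s in D) d s = 1 -> (forall s, 0 <= d s) ->
    (forall s, D s -> `|g s * d s| <= e / 2 * d s) ->
    mu.-integrable D (EFin \o (fun s => g s * d s)) /\
    `|\int[mu]_(s in D) (g s * d s)| <= e / 2.
  move=> mg id d1' d0 gd.
  have md : measurable_fun D d by apply/measurable_EFinP; exact: measurable_int id.
  have ied : mu.-integrable D (EFin \o (fun s => e / 2 * d s)).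
    by have := integrableZl mD (e / 2) id; apply: eq_integrable.
  have mgd : measurable_fun D (fun s => g s * d s) by exact: measurable_funM.
  split; first exact: (le_integrable_norm mD mgd gd ied).
  rewrite (le_trans (normr_Rintegral_le mD mgd ied gd))// RintegralZl// d1'.
  by rewrite mulr1.
have near_e : \forall n \near \oo, `|\int[mu]_(s in D) (a' s * phi n s) - 1| <= e.
  near=> n.
  have anr : 2 * al n < r by near: n; exact: al_cvg.
  have anl : 2 * al n < l by near: n; exact: al_cvg.
  have ha := al0 n; have ha5 := al5 n.
  have [_ _ d10 _ [h10 h11]] := P1 n; have [_ _ d20 _ [h20 h21]] := P2 n.
  have [i1 e1] : mu.-integrable D (EFin \o d1 n) /\ \int[mu]_(s in D) d1 n s = 1.
    by apply: (mass _ (th1 n)) => //; [rewrite h10//; lra|rewrite h11//; lra].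
  have [i2 e2] : mu.-integrable D (EFin \o d2 n) /\ \int[mu]_(s in D) d2 n s = 1.
    by apply: (mass _ (th2 n)) => //; [rewrite h20//; lra|rewrite h21//; lra].
  have gd1 s : D s -> `|b s * d1 n s| <= e / 2 * d1 n s.
    move=> _; have [h0 hout] := d10 s.
    have [sin|/hout ->] := boolP (s \in `]al n, 2 * al n[); last first.
      by rewrite !mulr0 normr0.
    rewrite normrM [X in _ * X]ger0_norm// ler_wpM2r//; apply: br.
    move: sin anr anl ha ha5; rewrite in_itv/= => /andP[]; clear; lra.
  have gd2 s : D s -> `|(b s - 1) * d2 n s| <= e / 2 * d2 n s.
    move=> _; have [h0 hout] := d20 s.
    have [sin|/hout ->] := boolP (s \in `]t - 2 * al n, t - al n[); last first.
      by rewrite !mulr0 normr0.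
    rewrite normrM [X in _ * X]ger0_norm// ler_wpM2r//; apply: bl.
    move: sin anr anl ha ha5; rewrite in_itv/= => /andP[]; clear; lra.
  have mb1 : measurable_fun D (fun s => b s - 1) by exact: measurable_funB.
  have [j1 le1] := conc b (d1 n) mb i1 e1 (fun s => (d10 s).1) gd1.
  have [j2 le2] := conc (fun s => b s - 1) (d2 n) mb1 i2 e2 (fun s => (d20 s).1) gd2.
  have := weak (phi n) (phi_test n); rewrite phi'.
  have md12 : measurable_fun D (fun s => d1 n s - d2 n s).
    by apply: measurable_funB; apply: measurable_funTS; exact: continuous_measurable_fun.
  rewrite (@ae_eq_Rintegral _ _ _ mu D mD _ (fun s => b s * (d1 n s - d2 n s))); last 3 first.
  - by apply: measurable_funM => //; exact: aL.1.
  - exact: measurable_funM.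
  - apply: (@filterS _ _ (ae_filter_ringOfSetsType mu) _ _ _ ab) => s abs Ds.
    by rewrite abs.
  (* [b] is small where [d1 n] lives and [b - 1] is small where [d2 n] lives; the remaining [d2 n]
     has integral 1. *)
  have -> : \int[mu]_(s in D) (b s * (d1 n s - d2 n s)) =
      \int[mu]_(s in D) (b s * d1 n s - ((b s - 1) * d2 n s + d2 n s)).
    by apply: eq_Rintegral => s _; ring.
  have j3 : mu.-integrable D (EFin \o (fun s => (b s - 1) * d2 n s + d2 n s)).
    by have := integrableD mD j2 i2; apply: eq_integrable.
  rewrite RintegralB// RintegralD// e2.
  move: le1 le2; rewrite !ler_norml.
  by move: (\int[mu]_(x in D) (b x * d1 n x)) (\int[mu]_(x in D) ((b x - 1) * d2 n x))
    (\int[mu]_(s in D) (a' s * phi n s)) => A1 A2 A3; lra.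
apply: (cvgr_to_le (cvg_norm (cvgB La' (cvg_cst (1 : R))))).
exact: near_e.
Unshelve. all: by end_near. Qed.

End sobolev_derivative.

(** * Bochner integrals *)

Section step_integrals.
Context {R : realType}.
Notation mu := (@lebesgue_measure R).
Variable D : set (measurableTypeR R).
Hypothesis mD : measurable D.

Lemma Rintegral_step {V : eqType} (s : seq (set R * V)) (a : V -> R) :
  (forall p, p \in s -> measurable (p.1 : set (measurableTypeR R)) /\
    (mu (p.1 `&` D) < +oo)%E) ->
  mu.-integrable D (EFin \o (fun x => \sum_(p <- s) \1_(p.1) x * a p.2)) /\
  \int[mu]_(x in D) (\sum_(p <- s) \1_(p.1) x * a p.2) =
  \sum_(p <- s) fine (mu (p.1 `&` D)) * a p.2.
Proof.
elim: s => [_|p s IH hs].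
  rewrite (_ : (fun x => \sum_(p <- [::]) \1_(p.1) x * a p.2) = cst 0); last first.
    by apply/funext => x; rewrite big_nil.
  rewrite big_nil Rintegral_cst// mul0r; split=> //.
  exact: integrable0.
have [mp finp] := hs p (mem_head _ _).
have [|ist es] := IH; first by move=> q qs; apply: hs; rewrite in_cons qs orbT.
have i1 : mu.-integrable D (EFin \o \1_(p.1)).
  apply/integrableP; split; first exact/measurable_EFinP/measurable_indic.
  under eq_integral do rewrite /= ger0_norm//.
  by rewrite integral_indic.
have ip : mu.-integrable D (EFin \o (fun x => \1_(p.1) x * a p.2)).
  by have := integrableZr mD (a p.2) i1; apply: eq_integrable.
rewrite (_ : (fun x => \sum_(q <- p :: s) \1_(q.1) x * a q.2) =
    (fun x => \1_(p.1) x * a p.2 + \sum_(q <- s) \1_(q.1) x * a q.2)); last first.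
  by apply/funext => x; rewrite big_cons.
split; first by have := integrableD mD ip ist; apply: eq_integrable.
rewrite RintegralD// es big_cons RintegralZr//; congr (_ * _ + _).
by rewrite /Rintegral integral_indic.
Qed.

End step_integrals.

Section bochner_functionals.
Context {R : realType} {E : completeNormedModType R}.
Notation mu := (@lebesgue_measure R).
Variable D : set (measurableTypeR R).
Hypothesis mD : measurable D.

Lemma functional_bound (xs : {linear E -> R^o}) : continuous xs ->
  exists2 K : R, 0 < K & forall z, `|xs z| <= K * `|z|.
Proof.
move=> cxs; have /linear_boundedP hK := continuous_linear_bounded 0 (@cxs 0).
near (pinfty_nbhs R) => K; exists K.
  by near: K; exact: nbhs_pinfty_gt.
by near: K.
Unshelve. all: by end_near. Qed.

(** Measurability of sums of [E]-valued maps is avoided. With all translates [v] treated at once, a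
    further step merely switches between two real functions of the same form. *)
Lemma measurable_norm_sub_step (g : R -> E) (s : seq (set R * E)) :
  (forall p, p \in s -> measurable (p.1 : set (measurableTypeR R))) ->
  (forall v, measurable_fun D (fun x => `|g x - v| : R)) ->
  forall v, measurable_fun D (fun x => `|g x - step_fun s x - v| : R).
Proof.
rewrite /step_fun => ms mg; elim: s ms => [_ v|p s IH hs v].
  by under eq_fun do rewrite big_nil subr0; exact: mg.
have mp := hs p (mem_head _ _).
have {}IH := IH (fun q qs => hs q (mem_behead (s := p :: s) qs)).
have -> : (fun x => `|g x - \sum_(q <- p :: s) \1_(q.1) x *: q.2 - v|) =
  (fun x => \1_(p.1) x * `|g x - (\sum_(q <- s) \1_(q.1) x *: q.2) - (v + p.2)| +
    (1 - \1_(p.1) x) * `|g x - (\sum_(q <- s) \1_(q.1) x *: q.2) - v|).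
  apply/funext => x; rewrite big_cons indicE; case: (x \in p.1).
    by rewrite scale1r mul1r subrr mul0r addr0; congr `|_|;
      rewrite !opprD !addrA [in RHS]addrAC (addrAC (g x)).
  by rewrite scale0r add0r mul0r add0r subr0 mul1r.
have m1 : measurable_fun D (\1_(p.1) : R -> R) by exact: measurable_indic.
apply: measurable_funD; apply: measurable_funM => //.
exact: measurable_funB.
Qed.

(** This allows the chosen value [bochner_integral] to be compared with an explicit integral under
    every functional, which replaces uniqueness of the integral. *)
Lemma bochner_integral_functional (g : R -> E) (y : E) (xs : {linear E -> R^o}) :
  is_bochner_integral D g y -> continuous xs ->
  (xs y : R) = \int[mu]_(x in D) (xs (g x) : R).
Proof.
move=> [[mg _] [s [hs sg sy]]] cxs; have [K K0 xsK] := functional_bound cxs.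
have mxg : measurable_fun D (fun x => xs (g x) : R) := measurable_fun_borel_real mg cxs.
have mgv v : measurable_fun D (fun x => `|g x - v| : R).
  apply: (measurable_fun_borel_real (g := fun z : E => `|z - v|) mg) => z.
  by apply: cvg_norm; apply: cvgB; [exact: cvg_id|exact: cvg_cst].
have mgs n : measurable_fun D (fun x => `|g x - step_fun (s n) x| : R).
  have := measurable_norm_sub_step (fun p ps => (hs n p ps).1) mgv 0.
  by under eq_fun do rewrite subr0.
have xstep n x : (xs (step_fun (s n) x) : R) = \sum_(p <- s n) \1_(p.1) x * (xs p.2 : R).
  rewrite /step_fun raddf_sum; apply: eq_bigr => p _; exact: linearZ.
have xint n : (xs (step_integral D (s n)) : R) = \int[mu]_(x in D) (xs (step_fun (s n) x) : R).
  under eq_Rintegral do rewrite xstep.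
  rewrite (Rintegral_step mD _ (hs n)).2 /step_integral raddf_sum.
  by apply: eq_bigr => p _; exact: linearZ.
have /fine_cvgP[fin cvf] := sg.
have near_le : \forall n \near \oo,
    `|xs (step_integral D (s n)) - \int[mu]_(x in D) (xs (g x) : R)| <=
    K * \int[mu]_(x in D) `|g x - step_fun (s n) x|.
  near=> n.
  have ign : mu.-integrable D (EFin \o (fun x => `|g x - step_fun (s n) x|)).
    apply/integrableP; split; first exact/measurable_EFinP.
    under eq_integral do rewrite /= normr_id.
    by rewrite ltey_eq; apply/orP; left; near: n.
  have iKn : mu.-integrable D (EFin \o (fun x => K * `|g x - step_fun (s n) x|)).
    by have := integrableZl mD K ign; apply: eq_integrable.
  have [ist _] := Rintegral_step mD (fun v => xs v : R) (hs n).
  have {}ist : mu.-integrable D (EFin \o (fun x => xs (step_fun (s n) x) : R)).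
    by apply: eq_integrable ist => // x _ /=; rewrite xstep.
  have ms : measurable_fun D (fun x => xs (step_fun (s n) x) : R).
    by apply/measurable_EFinP; exact: measurable_int ist.
  have le x : D x -> `|(xs (step_fun (s n) x) : R) - xs (g x)| <=
      K * `|g x - step_fun (s n) x|.
    by move=> _; rewrite -raddfB (le_trans (xsK _))// distrC.
  have id : mu.-integrable D (EFin \o (fun x => (xs (step_fun (s n) x) : R) - xs (g x))).
    by apply: (le_integrable_norm mD _ le iKn); exact: measurable_funB.
  have ig : mu.-integrable D (EFin \o (fun x => xs (g x) : R)).
    have := integrableB mD ist id; apply: eq_integrable => // x _ /=.
    by rewrite -EFinB; congr EFin; rewrite opprB addrC subrK.
  rewrite xint -RintegralB// -RintegralZl//.
  by apply: normr_Rintegral_le => //; exact: measurable_funB.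
have Kcvg : (fun n => K * \int[mu]_(x in D) `|g x - step_fun (s n) x|) @ \oo --> (0 : R).
  by rewrite -(mulr0 K); apply: cvgMr.
have L1 : (fun n => xs (step_integral D (s n)) : R) @ \oo --> (xs y : R).
  exact: (cvg_comp _ _ sy (@cxs y)).
have L2 : (fun n => (xs (step_integral D (s n)) : R) -
      \int[mu]_(x in D) (xs (g x) : R)) @ \oo --> (0 : R).
  apply/norm_cvg0P; apply: (squeeze_cvgr _ (cvg_cst (0 : R)) Kcvg).
  by apply: filterS near_le => n hn; rewrite normr_ge0.
have L3 : (fun n => (xs (step_integral D (s n)) : R) -
      \int[mu]_(x in D) (xs (g x) : R)) @ \oo -->
    (xs y : R) - \int[mu]_(x in D) (xs (g x) : R).
  by apply: cvgB => //; exact: cvg_cst.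
apply/eqP; rewrite -subr_eq0; apply/eqP.
by rewrite -(cvg_lim (@Rhausdorff R) L3) (cvg_lim (@Rhausdorff R) L2).
Unshelve. all: by end_near. Qed.

Import HBSimple.

(** The convolution integrand at the control is a scalar times the fixed vector S(t) xi, so L^1
    approximation of the scalar by simple functions provides the step functions. *)
Lemma bochner_integral_line (g : R -> E) (c : R -> R) (e : E) :
  (mu D < +oo)%E -> mu.-integrable D (EFin \o c) ->
  (forall x, D x -> g x = c x *: e) ->
  is_bochner_integral D g ((\int[mu]_(x in D) c x) *: e).
Proof.
move=> finD ic gE.
have mc : measurable_fun D c by apply/measurable_EFinP; exact: measurable_int ic.
split.
  split.
    apply: measurable_borelP => _ A oA.
    have oA' : open [set r : R | A (r *: e)].
      by apply: (open_comp (f := fun r : R => r *: e)) => // r _; apply: cvgZl; exact: cvg_id.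
    rewrite (_ : _ `&` _ = D `&` c @^-1` [set r : R | A (r *: e)]).
      by apply: mc => //; exact: open_measurable.
    by apply/seteqP; split => x [Dx /=]; rewrite gE.
  exists [set ratr q *: e | q in [set: rat]].
    by apply: card_le_trans (card_image_le _ _) _; exact: countableP.
  move=> _ [x Dx <-] A /nbhs_ballP[r /= r0 rA]; rewrite gE// in rA.
  pose k := r / (`|e| + 1).
  have e1 : 0 < `|e| + 1 by rewrite ltr_wpDl.
  have k0 : 0 < k by rewrite divr_gt0.
  have ck : c x < c x + k by rewrite ltrDl.
  have [q] := rat_in_itvoo ck; rewrite in_itv/= => /andP[cq qc].
  exists (ratr q *: e); split; first by exists q.
  apply: rA; rewrite -ball_normE/= -scalerBl normrZ.
  have cqk : `|c x - ratr q| < k by rewrite distrC ger0_norm; lra.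
  have kE : k * (`|e| + 1) = r by rewrite /k; field; rewrite gt_eqF.
  rewrite -kE (le_lt_trans _ (_ : `|c x - ratr q| * (`|e| + 1) < _)) ?ltr_pM2r//.
  by rewrite ler_wpM2l// lerDl.
have [h [ih _ hc]] := approximation_sfun_integrable mD ic.
pose l n : seq R := fset_set (range (h n)).
pose s n := [seq (h n @^-1` [set r], r *: e) | r <- l n].
have hE n x : h n x = \sum_(r <- l n) r * \1_(h n @^-1` [set r]) x.
  by rewrite [LHS]fimfunE fsbig_finite.
have okA n r : measurable (h n @^-1` [set r] : set (measurableTypeR R)) /\
    (mu (h n @^-1` [set r] `&` D) < +oo)%E.
  have mA : measurable (h n @^-1` [set r] : set (measurableTypeR R)).
    exact: measurable_sfunP.
  split=> //; apply: le_lt_trans finD; apply: le_measure; rewrite ?inE//.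
  exact: measurableI.
have stepE n x : step_fun (s n) x = h n x *: e.
  rewrite /step_fun big_map hE scaler_suml; apply: eq_bigr => r _ /=.
  by rewrite scalerA mulrC.
have intE n : step_integral D (s n) = (\int[mu]_(x in D) h n x) *: e.
  rewrite /step_integral big_map.
  have -> : \int[mu]_(x in D) h n x = \int[mu]_(x in D)
      (\sum_(p <- [seq (h n @^-1` [set r], r) | r <- l n]) \1_(p.1) x * p.2).
    apply: eq_Rintegral => x _; rewrite hE big_map; apply: eq_bigr => r _.
    by rewrite mulrC.
  rewrite (Rintegral_step mD id _).2; last by move=> p /mapP[r _ ->]; exact: okA.
  rewrite big_map scaler_suml; apply: eq_bigr => r _ /=.
  by rewrite scalerA.
exists s; split.
- by move=> n p /mapP[r _ ->]; exact: okA.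
- have mch n : measurable_fun D (fun x => `|c x - h n x|).
    apply: measurableT_comp => //; apply: measurable_funB => //.
    by apply: measurable_funTS; exact: measurable_funPT.
  have -> : (fun n => (\int[mu]_(x in D) (`|g x - step_fun (s n) x|)%:E)%E) =
      (fun n => (`|e|%:E * \int[mu]_(x in D) `|(EFin \o c) x - (h n x)%:E|)%E).
    apply/funext => n; rewrite -ge0_integralZl//; last first.
      have mEch : measurable_fun D (EFin \o (fun x => `|c x - h n x|)).
        exact/measurable_EFinP.
      exact: mEch.
    apply: eq_integral => x /set_mem Dx.
    by rewrite gE// stepE -scalerBl normrZ mulrC.
  by rewrite -(mule0 `|e|%:E); apply: cvgeZl.
- under eq_fun do rewrite intE.
  apply: cvgZl.
  have mh n : measurable_fun D (h n) by apply: measurable_funTS; exact: measurable_funPT.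
  have /fine_cvgP[fin hc'] := hc.
  apply/subr_cvg0; apply/norm_cvg0P; apply: (squeeze_cvgr _ (cvg_cst (0 : R)) hc').
  near=> n; rewrite normr_ge0/=.
  rewrite -RintegralB//.
  have icn : mu.-integrable D (EFin \o (fun x => h n x - c x)).
    by have := integrableB mD (ih n) ic; apply: eq_integrable.
  apply: (le_trans (le_normr_Rintegral mD icn)).
  by under eq_Rintegral do rewrite distrC.
Unshelve. all: by end_near. Qed.

End bochner_functionals.

(** * The derivative formula *)

Section L2_functions.
Context {R : realType} {H : completeNormedModType R}.
Variable ip : {dot H for (@idfun R)}.
Hypothesis ip_norm : forall h : H, ip h h = `|h| ^+ 2.
Notation mu := (@lebesgue_measure R).

(** On a separable range open sets are countable unions of balls, so measurable distances to fixed
    points suffice. *)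
Lemma strongly_measurable_normP {d} {T : measurableType d} (D : set T) (f : T -> H)
    (C : set H) : countable C -> f @` D `<=` closure C ->
  (forall c, measurable_fun D (fun x => `|f x - c|)) -> strongly_measurable D f.
Proof.
move=> cC fC mf; split; last by exists C.
apply: measurable_borelP => mD O oO.
have [Q cQ QO] := open_separable_cover cC oO.
have -> : D `&` f @^-1` O =
    \bigcup_(p in Q) (D `&` (fun x => `|f x - p.1|) @^-1` `]-oo, p.2.+1%:R^-1]).
  apply/seteqP; split=> [x [Dx]|x [p Qp [Dx]]] /=.
    have /QO[h1 _] : closure C (f x) by apply: fC; exists x.
    by move=> /h1[p Qp pz]; exists p => //; split=> //=; rewrite in_itv.
  rewrite in_itv/= => pz; split=> //=.
  have /QO[_ h2] : closure C (f x) by apply: fC; exists x.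
  by apply: h2; exists p.
have mball p : measurable (D `&` (fun x => `|f x - p.1|) @^-1` `]-oo, p.2.+1%:R^-1]).
  by apply: (mf p.1) => //; exact: measurable_itv.
have [->|[q _ ->]] := countable_enum cQ; first by rewrite bigcup_set0.
by apply: bigcupT_measurable => n; exact: mball.
Qed.

Lemma continuous_dot c : continuous (fun h : H => ip h c).
Proof.
move=> h; apply/cvgrPdist_le => e e0; near=> k.
have -> : ip h c - ip k c = ip (h - k) c.
  by rewrite dotDl -(scaleN1r k) dotZl mulN1r.
rewrite (le_trans (dot_le ip_norm _ _))//.
have c1 : 0 < `|c| + 1 by rewrite ltr_wpDl.
rewrite (@le_trans _ _ (`|h - k| * (`|c| + 1)))//.
  by rewrite ler_wpM2l// lerDl.
rewrite -ler_pdivlMr//; near: k; apply: cvgr_dist_le; first exact: cvg_id.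
by rewrite divr_gt0.
Unshelve. all: by end_near. Qed.

Lemma strongly_measurableZ {d} {T : measurableType d} (D : set T)
    (a : T -> R) (f : T -> H) : measurable_fun D a -> strongly_measurable D f ->
  strongly_measurable D (fun x => a x *: f x).
Proof.
move=> ma [mf [C cC fC]].
apply: (strongly_measurable_normP (C := [set ratr p.1 *: p.2 | p in [set: rat] `*` C])).
- apply: card_le_trans (card_image_le _ _) _.
  by apply: countableX => //; exact: countableP.
- move=> _ [x Dx <-] A /nbhs_ballP[r /= r0 rA].
  have fxC : closure C (f x) by apply: fC; exists x.
  pose k := r / 2 / (`|a x| + 1).
  have a1 : 0 < `|a x| + 1 by rewrite ltr_wpDl.
  have k0 : 0 < k by rewrite !divr_gt0.
  have [c [Cc /=]] := fxC _ (nbhsx_ballx (f x) _ k0).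
  rewrite -ball_normE/= => fc.
  pose l := r / 2 / (`|c| + 1).
  have c1 : 0 < `|c| + 1 by rewrite ltr_wpDl.
  have l0 : 0 < l by rewrite !divr_gt0.
  have al : a x < a x + l by rewrite ltrDl.
  have [q] := rat_in_itvoo al; rewrite in_itv/= => /andP[aq qa].
  have aql : `|a x - ratr q| < l by rewrite distrC ger0_norm; lra.
  exists (ratr q *: c); split; first by exists (q, c).
  apply: rA; rewrite -ball_normE/=.
  have -> : a x *: f x - ratr q *: c = a x *: (f x - c) + (a x - ratr q) *: c.
    by rewrite scalerBr scalerBl addrA subrK.
  rewrite (le_lt_trans (ler_normD _ _))// [ltRHS]splitr !normrZ.
  have kE : (`|a x| + 1) * k = r / 2 by rewrite /k; field; rewrite gt_eqF.
  have lE : l * (`|c| + 1) = r / 2 by rewrite /l; field; rewrite gt_eqF.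
  apply: ltrD.
    rewrite -kE (le_lt_trans _ (_ : (`|a x| + 1) * `|f x - c| < _)) ?ltr_pM2l//.
    by rewrite ler_wpM2r// lerDl.
  rewrite -lE (le_lt_trans _ (_ : `|a x - ratr q| * (`|c| + 1) < _)) ?ltr_pM2r//.
  by rewrite ler_wpM2l// lerDl.
- move=> c.
  (* The inner product expands the distance into products of measurable real functions, so no
     product of Borel structures is involved. *)
  have -> : (fun x => `|a x *: f x - c|) = (fun x => Num.sqrt
      (a x ^+ 2 * `|f x| ^+ 2 - 2 * (a x * ip (f x) c) + `|c| ^+ 2)).
    apply/funext => x; rewrite -[LHS]ger0_norm// -sqrtr_sqr (sqr_normB ip_norm).
    by rewrite sqr_normZ dotZl.
  apply: (measurableT_comp (continuous_measurable_fun (@sqrt_continuous R))).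
  have mn : measurable_fun D (fun x => `|f x| : R).
    by apply: (measurable_fun_borel_real mf) => h; exact: norm_continuous.
  have mi : measurable_fun D (fun x => ip (f x) c).
    exact: (measurable_fun_borel_real mf (@continuous_dot c)).
  apply: measurable_funD => //; apply: measurable_funB.
    by apply: measurable_funM; exact: measurable_funX.
  by apply: measurable_funM => //; exact: measurable_funM.
Qed.

Variable t : R.
Local Notation D := (`]0, t[%classic : set (measurableTypeR R)).
Local Notation Dy := (`[0, +oo[%classic : set (measurableTypeR R)).

Lemma L2_Linfty_scale (a : R -> R) (f : R -> H) :
  Linfty t a -> L2 D f -> L2 D (fun s => a s *: f s).
Proof.
move=> [ma [C aC]] [sf if2]; split; first exact: strongly_measurableZ.
have mn : measurable_fun D (fun x => `|f x| : R).
  by apply: (measurable_fun_borel_real sf.1) => h; exact: norm_continuous.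
apply: (@le_lt_trans _ _ (\int[mu]_(s in D) ((C ^+ 2)%:E * (`|f s| ^+ 2)%:E))%E).
  apply: ae_ge0_le_integral => //.
  - apply/measurable_EFinP/measurable_funX.
    have [mz _] := strongly_measurableZ ma sf.
    by apply: (measurable_fun_borel_real mz) => h; exact: norm_continuous.
  - by move=> x _; rewrite -EFinM lee_fin mulr_ge0 ?sqr_ge0.
  - by apply/measurable_EFinP/measurable_funM => //; exact: measurable_funX.
  - apply: (@filterS _ _ (ae_filter_ringOfSetsType mu) _ _ _ aC) => s asC Ds.
    rewrite -EFinM lee_fin normrZ exprMn ler_wpM2r ?sqr_ge0// ler_sqr ?nnegrE//.
      exact: asC.
    exact: (le_trans (normr_ge0 _) (asC Ds)).
rewrite ge0_integralZl//.
- by rewrite lte_mul_pinfty// lee_fin sqr_ge0.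
- by apply/measurable_EFinP; exact: measurable_funX.
- by rewrite lee_fin sqr_ge0.
Qed.

(** This is the argument that [wiener_integral] passes to [W], so properties of [W] on the half-line
    apply to W_t directly. *)
Definition zero_extension (f : R -> H) : R -> H :=
  fun s => if s \in `]0, t[ then f s else 0.

Lemma L2_zero_extension (f : R -> H) : L2 D f -> L2 Dy (zero_extension f).
Proof.
move=> [[mf [C cC fC]] if2]; split.
  split.
    apply: measurable_borelP => _ O oO.
    have -> : Dy `&` zero_extension f @^-1` O =
        (D `&` f @^-1` O) `|` ((Dy `\` D) `&` [set _ | O 0]).
      apply/seteqP; split=> s.
        rewrite /zero_extension => -[Dys /=]; case: ifPn => Ds Os; first by left.
        by right; split=> //; split=> //; exact/negP.
      case=> [[Ds Os]|[[Dys Ds] Os]]; split => //=.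
      - by move: Ds; rewrite /= !in_itv/= => /andP[/ltW -> _].
      - by rewrite /zero_extension ifT.
      - by rewrite /zero_extension ifF//; apply/negP.
    apply: measurableU.
      by apply: (mf _ O) => //; exact: sub_gen_smallest.
    apply: measurableI; first exact: measurableD.
    have [zO|zO] := pselect (O 0).
      by rewrite (_ : [set _ | O 0] = setT)//; apply/seteqP; split.
    by rewrite (_ : [set _ | O 0] = set0)//; apply/seteqP; split.
  exists (C `|` [set 0]).
    rewrite -bigcup2E; apply: bigcup_countable => // -[|[|n]] _ //=.
  move=> _ [s Ds <-]; rewrite /zero_extension; case: ifPn => Ds'.
    by rewrite closureU; left; apply: fC; exists s.
  by apply: subset_closure; right.
have -> : (\int[mu]_(s in Dy) (`|zero_extension f s| ^+ 2)%:E =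
    \int[mu]_(s in D) (`|f s| ^+ 2)%:E)%E.
  have -> : D = Dy `&` D.
    apply/seteqP; split=> [s Ds|s []//]; split=> //.
    by move: Ds; rewrite /= !in_itv/= => /andP[/ltW -> _].
  rewrite integral_mkcondr; apply: eq_integral => s _.
  rewrite patchE mem_setE /zero_extension; case: ifP => // _.
  by rewrite normr0 expr0n.
exact: if2.
Qed.

Lemma L2ip_zero_extension (f g : R -> H) :
  L2ip ip Dy (zero_extension f) (zero_extension g) = L2ip ip D f g.
Proof.
rewrite /L2ip; have -> : D = Dy `&` D.
  apply/seteqP; split=> [s Ds|s []//]; split=> //.
  by move: Ds; rewrite /= !in_itv/= => /andP[/ltW -> _].
rewrite Rintegral_mkcondr; apply: eq_Rintegral => s _.
rewrite patchE mem_setE /zero_extension; case: ifP => // _.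
by rewrite -(scale0r 0) dotZl mul0r.
Qed.

End L2_functions.

(** * Cosine integrals of a Gaussian pair *)

Section gaussian_pairs.
Context {R : realType} {d : measure_display} {Omega : measurableType d}.
Variable P : probability Omega R.
Variables X G : Omega -> R.
Hypothesis XG : forall a b : R, centred_gaussian P (fun w => a * X w + b * G w).

Let gX : centred_gaussian P X.
Proof.
have := XG 1 0; rewrite (_ : (fun w => _) = X)//.
by apply/funext => w; rewrite mul1r mul0r addr0.
Qed.

Let gG : centred_gaussian P G.
Proof.
have := XG 0 1; rewrite (_ : (fun w => _) = G)//.
by apply/funext => w; rewrite mul1r mul0r add0r.
Qed.

Lemma integrable_gaussian_sqr (Y : Omega -> R) : centred_gaussian P Y ->
  P.-integrable setT (EFin \o (fun w => Y w ^+ 2)).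
Proof.
move=> gY; have [iY _] := centred_gaussian_stein gY.
have := integrable_cube_le (isT : 2 <= 3)%N gY.1 iY; apply: eq_integrable => //.
by move=> w _ /=; rewrite real_normK ?num_real.
Qed.

Lemma gaussian_pair_char (b th : R) :
  \int[P]_w cos (X w + b * G w + th) =
  cos th * expR (- (\int[P]_w (X w ^+ 2) + 2 * b * \int[P]_w (X w * G w) +
    b ^+ 2 * \int[P]_w (G w ^+ 2)) / 2).
Proof.
have gY : centred_gaussian P (fun w => X w + b * G w).
  by have := XG 1 b; under eq_fun do rewrite mul1r.
rewrite (centred_gaussian_cos gY); congr (_ * expR (- _ / 2)).
have iX := integrable_gaussian_sqr gX; have iG := integrable_gaussian_sqr gG.
have iXG : P.-integrable setT (EFin \o (fun w => X w * G w)).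
  apply: (@le_integrable_norm _ _ _ P setT measurableT _ (fun w => X w ^+ 2 + G w ^+ 2)).
  - by apply: measurable_funM; [exact: gX.1|exact: gG.1].
  - move=> w _; rewrite normrM -(real_normK (num_real (X w))) -(real_normK (num_real (G w))).
    by move: `|X w| `|G w| => p q; have := sqr_ge0 (p - q); have := sqr_ge0 (p + q);
      rewrite sqrrB sqrrD; lra.
  - by have := integrableD measurableT iX iG; apply: eq_integrable.
have i2 : P.-integrable setT (EFin \o (fun w => 2 * b * (X w * G w))).
  by have := integrableZl measurableT (2 * b) iXG; apply: eq_integrable.
have i3 : P.-integrable setT (EFin \o (fun w => b ^+ 2 * G w ^+ 2)).
  by have := integrableZl measurableT (b ^+ 2) iG; apply: eq_integrable.
have i12 : P.-integrable setT (EFin \o (fun w => X w ^+ 2 + 2 * b * (X w * G w))).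
  by have := integrableD measurableT iX i2; apply: eq_integrable.
rewrite -[X in _ + X + _]RintegralZl// -[X in _ + X]RintegralZl//.
rewrite -RintegralD// -RintegralD//.
by apply: eq_Rintegral => w _; ring.
Qed.

End gaussian_pairs.

Lemma expectationE {R : realType} {d} {Omega : measurableType d}
    (P : probability Omega R) (f : Omega -> R) :
  fine ('E_P[f])%E = \int[P]_w f w.
Proof. by rewrite unlock. Qed.

(** * The control reaches S(t) xi *)

Section control_operator.
Context {R : realType} {E H : completeNormedModType R}.
Variable ip : {dot H for (@idfun R)}.
Hypothesis ip_norm : forall h : H, ip h h = `|h| ^+ 2.
Variable S : R -> {linear E -> E}.
Hypothesis S_semigroup : C0_semigroup S.
Variable B : {linear H -> E}.
Hypothesis B_bounded : continuous B.
Variables (t : R) (xi : E) (a a' : R -> R).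
Hypothesis t0 : 0 < t.
Hypothesis xi_admissible : admissible_direction ip S B t xi.
Hypothesis a_W1infty : W1infty t a a'.
Hypothesis a_boundary : boundary_values t a 0 1.
Notation mu := (@lebesgue_measure R).
Local Notation D := (`]0, t[%classic : set (measurableTypeR R)).

(** Where B [Bdagger] (S(s) xi) = S(s) xi, the semigroup law S(t - s) S(s) = S(t) makes the
    integrand a'(s) S(t) xi, and a' has integral 1. *)
Lemma convolution_operator_control (xs : {linear E -> R^o}) : continuous xs ->
  xs (convolution_operator S B t (control ip S B a' xi)) = xs (S t xi).
Proof.
move=> cxs; pose u s := Bdagger ip B (S s xi).
have [xi_range [[mu_u _] _]] := xi_admissible.
have [_ a'L _] := a_W1infty.
have mD : measurable D by [].
(* A Borel substitute for the set where S(s) xi lies in the range of [B]: by [B_Bdagger] the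
   identity for the integrand holds at every point of [D] once a' is multiplied by the indicator of
   [A]. *)
pose A := D `&` u @^-1` [set~ 0].
have mA : measurable (A : set (measurableTypeR R)).
  apply: (mu_u mD [set~ 0]); apply: sub_gen_smallest; apply: closed_openC.
  exact: (accessible_closed_set1 (hausdorff_accessible (@norm_hausdorff _ H))).
pose c s := a' s * \1_A s.
pose g s := S (t - s) (B (control ip S B a' xi s)).
have gE s : D s -> g s = c s *: S t xi.
  move=> Ds; have := Ds; rewrite /= in_itv/= => /andP[s0 st].
  rewrite /g /control linearZ/= (B_Bdagger ip_norm B_bounded) -/(u s) /c indicE.
  have [us|us] := eqVneq (u s) 0.
    by rewrite scaler0 linear0 memNset//= ?mulr0 ?scale0r// => -[_]; apply.
  rewrite mem_set//=; last by split=> //; exact/eqP.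
  by rewrite mulr1 linearZ/= -(C0_D S_semigroup) ?subrK ?subr_ge0 ?ltW.
have ia' := integrable_Linfty t0 a'L.
have mc : measurable_fun D c.
  by apply: measurable_funM; [exact: a'L.1|exact: measurable_indic].
have ic : mu.-integrable D (EFin \o c).
  apply: (le_integrable_norm mD mc _ (integrable_norm ia')) => s Ds.
  rewrite /c normrM ler_piMr// indicE.
  by case: (s \in A); rewrite ?normr1 ?normr0.
have finD : (mu D < +oo)%E.
  by rewrite [mu _]lebesgue_measure_itv/= lte_fin t0 -EFinB ltry.
(* If S(t) xi is nonzero, so is S(s) xi for every s < t by the semigroup law; hence almost every s
   lies in [A] and c = a' almost everywhere. If S(t) xi = 0 the integral of [c] does not matter. *)
have cS : (\int[mu]_(s in D) c s) *: S t xi = S t xi.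
  have [->|Stxi] := eqVneq (S t xi) 0; first by rewrite scaler0.
  rewrite (@ae_eq_Rintegral _ _ _ mu D mD c a' mc a'L.1).
    by rewrite (integral_weak_derivative t0 a_W1infty a_boundary) scale1r.
  apply: (@filterS _ _ (ae_filter_ringOfSetsType mu) _ _ _ xi_range) => s sB Ds.
  rewrite /c indicE mem_set ?mulr1//; split=> //=; apply/eqP.
  apply: (Bdagger_neq0 ip_norm B_bounded); first exact: sB.
  apply: contra_neq Stxi => Ss0; move: Ds; rewrite /= in_itv/= => /andP[s0 st].
  by rewrite -(subrK s t) (C0_D S_semigroup) ?subr_ge0 ?(ltW s0) ?(ltW st)// Ss0 linear0.
have gb : is_bochner_integral D g (S t xi).
  by rewrite -cS; exact: bochner_integral_line.
(* [gb] shows that an integral exists, so [xget] does not return its default. *)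
have convb : is_bochner_integral D g (convolution_operator S B t (control ip S B a' xi)).
  rewrite /convolution_operator /bochner_integral; case: xgetP => [z -> //|/(_ (S t xi))].
  by case.
rewrite (bochner_integral_functional mD convb cxs).
by rewrite (bochner_integral_functional mD gb cxs).
Qed.

End control_operator.

(** * Differentiation under the expectation for smooth functions *)

Section smooth_functions.
Context {R : realType} {E : normedModType R}.

Lemma is_derive_line (f : E -> R) (z y : E) (r : R) :
  differentiable f (z + r *: y) ->
  is_derive r 1 (fun r => f (z + r *: y)) ('d f (z + r *: y) y).
Proof.
move=> df; pose u r := f (z + r *: y).
have uE : (fun h : R => h^-1 *: ((u \o shift r) (h *: 1) - u r)) =
    (fun h : R => h^-1 *: ((f \o shift (z + r *: y)) (h *: y) - f (z + r *: y))).
  apply/funext => h; rewrite /u/= scalerDl addrCA (addrC (h *: y)).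
  by rewrite [h *: (1 : R)]mulr1 addrC.
split; first by rewrite /derivable uE; exact: diff_derivable.
by rewrite /derive uE; exact: (deriveE y df).
Qed.

Context {d : measure_display} {Omega : measurableType d}.
Variable P : probability Omega R.

(** The mean value theorem bounds all difference quotients by [C * |y|], so dominated convergence
    applies. *)
Lemma is_derive_Rintegral_line (f : E -> R) (M C : R) (X : Omega -> E) (y : E) :
  (forall z, `|f z| <= M) -> (forall z, differentiable f z) ->
  (forall z h, `|'d f z h| <= C * `|h|) ->
  measurable_fun setT (X : Omega -> borelType E) ->
  is_derive (0 : R) 1 (fun e => \int[P]_w f (X w + e *: y))
    (\int[P]_w 'd f (X w) y).
Proof.
move=> fM df dfC mX.
have dline z r := @is_derive_line f z y r (df _).
have mfX (e : R) : measurable_fun setT (fun w => f (X w + e *: y)).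
  apply: (measurable_fun_borel_real (g := fun z => f (z + e *: y)) mX) => z.
  apply: (@continuous_comp _ _ _ (fun z => z + e *: y) f).
    by apply: cvgD; [exact: cvg_id|exact: cvg_cst].
  exact: differentiable_continuous.
have ifX (e : R) : P.-integrable setT (EFin \o (fun w => f (X w + e *: y))).
  by apply: (@bounded_integrable _ _ _ P _ M) => // w; exact: fM.
pose u e := \int[P]_w f (X w + e *: y).
have cu : h^-1 *: ((u \o shift 0) (h *: 1) - u 0) @[h --> (0 : R)^'] -->
    \int[P]_w 'd f (X w) y.
  (* Dominated convergence is sequential, so the limit is tested along sequences of nonzero
     steps. *)
  apply/cvgr_dnbhsP => h [h0 hcv].
  have -> : (fun n => (h n)^-1 *: ((u \o shift 0) (h n *: 1) - u 0)) =
      (fun n => \int[P]_w ((h n)^-1 * (f (X w + h n *: y) - f (X w + (0 : R) *: y)))).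
    apply/funext => n; rewrite /= addr0 [h n *: (1 : R)]mulr1 RintegralZl//.
      by rewrite RintegralB.
    by have := integrableB measurableT (ifX (h n)) (ifX 0); apply: eq_integrable.
  apply: (@Rintegral_dominated_cvg _ _ _ P setT measurableT _ _ (cst (C * `|y|)) _ _ _ _).2.
  - by move=> n; apply: measurable_funM => //; exact: measurable_funB.
  - exact: finite_measure_integrable_cst.
  - move=> n w _.
    have [c _ ->] := MVT_is_derive 0 (h n) (dline (X w)).
    by rewrite subr0 mulrC mulfK.
  - move=> w _; have [dw] := dline (X w) 0.
    rewrite [in X in _ = X]scale0r addr0 => <-.
    have /cvgr_dnbhsP/(_ h (conj h0 hcv)) := dw.
    by under eq_fun do rewrite /= addr0 [h _ *: (1 : R)]mulr1.
split; first by apply/cvg_ex; eexists; exact: cu.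
by apply/cvg_lim => //; exact: cu.
Qed.

End smooth_functions.

Theorem theorem5p3 (R : realType) (E H : completeNormedModType R)
    (ip : {dot H for (@idfun R)}) (ip_norm : forall h : H, ip h h = `|h| ^+ 2)
    (H_separable : separable H)
    (S : R -> {linear E -> E}) (S_semigroup : C0_semigroup S)
    (B : {linear H -> E}) (B_bounded : continuous B)
    (d : measure_display) (Omega : measurableType d) (P : probability Omega R)
    (WH : R -> H -> Omega -> R)
    (WH_cylindrical : cylindrical_brownian_motion ip P WH)
    (SB_integrable : forall T : R, 0 < T ->
       stochastically_integrable ip (SB_on S B T))
    (W : (R -> H) -> Omega -> R) (W_extension : isonormal_extension ip P WH W)
    (t : R) (t_gt0 : 0 < t) (x xi : E)
    (xi_admissible : admissible_direction ip S B t xi)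
    (a a' : R -> R) (a_W1infty : W1infty t a a')
    (a_boundary : boundary_values t a 0 1)
    (WA : Omega -> E)
    (WA_convolution : is_stochastic_convolution ip S B P W t WA) :
  (forall f : E -> R, bounded_borel f ->
     let u := fun eps : R => transition S P WA t f (x + eps *: xi) in
     derivable u 0 1 /\
     derive1 u 0 = fine 'E_P[fun w => (f (mild_solution S WA t x w) *
                 wiener_integral W t (control ip S B a' xi) w)%R]%E) /\
  (forall f : E -> R, C1b f ->
     let u := fun eps : R => transition S P WA t f (x + eps *: xi) in
     derivable u 0 1 /\
     derive1 u 0 = fine 'E_P[fun w => 'd f (mild_solution S WA t x w) (S t xi)]%E).
Proof.
have [WA_sm WA_gauss] := WA_convolution.
have [W_iso _] := W_extension.
have [_ a'L _] := a_W1infty.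
pose v := control ip S B a' xi.
pose G := wiener_integral W t v.
pose y := S t xi.
have vL2 : L2 (`]0, t[ : set (measurableTypeR R)) v.
  exact: (L2_Linfty_scale ip_norm a'L xi_admissible.2).
have ve := L2_zero_extension vL2.
(* Joint normality of W_t g and [G] is the two-dimensional case of the isonormal property. *)
have gauss g : L2 (`]0, t[ : set (measurableTypeR R)) g -> forall p q : R,
    centred_gaussian P (fun w => p * wiener_integral W t g w + q * G w).
  move=> gL2 p q; have ge := L2_zero_extension gL2.
  have := isonormal_gaussian W_iso
    (f := fun i : 'I_2 => if i == ord0 then zero_extension t g else zero_extension t v).
  move=> /(_ _ (fun i => if i == ord0 then p else q)).
  rewrite (_ : (fun w => _) = fun w => p * wiener_integral W t g w + q * G w).
    by apply; move=> i; case: ifP.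
  by apply/funext => w; rewrite !big_ord_recl big_ord0 addr0.
have gG : centred_gaussian P G.
  have := gauss v vL2 0 1.
  by under eq_fun do rewrite mul0r add0r mul1r.
have mG := gG.1.
have [iG _] := centred_gaussian_stein gG.
have char_fun (xs : {linear E -> R^o}) : continuous xs -> exists s : R,
    forall b th : R, \int[P]_w cos ((xs (WA w) : R) + b * G w + th) =
      cos th * expR (- (s + 2 * b * xs y + b ^+ 2 * \int[P]_w (G w ^+ 2)) / 2).
  move=> cxs; have [gxs [g [gL2 gR gW]]] := WA_gauss _ cxs.
  have ge := L2_zero_extension gL2.
  (* <WA, x*> agrees with [X1] only almost surely; the computation is done for [X1] and transferred
     at the end. *)
  pose X1 := wiener_integral W t g.
  (* The covariance is (g | v), and [g] represents the adjoint of the convolution operator at [xs],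
     so it equals <R_t v, x*>. *)
  have X1G : \int[P]_w (X1 w * G w) = xs y.
    have := isonormal_covariance W_iso ge ve.
    move=> /(congr1 fine); rewrite expectationE /= => ->.
    rewrite L2ip_zero_extension gR//.
    exact: (convolution_operator_control ip_norm S_semigroup B_bounded t_gt0
      xi_admissible a_W1infty a_boundary cxs).
  have mX1 : measurable_fun setT X1.
    have [+ _] := gauss g gL2 1 0.
    by under eq_fun do rewrite mul1r mul0r addr0.
  exists (\int[P]_w (X1 w ^+ 2)) => b th.
  rewrite -X1G -(gaussian_pair_char (gauss g gL2)).
  have mcos (X : Omega -> R) : measurable_fun setT X ->
      measurable_fun setT (fun w => cos (X w + b * G w + th)).
    move=> mX; apply: measurable_fun_cos; apply: measurable_funD => //.
    by apply: measurable_funD => //; exact: measurable_funM.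
  apply: ae_eq_Rintegral => //; [exact: (mcos _ gxs.1)|exact: mcos|].
  by apply: filterS gW => w -> _.
(* By linearity of S(t), moving the starting point along [xi] shifts [WA] along [y]. *)
have uE (f : E -> R) : (fun eps : R => transition S P WA t f (x + eps *: xi)) =
    (fun eps => \int[P]_w f (S t x + (WA w + eps *: y))).
  apply/funext => eps; rewrite /transition expectationE.
  by apply: eq_Rintegral => w _; rewrite /mild_solution linearD linearZ/= addrA addrAC.
split=> f.
- move=> [mf [C fC]]; rewrite uE; cbv zeta.
  have mF : measurable_fun setT ((fun z => f (S t x + z)) : borelType E -> R).
    have mT : measurable_fun setT ((fun z : E => S t x + z) : borelType E -> borelType E).
      apply: (@measurable_borelP _ _ E) => _ O oO; rewrite setTI.
      apply: sub_gen_smallest; move: O oO; apply/continuousP => z.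
      by apply: cvgD; [exact: cvg_cst|exact: cvg_id].
    exact: (measurableT_comp mf mT).
  have [dF dFE] := is_derive_gaussian_shift WA_sm mG iG char_fun mF (fun z => fC _).
  by split=> //; rewrite derive1E dFE expectationE.
- move=> [[M fM] df [C dfC] _]; rewrite uE; cbv zeta.
  have mX : measurable_fun setT ((fun w => S t x + WA w) : Omega -> borelType E).
    apply: (measurable_fun_borel_continuous (g := fun z => S t x + z) WA_sm.1) => z.
    by apply: cvgD; [exact: cvg_cst|exact: cvg_id].
  have [dF dFE] := is_derive_Rintegral_line P y fM df dfC mX.
  under eq_fun do under eq_Rintegral do rewrite addrA.
  by split=> //; rewrite derive1E dFE expectationE.
Qed.
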